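(* Let $S=S^r_{F,\mathcal K}$ be a Drinfeld modular variety. For every sequence $(X_n)$ of pairwise distinct Drinfeld modular subvarieties of $S$ all having the same reflex field $F'$, the indices $i(X_n)$ are unbounded.
   Context: Let $F$ be a global function field with field of constants $\mathbb{F}_q$, $\infty$ a fixed place, $A$ the ring of elements regular outside $\infty$. $\mathbb{A}_F^f$ = finite adeles (outside $\infty$), $\mathbb C_\infty$ the completion of an algebraic closure of $F_\infty$. $\Omega_F^r=\mathbb P^{r-1}(\mathbb C_\infty)\setminus\{F_\infty\text{-rational hyperplanes}\}$, points $\bar\omega$ = injective $F_\infty$-linear maps $\omega:F_\infty^r\to\mathbb C_\infty$ mod $\mathbb C_\infty^*$, $\mathrm{GL}_r(F)$ acting by $T\cdot\bar\omega=\overline{\omega\circ T^{-1}}$. For compact open $\mathcal K\subset\mathrm{GL}_r(\mathbb A_F^f)$ the Drinfeld modular variety $S^r_{F,\mathcal K}$ is the normal affine variety over $F$ of dimension $r-1$ with $S^r_{F,\mathcal K}(\mathbb C_\infty)=\mathrm{GL}_r(F)\backslash(\Omega^r_F\times\mathrm{GL}_r(\mathbb A_F^f)/\mathcal K)$. Inclusions: for a finite extension $F'\subset\mathbb C_\infty$ of $F$ of degree $r/r'$ with one place above $\infty$ and an $\mathbb A_F^f$-linear isomorphism $b:(\mathbb A_F^f)^r\to(\mathbb A_{F'}^f)^{r'}$, put $\mathcal K'=b\mathcal Kb^{-1}\cap\mathrm{GL}_{r'}(\mathbb A^f_{F'})$; $\iota^{F'}_{F,b}:S^{r'}_{F',\mathcal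 K'}\to S^r_{F,\mathcal K}$, $[(\bar\omega',h')]\mapsto[(\overline{\omega'\circ\phi},\phi^{-1}\circ h'\circ b)]$ ($\phi:F^r\to F'^{r'}$ any $F$-linear isomorphism) is a finite morphism over $F'$; its image is a Drinfeld modular subvariety with reflex field $F'$. The index $i(X)$ of $X=\iota^{F'}_{F,b}(S^{r'}_{F',\mathcal K'})$ is the index of $\mathcal K'$ in a maximal compact subgroup of $\mathrm{GL}_{r'}(\mathbb A^f_{F'})$ containing it. *)

(* Defs.v *)
From HB Require Import structures.
From mathcomp Require Import all_boot all_order all_algebra all_field.
From mathcomp Require Import all_classical all_reals.
From mathcomp Require Import topology.

Set Implicit Arguments.
Unset Strict Implicit.
Unset Printing Implicit Defensive.

Import Order.TTheory GRing.Theory Num.Theory.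
Local Open Scope classical_set_scope.
Local Open Scope ring_scope.

(* The constant field is an explicit [k]; a global function field over [k] is a
   finite extension of the rational function field k(T). *)
Definition constant_embedding (k : finFieldType)
  (F : fieldExtType {fraction {poly k}}) : k -> F :=
  fun c => (tofrac c%:P)%:A.

Definition full_constant_field (k : finFieldType)
    (F : fieldExtType {fraction {poly k}}) : Prop :=
  forall x : F, algebraicOver (@constant_embedding k F) x ->
    exists c : k, x = constant_embedding F c.

(* A normalized discrete valuation.  The value at 0, which should be +oo, is
   fixed to the junk value 0 so that two places are equal as soon as they agree
   on nonzero elements; [vge] below restores the convention v(0) = +oo. The
   places of a function field with finite constant field are exactly its
   normalized discrete valuations: such a valuation is automatically trivial on
   the constants, which are 0 and roots of unity. *)
Record place (E : fieldType) : Type := Place {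
  val_of :> E -> int;
  val_zero : val_of 0 = 0;
  val_mul : forall x y, x != 0 -> y != 0 -> val_of (x * y) = val_of x + val_of y;
  val_add : forall x y, x != 0 -> y != 0 -> x + y != 0 ->
    Num.min (val_of x) (val_of y) <= val_of (x + y);
  val_surj : exists2 x, x != 0 & val_of x = 1
}.

Definition vge (E : fieldType) (v : place E) (N : int) (x : E) : bool :=
  (x == 0) || (N <= v x).

Record completion (E : fieldType) (v : place E) : Type := Completion {
  cfield :> fieldType;
  cval : place cfield;
  cemb : {rmorphism E -> cfield};
  cval_emb : forall x, cval (cemb x) = v x;
  cdense : forall (a : cfield) (N : int), exists x : E, vge cval N (a - cemb x);
  ccomplete : forall u : nat -> cfield,
    (forall N : int, exists m, forall i j, (m <= i)%N -> (m <= j)%N ->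
       vge cval N (u i - u j)) ->
    exists l, forall N : int, exists m, forall i, (m <= i)%N ->
       vge cval N (u i - l)
}.

Definition lies_over (F : fieldType) (L : fieldExtType F)
    (w : place L) (v : place F) : Prop :=
  exists2 e : nat, (0 < e)%N & forall x : F, w x%:A = e%:Z * v x.

Definition fplace (E : fieldType) (inf : place E) : Type :=
  {v : place E | v <> inf}.

Lemma vge0 (E : fieldType) (v : place E) N : vge v N 0.
Proof. by rewrite /vge eqxx. Qed.

Lemma vgeD (E : fieldType) (v : place E) N x y :
  vge v N x -> vge v N y -> vge v N (x + y).
Proof.
rewrite /vge.
have [->|x0] := eqVneq x 0; first by rewrite add0r.
have [->|y0] := eqVneq y 0; first by rewrite addr0 (negbTE x0).
have [//|xy0] := eqVneq (x + y) 0.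
move=> /= Nx Ny; apply: (le_trans _ (val_add v x0 y0 xy0)).
by rewrite le_min Nx Ny.
Qed.

Lemma val1 (E : fieldType) (v : place E) : v 1 = 0.
Proof.
have := val_mul v (oner_neq0 E) (oner_neq0 E); rewrite mulr1 => h.
by apply: (addrI (v 1)); rewrite addr0 -h.
Qed.

Lemma vgeN (E : fieldType) (v : place E) N x : vge v N (- x) = vge v N x.
Proof.
rewrite /vge oppr_eq0; case: eqVneq => //= x0.
have N10 : (-1 : E) != 0 by rewrite oppr_eq0 oner_eq0.
have vN1 : v (-1) = 0.
  have := val_mul v N10 N10; rewrite mulrNN mulr1 val1 => /esym/eqP.
  by rewrite -mulr2n mulrn_eq0 /= => /eqP.
by rewrite -mulN1r (val_mul v N10 x0) vN1 add0r.
Qed.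

Lemma vgeM (E : fieldType) (v : place E) M N x y :
  vge v M x -> vge v N y -> vge v (M + N) (x * y).
Proof.
rewrite /vge.
have [->|x0] := eqVneq x 0; first by rewrite mul0r eqxx.
have [->|y0] := eqVneq y 0; first by rewrite mulr0 eqxx.
by move=> /= hM hN; rewrite mulf_eq0 (negbTE x0) (negbTE y0) /= val_mul// lerD.
Qed.

Lemma vge_le (E : fieldType) (v : place E) M N x :
  M <= N -> vge v N x -> vge v M x.
Proof. by rewrite /vge => MN /orP[->//|h]; rewrite (le_trans MN h) orbT. Qed.

(* The ring of adeles of E away from inf, as the restricted product of the
   completions at all other places. *)
Section Adeles.
Context (E : fieldType) (inf : place E) (Ehat : forall v : place E, completion v).

Record adele : Type := Adele {
  adele_at :> forall v : fplace inf, Ehat (sval v);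
  adele_int : finite_set [set v | ~~ vge (cval (Ehat (sval v))) 0 (adele_at v)]
}.

Lemma adele_eq (a b : adele) : (forall v, a v = b v) -> a = b.
Proof.
case: a b => [a ha] [b hb] /= ab.
have e : a = b by apply: functional_extensionality_dep.
by subst b; congr Adele; apply: Prop_irrelevance.
Qed.

Definition adele0 : adele.
Proof.
by exists (fun v => 0); apply: sub_finite_set (finite_set0 _) => v /=; rewrite vge0.
Defined.

Definition adele1 : adele.
Proof.
exists (fun v => 1); apply: sub_finite_set (finite_set0 _) => v /=.
by rewrite /vge val1 lexx orbT.
Defined.

Definition adele_opp (a : adele) : adele.
Proof.
exists (fun v => - a v); apply: sub_finite_set (adele_int a) => v /=.
by rewrite vgeN.
Defined.

Definition adele_add (a b : adele) : adele.
Proof.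
exists (fun v => a v + b v).
have : finite_set ([set v | ~~ vge (cval (Ehat (sval v))) 0 (a v)]
   `|` [set v | ~~ vge (cval (Ehat (sval v))) 0 (b v)]).
  by rewrite finite_setU; split; apply: adele_int.
apply: sub_finite_set => v /= h.
have [av|av] := boolP (vge (cval (Ehat (sval v))) 0 (a v)); last by left.
by right; apply: contra h => bv; apply: vgeD.
Defined.

Definition adele_mul (a b : adele) : adele.
Proof.
exists (fun v => a v * b v).
have : finite_set ([set v | ~~ vge (cval (Ehat (sval v))) 0 (a v)]
   `|` [set v | ~~ vge (cval (Ehat (sval v))) 0 (b v)]).
  by rewrite finite_setU; split; apply: adele_int.
apply: sub_finite_set => v /= h.
have [av|av] := boolP (vge (cval (Ehat (sval v))) 0 (a v)); last by left.
by right; apply: contra h => bv; rewrite -[0]addr0; apply: vgeM.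
Defined.

HB.instance Definition _ := gen_eqMixin adele.
HB.instance Definition _ := gen_choiceMixin adele.

Fact adele_addA : associative adele_add.
Proof. by move=> a b c; apply: adele_eq => v /=; rewrite addrA. Qed.
Fact adele_addC : commutative adele_add.
Proof. by move=> a b; apply: adele_eq => v /=; rewrite addrC. Qed.
Fact adele_add0 : left_id adele0 adele_add.
Proof. by move=> a; apply: adele_eq => v /=; rewrite add0r. Qed.
Fact adele_addN : left_inverse adele0 adele_opp adele_add.
Proof. by move=> a; apply: adele_eq => v /=; rewrite addNr. Qed.
HB.instance Definition _ :=
  GRing.isZmodule.Build adele adele_addA adele_addC adele_add0 adele_addN.

Fact adele_mulA : associative adele_mul.
Proof. by move=> a b c; apply: adele_eq => v /=; rewrite mulrA. Qed.
Fact adele_mulC : commutative adele_mul.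
Proof. by move=> a b; apply: adele_eq => v /=; rewrite mulrC. Qed.
Fact adele_mul1 : left_id adele1 adele_mul.
Proof. by move=> a; apply: adele_eq => v /=; rewrite mul1r. Qed.
Fact adele_mulD : left_distributive adele_mul adele_add.
Proof. by move=> a b c; apply: adele_eq => v /=; rewrite mulrDl. Qed.
HB.instance Definition _ := GRing.Zmodule_isComPzRing.Build adele
  adele_mulA adele_mulC adele_mul1 adele_mulD.

(* The restricted product topology: the sets a + \prod_v pi_v^(n v) O_v, with
   n v = 0 for almost all v, form a neighbourhood basis of a. *)
Definition adele_box (n : fplace inf -> nat) (a : adele) : set adele :=
  [set b | forall v, vge (cval (Ehat (sval v))) (n v) (b v - a v)].

Definition adele_open (U : set adele) : Prop :=
  forall a, U a -> exists2 n : fplace inf -> nat,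
    finite_set [set v | n v != 0%N] & adele_box n a `<=` U.

Fact adele_openT : adele_open setT.
Proof.
move=> a _; exists (fun=> 0%N) => //.
by apply: sub_finite_set (finite_set0 _) => v /=.
Qed.

Fact adele_openI : setI_closed adele_open.
Proof.
move=> U V oU oV a [/oU[m fm mU] /oV[n fn nV]].
exists (fun v => maxn (m v) (n v)).
  have : finite_set ([set v | m v != 0%N] `|` [set v | n v != 0%N]).
    by rewrite finite_setU.
  apply: sub_finite_set => v /=; have [->|m0] := eqVneq (m v) 0%N.
    by rewrite max0n; right.
  by left.
move=> b hb; split.
  by apply: mU => v; apply: vge_le (hb v); rewrite lez_nat leq_maxl.
by apply: nV => v; apply: vge_le (hb v); rewrite lez_nat leq_maxr.
Qed.

Fact adele_open_bigU (I : Type) (f : I -> set adele) :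
  (forall i, adele_open (f i)) -> adele_open (\bigcup_i f i).
Proof.
move=> of_ a [i _ /of_[n fn nf]]; exists n => // b /nf fib; exists i => //.
Qed.

HB.instance Definition _ := isOpenTopological.Build adele
  adele_openT adele_openI adele_open_bigU.

End Adeles.

(* GL_n over a possibly zero commutative ring. *)
Record GL (R : comPzRingType) (n : nat) : Type := MkGL {
  GLmx :> 'M[R]_n;
  GLinvmx : 'M[R]_n;
  GLmulV : GLmx *m GLinvmx = 1%:M;
  GLmulVl : GLinvmx *m GLmx = 1%:M
}.

Section GLGroup.
Context (R : comPzRingType) (n : nat).

Lemma GL_eq (g h : GL R n) : GLmx g = GLmx h -> g = h.
Proof.
case: g h => [g g' gV gVl] [h h' hV hVl] /= gh; subst h.
have e : g' = h' by rewrite -[g']mulmx1 -hV mulmxA gVl mul1mx.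
by subst h'; congr MkGL; apply: Prop_irrelevance.
Qed.

HB.instance Definition _ := gen_eqMixin (GL R n).
HB.instance Definition _ := gen_choiceMixin (GL R n).

Definition GL_one : GL R n := MkGL (mulmx1 1%:M) (mulmx1 1%:M).
Definition GL_inv (g : GL R n) : GL R n := MkGL (GLmulVl g) (GLmulV g).
Definition GL_mul (g h : GL R n) : GL R n.
Proof.
exists (GLmx g *m GLmx h) (GLinvmx h *m GLinvmx g).
  by rewrite mulmxA -(mulmxA (GLmx g)) GLmulV mulmx1 GLmulV.
by rewrite mulmxA -(mulmxA (GLinvmx h)) GLmulVl mulmx1 GLmulVl.
Defined.

Fact GL_mulA : associative GL_mul.
Proof. by move=> a b c; apply: GL_eq; rewrite /= mulmxA. Qed.
Fact GL_mul1g : left_id GL_one GL_mul.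
Proof. by move=> a; apply: GL_eq; rewrite /= mul1mx. Qed.
Fact GL_mulg1 : right_id GL_one GL_mul.
Proof. by move=> a; apply: GL_eq; rewrite /= mulmx1. Qed.
Fact GL_mulVg : left_inverse GL_one GL_inv GL_mul.
Proof. by move=> a; apply: GL_eq; rewrite /= GLmulVl. Qed.
Fact GL_mulgV : right_inverse GL_one GL_inv GL_mul.
Proof. by move=> a; apply: GL_eq; rewrite /= GLmulV. Qed.
End GLGroup.

HB.instance Definition _ (R : comPzRingType) (n : nat) :=
  isGroup.Build (GL R n) (@GL_mulA R n) (@GL_mul1g R n) (@GL_mulg1 R n)
    (@GL_mulVg R n) (@GL_mulgV R n).

(* The topology of GL_n of the adeles is the one making g |-> (g, g^-1) an
   embedding into M_n x M_n; inversion is not continuous for the topology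
   induced by M_n alone. *)
Definition GL_pair (R : comPzRingType) (n : nat) (g : GL R n) :
  'M[R]_n * 'M[R]_n := (GLmx g, GLinvmx g).

HB.instance Definition _ (E : fieldType) (inf : place E)
    (Ehat : forall v : place E, completion v) (n : nat) :=
  Topological.copy (GL (adele inf Ehat) n)
    (initial_topology (@GL_pair (adele inf Ehat) n)).

Definition subgroup (G : groupType) (H : set G) : Prop :=
  H 1%g /\ forall x y, H x -> H y -> H (x^-1 * y)%g.

Definition compact_subgroup (E : fieldType) (inf : place E)
    (Ehat : forall v : place E, completion v) (n : nat)
    (M : set (GL (adele inf Ehat) n)) : Prop :=
  subgroup M /\ compact M.

Definition maximal_compact_subgroup (E : fieldType) (inf : place E)
    (Ehat : forall v : place E, completion v) (n : nat)
    (M : set (GL (adele inf Ehat) n)) : Prop :=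
  compact_subgroup M /\
  forall N : set (GL (adele inf Ehat) n), compact_subgroup N -> M `<=` N -> N = M.

Definition has_index (G : groupType) (M H : set G) (i : nat) : Prop :=
  ([set [set (x * h)%g | h in H] | x in M] #= `I_i)%card.

Record level (E : fieldType) (inf : place E)
    (Ehat : forall v : place E, completion v) (r : nat) : Type := Level {
  level_set : set (GL (adele inf Ehat) r);
  level_subgroup : subgroup level_set;
  level_open : open level_set;
  level_compact : compact level_set
}.

Definition local_field (E : fieldType) (R : realType) (C : fieldType)
    (absC : C -> R) (j : E -> C) : set C :=
  [set z | forall eps : R, 0 < eps -> exists x : E, absC (z - j x) < eps].

(* C, with the absolute value absC and the embedding j of E, is the completion
   of an algebraic closure of E_inf: C is algebraically closed and complete, so
   the closure E_inf of j(E) in C is a completion of E at inf, the elements of C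
   algebraic over E_inf form an algebraic closure of E_inf, and the latter is
   dense in C. *)
Record is_Cinfty (E : fieldType) (inf : place E) (R : realType)
    (C : closedFieldType) (absC : C -> R) (j : {rmorphism E -> C}) : Prop := {
  absC_ge0 : forall x, 0 <= absC x;
  absC_eq0 : forall x, absC x = 0 <-> x = 0;
  absC_mul : forall x y, absC (x * y) = absC x * absC y;
  absC_ultra : forall x y, absC (x + y) <= Num.max (absC x) (absC y);
  absC_inf : exists2 c : R, 1 < c &
    forall x : E, x != 0 -> absC (j x) = c ^ (- inf x);
  absC_complete : forall u : nat -> C,
    (forall eps : R, 0 < eps -> exists m, forall p q, (m <= p)%N -> (m <= q)%N ->
       absC (u p - u q) < eps) ->
    exists l, forall eps : R, 0 < eps -> exists m, forall p, (m <= p)%N ->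
       absC (u p - l) < eps;
  absC_dense : forall (z : C) (eps : R), 0 < eps ->
    exists y : C,
      (exists p : {poly C}, [/\ p != 0,
         (forall i, local_field absC j p`_i) & root p y]) /\
      absC (z - y) < eps
}.

(* An injective E_inf-linear map omega : E_inf^r -> C, encoded by the row of the
   images of the standard basis; omega o T is then the product by the matrix T.
   A point of Omega^r is such a row up to C^*; the identification modulo C^* is
   performed in [drinfeld_equiv]. *)
Record frame (E : fieldType) (R : realType) (C : fieldType)
    (absC : C -> R) (j : E -> C) (r : nat) : Type := Frame {
  frame_row :> 'rV[C]_r;
  frame_inj : forall a : 'cV[C]_r, (forall i, local_field absC j (a i 0)) ->
    frame_row *m a = 0 -> a = 0
}.

HB.instance Definition _ (E : fieldType) (R : realType) (C : fieldType)
    (absC : C -> R) (j : E -> C) (r : nat) := gen_eqMixin (frame absC j r).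
HB.instance Definition _ (E : fieldType) (R : realType) (C : fieldType)
    (absC : C -> R) (j : E -> C) (r : nat) := gen_choiceMixin (frame absC j r).

Definition mx_at (E : fieldType) (inf : place E)
    (Ehat : forall v : place E, completion v) (v : fplace inf) (m n : nat)
    (g : 'M[adele inf Ehat]_(m, n)) : 'M[Ehat (sval v)]_(m, n) :=
  map_mx (fun a : adele inf Ehat => a v) g.

Lemma mx_atM (E : fieldType) (inf : place E)
    (Ehat : forall v : place E, completion v) (v : fplace inf) (m n p : nat)
    (g : 'M[adele inf Ehat]_(m, n)) (h : 'M[adele inf Ehat]_(n, p)) :
  mx_at v (g *m h) = mx_at v g *m mx_at v h.
Proof.
apply/matrixP => i k; rewrite !mxE.
have -> : (\sum_l g i l * h l k) v = \sum_l (g i l * h l k) v.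
  by apply: (big_morph (fun a : adele inf Ehat => a v)).
by apply: eq_bigr => l _; rewrite !mxE.
Qed.

Section DrinfeldModularVariety.
Context (E : fieldType) (inf : place E) (Ehat : forall v : place E, completion v).
Context (R : realType) (C : fieldType) (absC : C -> R) (j : {rmorphism E -> C}).
Context (r : nat) (K : level inf Ehat r).

(* p and q have the same class in GL_r(E) \ (Omega^r x GL_r(A_E^f) / K):
   q = (c . omega o T^-1, T g k) where p = (omega, g).  The rational matrix T
   acts on adelic matrices at each place. *)
Definition drinfeld_equiv_prop
    (p q : frame absC j r * GL (adele inf Ehat) r) : Prop :=
  exists T : 'M[E]_r, exists c : C, exists k : GL (adele inf Ehat) r,
    [/\ T \in unitmx, c != 0, level_set K k,
        frame_row q.1 = c *: (frame_row p.1 *m map_mx j (invmx T)) &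
        forall v : fplace inf,
          mx_at v q.2 = map_mx (cemb (Ehat (sval v))) T *m mx_at v (p.2 * k)%g].

Definition drinfeld_equiv : rel (frame absC j r * GL (adele inf Ehat) r) :=
  fun p q => `[< drinfeld_equiv_prop p q >].

Fact drinfeld_equiv_refl : reflexive drinfeld_equiv.
Proof.
move=> p; apply/asboolP; exists 1%:M, 1, 1%g; split.
- exact: unitmx1.
- exact: oner_neq0.
- by case: (level_subgroup K).
- by rewrite invmx1 map_mx1 mulmx1 scale1r.
- by move=> v; rewrite map_mx1 mul1mx mulg1.
Qed.

Lemma level_inv k : level_set K k -> level_set K k^-1%g.
Proof.
by case: (level_subgroup K) => K1 KM Kk; rewrite -[k^-1%g]mulg1; apply: KM.
Qed.

Lemma level_mul k l : level_set K k -> level_set K l -> level_set K (k * l)%g.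
Proof.
case: (level_subgroup K) => K1 KM Kk Kl; rewrite -[k]invgK; apply: KM => //.
exact: level_inv.
Qed.

Fact drinfeld_equiv_sym : symmetric drinfeld_equiv.
Proof.
suff h p q : drinfeld_equiv p q -> drinfeld_equiv q p.
  by move=> p q; apply/idP/idP; apply: h.
move=> /asboolP[T [c [k [Tu c0 Kk qw qg]]]]; apply/asboolP.
exists (invmx T), c^-1, k^-1%g; split.
- by rewrite unitmx_inv.
- by rewrite invr_eq0.
- exact: level_inv.
- rewrite qw invmxK -scalemxAl scalerA mulVf// scale1r -mulmxA -map_mxM.
  by rewrite mulVmx// map_mx1 mulmx1.
- move=> v; rewrite mx_atM qg [in RHS]mulmxA mulmxA -map_mxM mulVmx// map_mx1 mul1mx.
  by rewrite -mx_atM -[_ *m _]/(GLmx (p.2 * k * k^-1)%g) mulgK.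
Qed.

Fact drinfeld_equiv_trans : transitive drinfeld_equiv.
Proof.
move=> q p s /asboolP[T [c [k [Tu c0 Kk qw qg]]]].
move=> /asboolP[T' [c' [k' [Tu' c0' Kk' sw sg]]]]; apply/asboolP.
exists (T' *m T), (c' * c), (k * k')%g; split.
- by rewrite unitmx_mul Tu' Tu.
- by rewrite mulf_neq0.
- exact: level_mul.
- rewrite sw qw -scalemxAl scalerA -mulmxA -map_mxM; congr (_ *: (_ *m map_mx _ _)).
  have u : T' *m T \in unitmx by rewrite unitmx_mul Tu' Tu.
  have e : invmx T *m invmx T' *m (T' *m T) = 1%:M.
    by rewrite mulmxA -(mulmxA (invmx T)) mulVmx// mulmx1 mulVmx.
  by rewrite -[LHS]mulmx1 -(mulmxV u) mulmxA e mul1mx.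
- move=> v; rewrite sg mx_atM qg map_mxM -!mulmxA; congr (_ *m (_ *m _)).
  by rewrite -mx_atM -[_ *m _]/(GLmx (p.2 * k * k')%g) mulgA.
Qed.

Definition drinfeld_equivRel :=
  EquivRel drinfeld_equiv drinfeld_equiv_refl drinfeld_equiv_sym
    drinfeld_equiv_trans.

(* The set S^r_{E,K}(C) of C-valued points. *)
Definition drinfeld_points : Type := {eq_quot drinfeld_equivRel}%qT.

Definition drinfeld_class (omega : frame absC j r) (g : GL (adele inf Ehat) r) :
  drinfeld_points := (\pi_({eq_quot drinfeld_equivRel}) (omega, g))%qT.

End DrinfeldModularVariety.

(* iota is the canonical map from the adeles of F to those of L: at a place w of
   L above v it is the continuous extension F_v -> L_w of the inclusion. *)
Definition canonical_adele_map (F : fieldType) (L : fieldExtType F)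
    (inf : place F) (infL : place L)
    (Fhat : forall v : place F, completion v)
    (Lhat : forall w : place L, completion w)
    (iota : adele inf Fhat -> adele infL Lhat) : Prop :=
  forall (w : fplace infL) (v : fplace inf), lies_over (sval w) (sval v) ->
    exists loc : {rmorphism Fhat (sval v) -> Lhat (sval w)},
      [/\ forall x : F, loc (cemb (Fhat (sval v)) x) = cemb (Lhat (sval w)) x%:A,
          forall N : int, exists M : int, forall a : Fhat (sval v),
            vge (cval (Fhat (sval v))) M a ->
            vge (cval (Lhat (sval w))) N (loc a) &
          forall a : adele inf Fhat, iota a w = loc (a v)].

Section Inclusions.
Context (F : fieldType) (L : fieldExtType F).
Context (inf : place F) (infL : place L).
Context (Fhat : forall v : place F, completion v).
Context (Lhat : forall w : place L, completion w).
Context (R : realType) (C : fieldType) (absC : C -> R).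
Context (jF : {rmorphism F -> C}) (jL : {rmorphism L -> C}).
Context (iota : {rmorphism adele inf Fhat -> adele infL Lhat}).
Context (r r' : nat).

Definition rational_linear := {linear 'cV[F]_r -> 'cV[L]_r' | GRing.in_alg L \; *:%R}.
Definition adelic_linear :=
  {linear 'cV[adele inf Fhat]_r -> 'cV[adele infL Lhat]_r' | iota \; *:%R}.

Definition rational_mx (phi : rational_linear) : 'M[L]_(r', r) :=
  \matrix_(s, i) phi (delta_mx i 0) s 0.

(* The value at w of phi (x) A_F^f, the A_F^f-linear extension of phi. *)
Definition adelic_extension_at (phi : rational_linear)
    (x : 'cV[adele inf Fhat]_r) (w : fplace infL) : 'cV[Lhat (sval w)]_r' :=
  map_mx (cemb (Lhat (sval w))) (rational_mx phi) *m mx_at w (map_mx iota x).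

Section Level.
Context (K : level inf Fhat r).

(* K' = b K b^-1 \cap GL_r'(A_L^f). *)
Definition pullback_level (b : adelic_linear) : set (GL (adele infL Lhat) r') :=
  [set h | exists2 k : GL (adele inf Fhat) r, level_set K k &
     forall x, GLmx h *m b x = b (GLmx k *m x)].

(* s is the image under iota_b of the class of (omega', h'): it is the class of
   (omega' o phi, phi^-1 o h' o b). *)
Definition inclusion_rel (b : adelic_linear) (omega' : frame absC jL r')
    (h' : GL (adele infL Lhat) r') (s : drinfeld_points absC jF K) : Prop :=
  exists (phi : rational_linear) (omega : frame absC jF r)
      (g : GL (adele inf Fhat) r),
    [/\ bijective phi,
        frame_row omega = frame_row omega' *m map_mx jL (rational_mx phi),
        forall (x : 'cV[adele inf Fhat]_r) (w : fplace infL),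
          adelic_extension_at phi (GLmx g *m x) w = mx_at w (GLmx h' *m b x) &
        s = drinfeld_class K omega g].

Definition inclusion_image (b : adelic_linear) : set (drinfeld_points absC jF K) :=
  [set s | exists omega' h', inclusion_rel b omega' h' s].

Definition drinfeld_subvariety (X : set (drinfeld_points absC jF K)) : Prop :=
  exists2 b : adelic_linear, bijective b & X = inclusion_image b.

Definition is_index (X : set (drinfeld_points absC jF K)) (i : nat) : Prop :=
  exists (b : adelic_linear) (M : set (GL (adele infL Lhat) r')),
    [/\ bijective b, X = inclusion_image b, maximal_compact_subgroup M,
        pullback_level b `<=` M & has_index M (pullback_level b) i].

(* The index does not depend on the choice of b and of the maximal compact
   subgroup. *)
Definition drinfeld_index (X : set (drinfeld_points absC jF K)) : nat :=
  xget 0%N [set i | is_index X i].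

End Level.
End Inclusions.

(* Main.v *)
(* Let b be a bijective adelic linear map for which K' = b K b^-1 /\ GL_r'(A_L)
   has index at most B in a maximal compact subgroup. Maximal compact subgroups
   are conjugate to GL_r'(O_L), and replacing b by h b does not change the image
   of the inclusion, so the maximal compact subgroup may be taken to be
   GL_r'(O_L). Let Lambda be a K-stable lattice of A_F^r. The O_F-algebra of
   matrices stabilizing b(Lambda) contains K'. For an integral matrix x supported
   at one place above v and t_0, ..., t_B in O_v, two of the units 1 + t_i x lie
   in the same coset of K', and this forces (t_i - t_j) x into the algebra if
   t_i - t_j divides t_j. When v has a large residue field all t_i - t_j can be
   chosen to be units; at the finitely many other places one takes
   t_i = pi^(i+1). So the algebra contains C M_r'(O_L) for some nonzero C
   depending on B only. After scaling b by an idele,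
   O_L^r' <= b(Lambda) <= C^-1 O_L^r'. Hence all these b differ by elements of a
   fixed compact subset of GL_r(A_F), which is covered by finitely many cosets
   of K, and b K determines the image. *)

Require Import Defs.
From HB Require Import structures.
From mathcomp Require Import all_boot all_order all_algebra all_field.
From mathcomp Require Import finmap all_classical all_reals.
From mathcomp Require Import topology.
From mathcomp Require Import zify ring lra.

Set Implicit Arguments.
Unset Strict Implicit.
Unset Printing Implicit Defensive.

Import Order.TTheory GRing.Theory Num.Theory.
Local Open Scope classical_set_scope.
Local Open Scope ring_scope.

(** * Valuations *)

(** Two facts that the overview takes for granted have to be extracted from the data: the residue
    fields are finite, and [b] is a homeomorphism although it is only given as a linear bijection.
    Both come from compactness. The compact open group [K] forces the residue fields of F to be
    finite, and then bounded closed sets are compact. Unboundedness of the inverse of [b] would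
    produce primitive vectors with images tending to 0, and their limit would be a nonzero vector in
    the kernel of [b]. Continuity of the inverse transfers finiteness of residue fields to L and
    makes K' open and bounded, so that a finite index exists at all.

    A second obstacle is that b(Lambda) is a module over O_F only, so no multiple of it need be an
    O_L-lattice. It is compared with the largest a O_L^r' that it contains, for an idele a. The
    elementary matrices in the stabilizer, each supported at one place of L, move any coordinate of
    a lattice vector to any position with any integral factor, and this bounds b(Lambda) by C^-1 a
    O_L^r'. *)

Section Places.
Context (E : fieldType) (v : place E).
Implicit Types (x y c : E) (M N : int).

Lemma vge_val x N : x != 0 -> vge v N x = (N <= v x).
Proof. by rewrite /vge => /negbTE ->. Qed.

Lemma vge_sep x : (forall N, vge v N x) -> x = 0.
Proof.
move=> h; apply/eqP/negP => /negP x0; have := h (v x + 1).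
by rewrite vge_val// gerDl.
Qed.

Lemma vgeB N x y : vge v N x -> vge v N y -> vge v N (x - y).
Proof. by move=> hx hy; apply: vgeD => //; rewrite vgeN. Qed.

Lemma vge_sum (I : Type) (s : seq I) (P : pred I) (f : I -> E) N :
  (forall i, P i -> vge v N (f i)) -> vge v N (\sum_(i <- s | P i) f i).
Proof.
move=> h; elim/big_ind: _ => //; first exact: vge0.
by move=> x y; apply: vgeD.
Qed.

Lemma vge1 : vge v 0 1.
Proof. by rewrite vge_val ?oner_neq0// Defs.val1. Qed.

Lemma vge0M x y : vge v 0 x -> vge v 0 y -> vge v 0 (x * y).
Proof. by move=> hx hy; rewrite -[0]addr0; apply: vgeM. Qed.

Lemma valV x : x != 0 -> v x^-1 = - v x.
Proof.
move=> x0; have := val_mul v x0 (invr_neq0 x0).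
rewrite mulfV// Defs.val1 => /esym/eqP; rewrite addrC addr_eq0 => /eqP //.
Qed.

Lemma valX x n : x != 0 -> v (x ^+ n) = n%:Z * v x.
Proof.
move=> x0; elim: n => [|n IH]; first by rewrite expr0 Defs.val1 mul0r.
by rewrite exprS val_mul ?expf_neq0// IH intS mulrDl mul1r.
Qed.

Lemma vgeMl c x N : c != 0 -> vge v N (c * x) = vge v (N - v c) x.
Proof.
move=> c0; have [->|x0] := eqVneq x 0; first by rewrite mulr0 !vge0.
by rewrite !vge_val ?mulf_neq0// val_mul// lerBlDl.
Qed.

Lemma vgeXn x n : vge v 0 x -> vge v 0 (x ^+ n).
Proof.
by move=> hx; elim: n => [|n IH]; rewrite ?expr0 ?vge1// exprS vge0M.
Qed.

Lemma valN x : v (- x) = v x.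
Proof.
have h y : y != 0 -> v y <= v (- y).
  by move=> y0; rewrite -vge_val ?oppr_eq0// vgeN vge_val.
have [->|x0] := eqVneq x 0; first by rewrite oppr0.
by apply/eqP; rewrite eq_le h// andbT -{2}[x]opprK h// oppr_eq0.
Qed.

(** The equality case of the ultrametric inequality. The bound on [y] goes through [vge] so that
    [y = 0], whose valuation is a junk value, is covered. *)
Lemma val_addl x y N : x != 0 -> v x < N -> vge v N y ->
  x + y != 0 /\ v (x + y) = v x.
Proof.
move=> x0 xN; have [->|y0] := eqVneq y 0; first by rewrite addr0.
rewrite vge_val// => Ny; have xy : v x < v y by apply: lt_le_trans Ny.
have s0 : x + y != 0.
  apply: contraTneq xy => /eqP; rewrite addr_eq0 => /eqP ->.
  by rewrite -leNgt valN.
split=> //; apply/eqP; rewrite eq_le; apply/andP; split; last first.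
  by have := val_add v x0 y0 s0; rewrite (min_idPl (ltW xy)).
have: vge v (Num.min (v (x + y)) (v y)) (x + y - y).
  by apply: vgeB; rewrite vge_val// ge_min lexx ?orbT.
by rewrite addrK vge_val// ge_min [v y <= _]leNgt xy orbF.
Qed.

Lemma exists_uniformizer : exists2 x, x != 0 & v x = 1.
Proof. exact: val_surj. Qed.

Definition uniformizer : E := s2val (cid2 exists_uniformizer).

Lemma uniformizer_neq0 : uniformizer != 0.
Proof. by rewrite /uniformizer; case: cid2. Qed.

Lemma val_uniformizer : v uniformizer = 1.
Proof. by rewrite /uniformizer; case: cid2. Qed.

Definition upow (n : int) : E := uniformizer ^ n.

Lemma upow_neq0 n : upow n != 0.
Proof. by rewrite expfz_neq0// uniformizer_neq0. Qed.

Lemma val_upow n : v (upow n) = n.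
Proof.
have u0 := uniformizer_neq0; case: n => n; rewrite /upow.
  by rewrite -[LHS]/(v (uniformizer ^+ n)) valX// val_uniformizer mulr1.
rewrite -[LHS]/(v (uniformizer ^+ n.+1)^-1) valV ?expf_neq0//.
by rewrite valX// val_uniformizer mulr1.
Qed.

Lemma vge_upow n : vge v n (upow n).
Proof. by rewrite vge_val ?upow_neq0// val_upow. Qed.

Lemma vge_upowMl n N x : vge v N (upow n * x) = vge v (N - n) x.
Proof. by rewrite vgeMl ?upow_neq0// val_upow. Qed.

End Places.

Section FiniteSupport.
Context (T : Type).

Definition fsupp (n : T -> int) : Prop := finite_set [set v | n v != 0].

Lemma fsupp_sub (S : set T) (n : T -> int) :
  finite_set S -> (forall v, ~ S v -> n v = 0) -> fsupp n.
Proof.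
move=> fS h; apply: sub_finite_set fS => v /= nv; apply: contrapT => /h/eqP.
by apply/negP.
Qed.

Lemma fsupp0 : fsupp (fun=> 0).
Proof. exact: (fsupp_sub (finite_set0 _)). Qed.

Lemma fsupp2 (f : int -> int -> int) (m n : T -> int) : f 0 0 = 0 ->
  fsupp m -> fsupp n -> fsupp (fun v => f (m v) (n v)).
Proof.
move=> f0 fm fn; have: finite_set ([set v | m v != 0] `|` [set v | n v != 0]).
  by rewrite finite_setU.
move/fsupp_sub; apply=> v /not_orP[/= /negP + /negP].
by rewrite !negbK => /eqP-> /eqP->.
Qed.

Lemma fsupp1 (f : int -> int) (m : T -> int) : f 0 = 0 ->
  fsupp m -> fsupp (fun v => f (m v)).
Proof. by move=> f0 fm; apply: (fsupp2 (f := fun x _ => f x) _ fm fm). Qed.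

Lemma fsupp_lower (I : finType) (n : I -> T -> int) : (forall i, fsupp (n i)) ->
  exists m, fsupp m /\ forall i v, m v <= n i v.
Proof.
move=> fn; exists (fun v => - \sum_i `|n i v|); split; last first.
  move=> i v; rewrite (bigD1 i)//= opprD; have : 0 <= \sum_(j | j != i) `|n j v|.
    by apply: sumr_ge0 => j _; apply: normr_ge0.
  by move: (\sum_(_ | _) _) (n i v) => s x s0; lia.
have: finite_set (\bigcup_(i in [set: I]) [set v | n i v != 0]).
  by apply: bigcup_finite => // i _; apply: fn.
move/fsupp_sub; apply=> v h; rewrite big1 ?oppr0// => i _.
apply/eqP; rewrite normr_eq0; apply/negP => /negP ni.
by apply: h; exists i.
Qed.

End FiniteSupport.

(** * Adeles *)

Section AdeleBoxes.
Context (E : fieldType) (inf : place E) (Ehat : forall v : place E, completion v).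
Local Notation A := (adele inf Ehat).
Local Notation P := (fplace inf).
Local Notation vg v := (vge (cval (Ehat (sval v)))).
Implicit Types (a b : A) (v w : P) (n m : P -> int).

Lemma adeleD a b v : (a + b) v = a v + b v. Proof. by []. Qed.
Lemma adeleM a b v : (a * b) v = a v * b v. Proof. by []. Qed.
Lemma adeleN a v : (- a) v = - a v. Proof. by []. Qed.
Lemma adele_sum (I : Type) (s : seq I) (Q : pred I) (f : I -> A) v :
  (\sum_(i <- s | Q i) f i) v = \sum_(i <- s | Q i) f i v.
Proof. exact: (big_morph (fun a : A => a v)). Qed.

(** Exponents are integers, unlike those of [adele_box]: the same notion then serves for
    neighbourhoods of 0 and for bounds on denominators. *)
Definition abox n a : Prop := forall v, vg v (n v) (a v).

Definition mbox p q n (g : 'M[A]_(p, q)) : Prop := forall i j, abox n (g i j).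

Definition integral a : Prop := forall v, vg v 0 (a v).

Definition mintegral p q (g : 'M[A]_(p, q)) : Prop :=
  forall i j, integral (g i j).

Lemma mk_adele (f : forall v, Ehat (sval v)) n :
  fsupp n -> (forall v, vg v (n v) (f v)) -> {a : A | forall v, a v = f v}.
Proof.
move=> fn h; have fi : finite_set [set v | ~~ vg v 0 (f v)].
  apply: sub_finite_set fn => v /=; apply: contra => /eqP n0.
  by rewrite -n0 h.
by exists (Adele fi).
Qed.

Lemma abox_le m n a : (forall v, m v <= n v) -> abox n a -> abox m a.
Proof. by move=> mn h v; apply: vge_le (h v). Qed.

Lemma aboxD n a b : abox n a -> abox n b -> abox n (a + b).
Proof. by move=> ha hb v; apply: vgeD. Qed.

Lemma aboxN n a : abox n a -> abox n (- a).
Proof. by move=> ha v; rewrite adeleN vgeN. Qed.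

Lemma abox_zero n : abox n 0. Proof. by move=> v; apply: vge0. Qed.

Lemma aboxM m n a b : abox m a -> abox n b -> abox (fun v => m v + n v) (a * b).
Proof. by move=> ha hb v; apply: vgeM. Qed.

Lemma abox_sum (I : Type) (s : seq I) (Q : pred I) (f : I -> A) n :
  (forall i, Q i -> abox n (f i)) -> abox n (\sum_(i <- s | Q i) f i).
Proof. by move=> h v; rewrite adele_sum; apply: vge_sum => i /h. Qed.

Lemma abox_exists a : exists2 n, fsupp n & abox n a.
Proof.
exists (fun v => if vg v 0 (a v) then 0 else cval (Ehat (sval v)) (a v)).
  by apply: fsupp_sub (adele_int a) _ => v /= /negP; rewrite negbK => ->.
by move=> v; case: ifP => // _; rewrite /vge lexx orbT.
Qed.

Section Matrix.
Context (p q : nat).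
Implicit Types g h : 'M[A]_(p, q).

Lemma mbox_le m n g : (forall v, m v <= n v) -> mbox n g -> mbox m g.
Proof. by move=> mn h i j; apply: abox_le (h i j). Qed.

Lemma mboxD n g h : mbox n g -> mbox n h -> mbox n (g + h).
Proof. by move=> hg hh i j; rewrite mxE; apply: aboxD. Qed.

Lemma mboxN n g : mbox n g -> mbox n (- g).
Proof. by move=> hg i j; rewrite mxE; apply: aboxN. Qed.

Lemma mboxB n g h : mbox n g -> mbox n h -> mbox n (g - h).
Proof. by move=> hg hh; apply: mboxD => //; apply: mboxN. Qed.

Lemma mbox_trans n g h k : mbox n (g - h) -> mbox n (h - k) -> mbox n (g - k).
Proof. by move=> gh hk; rewrite -(subrK h g) -addrA; apply: mboxD. Qed.

Lemma mbox_subr n g h : mbox n (g - h) -> mbox n h -> mbox n g.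
Proof. by move=> gh hh; rewrite -(subrK h g); apply: mboxD. Qed.

Lemma mbox_exists g : exists2 n, fsupp n & mbox n g.
Proof.
have h ij := abox_exists (g ij.1 ij.2).
have [m [fm hm]] := @fsupp_lower _ (('I_p * 'I_q)%type : finType)
  (fun ij => s2val (cid2 (h ij))) (fun ij => s2valP (cid2 (h ij))).
exists m => // i j; apply: abox_le (s2valP' (cid2 (h (i, j)))) => v.
exact: (hm (i, j)).
Qed.

End Matrix.

Lemma mboxM p q s m n (g : 'M[A]_(p, q)) (h : 'M[A]_(q, s)) :
  mbox m g -> mbox n h -> mbox (fun v => m v + n v) (g *m h).
Proof.
by move=> hg hh i j; rewrite mxE; apply: abox_sum => k _; apply: aboxM.
Qed.

Lemma mintegralM p q s (g : 'M[A]_(p, q)) (h : 'M[A]_(q, s)) :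
  mintegral g -> mintegral h -> mintegral (g *m h).
Proof. by move=> hg hh; apply: mbox_le (mboxM hg hh) => v; rewrite addr0. Qed.

Lemma mintegral1 p : mintegral (1%:M : 'M[A]_p).
Proof.
move=> i j v; rewrite mxE; case: (i == j); [exact: vge1|exact: vge0].
Qed.

(** Completions at different places are different types, so the value at [v] is transported along
    [v = w]; [single_ind] replaces the transport by a case split. *)
Definition single_at v (c : Ehat (sval v)) w : Ehat (sval w) :=
  match pselect (v = w) with
  | left e => eq_rect v (fun w => Ehat (sval w)) c w e
  | right _ => 0
  end.

Lemma single_at_eq v c : single_at c v = c.
Proof.
rewrite /single_at; case: pselect => // e.
by rewrite (Prop_irrelevance e erefl).
Qed.

Lemma single_at_neq v c w : v <> w -> single_at (v := v) c w = 0.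
Proof. by rewrite /single_at; case: pselect. Qed.

Lemma single_int v c : finite_set [set w | ~~ vg w 0 (single_at (v := v) c w)].
Proof.
apply: sub_finite_set (finite_set1 v) => w /=; apply: contraNP => /nesym vw.
by rewrite single_at_neq// vge0.
Qed.

Definition single v c : A := Adele (single_int (v := v) c).

Lemma singleE v c : single (v := v) c v = c.
Proof. exact: single_at_eq. Qed.

Lemma single_neq v c w : v <> w -> single (v := v) c w = 0.
Proof. exact: single_at_neq. Qed.

Lemma single_ind v c (Q : forall w, Ehat (sval w) -> Prop) w :
  Q v c -> (v <> w -> Q w 0) -> Q w (single (v := v) c w).
Proof.
move=> h1 h2; have [e|e] := pselect (v = w); first by subst w; rewrite singleE.
by rewrite single_neq//; apply: h2.
Qed.

Lemma singleM v c a : single (v := v) c * a = single (c * a v).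
Proof.
apply: adele_eq => w; rewrite adeleM.
have [e|e] := pselect (v = w); first by subst w; rewrite !singleE.
by rewrite !single_neq// mul0r.
Qed.

Lemma abox_single v c n : vg v (n v) c -> abox n (single (v := v) c).
Proof.
by move=> h w; apply: (single_ind (Q := fun w => vg w (n w))) => // _; apply: vge0.
Qed.

Lemma single1M v a : single (v := v) 1 * a = single (a v).
Proof. by rewrite singleM mul1r. Qed.

Section Idele.
Context n (fn : fsupp n).

Definition idele : A :=
  sval (@mk_adele (fun v => upow (cval (Ehat (sval v))) (n v)) n fn
    (fun v => vge_upow _ _)).

Lemma ideleE v : idele v = upow (cval (Ehat (sval v))) (n v).
Proof. by rewrite /idele; case: mk_adele. Qed.

Lemma abox_ideleM m a : abox m (idele * a) <-> abox (fun v => m v - n v) a.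
Proof. by split=> h v; have := h v; rewrite adeleM ideleE vge_upowMl. Qed.

Lemma mbox_ideleM p q m (g : 'M[A]_(p, q)) :
  mbox m (idele *: g) <-> mbox (fun v => m v - n v) g.
Proof.
by split=> h i j; have := h i j; rewrite ?mxE => /abox_ideleM.
Qed.
End Idele.

Lemma ideleV n (fn : fsupp n) (fN : fsupp (fun v => - n v)) :
  idele fn * idele fN = 1.
Proof.
apply: adele_eq => v; rewrite adeleM !ideleE /upow -expfzDr ?uniformizer_neq0//.
by rewrite subrr.
Qed.

Lemma fsuppN n : fsupp n -> fsupp (fun v => - n v).
Proof. exact: (fsupp1 (f := -%R) (oppr0 _)). Qed.

Lemma fsuppD m n : fsupp m -> fsupp n -> fsupp (fun v => m v + n v).
Proof. exact: (fsupp2 (f := +%R) (addr0 _)). Qed.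

End AdeleBoxes.

(** * The topology of GL over the adeles *)

Section Subgroups.
Context (G : groupType) (H : set G) (sH : subgroup H).
Implicit Types x y z : G.

Lemma subgroup1 : H 1%g. Proof. by case: sH. Qed.

Lemma subgroupV x : H x -> H x^-1%g.
Proof. by case: sH => H1 HM Hx; rewrite -[x^-1%g]mulg1; apply: HM. Qed.

Lemma subgroupM x y : H x -> H y -> H (x * y)%g.
Proof. by case: sH => H1 HM /subgroupV Hx; rewrite -[x]invgK; apply: HM. Qed.

Lemma subgroup_divr x y z : H (x^-1 * y)%g -> H (y^-1 * z)%g -> H (x^-1 * z)%g.
Proof.
by move=> h1 h2; have := subgroupM h1 h2; rewrite mulgA -(mulgA (x^-1)%g) mulgV mulg1.
Qed.

Lemma subgroup_divl x y z : H (x^-1 * y)%g -> H (x^-1 * z)%g -> H (y^-1 * z)%g.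
Proof.
by move=> h1 h2; have := subgroupM (subgroupV h1) h2;
  rewrite invgM invgK mulgA -(mulgA (y^-1)%g) mulgV mulg1.
Qed.

Lemma subgroup_conj h : subgroup [set g | H (h^-1 * g * h)%g].
Proof.
split=> [|x y hx hy] /=; first by rewrite mulg1 mulVg; apply: subgroup1.
suff -> : (h^-1 * (x^-1 * y) * h = (h^-1 * x * h)^-1 * (h^-1 * y * h))%g.
  by apply: subgroupM => //; apply: subgroupV.
by rewrite !invgM invgK !mulgA -(mulgA _ h h^-1%g) mulgV mulg1.
Qed.

Lemma conj_conjV (h x : G) : (h^-1 * (h * x * h^-1) * h = x)%g.
Proof. by rewrite !mulgA mulVg mul1g -mulgA mulVg mulg1. Qed.

Lemma conj_quotient (h h' x : G) :
  ((h^-1 * h') * (h'^-1 * x * h') * (h^-1 * h')^-1 = h^-1 * x * h)%g.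
Proof.
rewrite invgM invgK !mulgA -(mulgA _ h' h'^-1%g) mulgV mulg1.
by rewrite -(mulgA _ h' h'^-1%g) mulgV mulg1.
Qed.

Lemma conj_quotientV (h h' x : G) :
  ((h^-1 * h')^-1 * x * (h^-1 * h') = h'^-1 * (h * x * h^-1) * h')%g.
Proof. by rewrite invgM invgK !mulgA. Qed.

Lemma conj_image h : [set g | H (h^-1 * g * h)%g] =
  (fun g => (h * g)%g) @` ((fun g => (g * h^-1)%g) @` H).
Proof.
apply/seteqP; split=> [g hg|_ [_ [g hg <-] <-]].
  exists (h^-1 * g)%g; last by rewrite mulgA mulgV mul1g.
  by exists (h^-1 * g * h)%g => //; rewrite -mulgA mulgV mulg1.
by rewrite /= (mulgA h) conj_conjV.
Qed.

End Subgroups.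

HB.instance Definition _ (E : fieldType) (inf : place E)
    (Ehat : forall v : place E, completion v) (r : nat) :=
  isPointed.Build (GL (adele inf Ehat) r) 1%g.

Section GLTopology.
Context (E : fieldType) (inf : place E) (Ehat : forall v : place E, completion v).
Context (r : nat).
Local Notation A := (adele inf Ehat).
Local Notation P := (fplace inf).
Local Notation G := (GL A r).
Implicit Types (g h : G).

Lemma nbhs_abox (a : A) (n : P -> int) : fsupp n ->
  nbhs a [set b | abox n (b - a)].
Proof.
move=> fn; rewrite nbhsE; exists [set b | abox n (b - a)]; last by [].
split; last by move=> v; rewrite subrr; apply: vge0.
move=> b hb; exists (fun v => `|n v|%N).
  by apply: sub_finite_set fn => v /=; rewrite absz_eq0.
move=> c hc v; have -> : c - a = (c - b) + (b - a) by rewrite addrA subrK.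
apply: vgeD; last exact: hb.
by apply: vge_le (hc v); lia.
Qed.

Lemma nbhs_abox_sub (a : A) (U : set A) : nbhs a U ->
  exists2 n : P -> int, fsupp n & forall b, abox n (b - a) -> U b.
Proof.
rewrite nbhsE => -[O [oO Oa] OU]; have [n fn nO] := oO a Oa.
by exists (fun v => (n v)%:Z) => // b hb; apply/OU/nO.
Qed.

Lemma nbhs_mbox_sub p q (M : 'M[A]_(p, q)) (U : set 'M[A]_(p, q)) : nbhs M U ->
  exists2 n : P -> int, fsupp n & forall N, mbox n (N - M) -> U N.
Proof.
move=> [Q hQ QU].
have h (ij : 'I_p * 'I_q) := nbhs_abox_sub (hQ ij.1 ij.2).
pose n ij := s2val (cid2 (h ij)).
have [m [fm hm]] := @fsupp_lower P ('I_p * 'I_q)%type (fun ij v => - n ij v)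
  (fun ij => fsuppN (s2valP (cid2 (h ij)))).
exists (fun v => - m v); first exact: fsuppN.
move=> N hN; apply: QU => i j; apply: (s2valP' (cid2 (h (i, j)))).
have := hN i j; rewrite !mxE => /abox_le; apply=> v.
by rewrite lerNr; apply: hm (i, j) v.
Qed.

Definition GLbox (n : P -> int) g : set G :=
  [set h | mbox n (GLmx h - GLmx g) /\ mbox n (GLinvmx h - GLinvmx g)].

Lemma nbhs_GLP g (U : set G) :
  nbhs g U <-> exists2 n : P -> int, fsupp n & GLbox n g `<=` U.
Proof.
split=> [|[n fn nU]].
  rewrite nbhsE => -[O [[B oB BO] Og] OU].
  have : nbhs (GL_pair g) B by apply: open_nbhs_nbhs; split=> //; rewrite -BO in Og.
  move=> [[B1 B2] /= [/nbhs_mbox_sub[n1 f1 h1] /nbhs_mbox_sub[n2 f2 h2]] B12].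
  exists (fun v => Num.max (n1 v) (n2 v)).
    by apply: (fsupp2 (f := Num.max)) => //; rewrite maxxx.
  move=> h [hh hi]; apply: OU; rewrite -BO; apply: B12; split => /=.
    by apply: h1; apply: mbox_le hh => v; rewrite le_max lexx.
  by apply: h2; apply: mbox_le hi => v; rewrite le_max lexx orbT.
apply: filterS nU _.
pose V (M : 'M[A]_r) := [set N : 'M[A]_r | mbox n (N - M)].
have hV M : nbhs M (V M).
  exists (fun i j => [set b | abox n (b - M i j)]).
    by move=> i j; apply: nbhs_abox.
  by move=> N hN i j; rewrite !mxE; apply: hN.
pose W : set ('M[A]_r * 'M[A]_r) := [set MN | V (GLmx g) MN.1 /\ V (GLinvmx g) MN.2].
have hW : nbhs (GL_pair g) W.
  by exists (V (GLmx g), V (GLinvmx g)); [split; apply: hV|].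
exact: (@initial_continuous _ _ (@GL_pair A r) g W hW).
Qed.

Lemma open_GLP (U : set G) :
  open U <-> forall g, U g -> exists2 n : P -> int, fsupp n & GLbox n g `<=` U.
Proof.
split=> [oU g Ug|h].
  by apply/nbhs_GLP; apply: open_nbhs_nbhs.
by rewrite openE => g /h /nbhs_GLP.
Qed.

Lemma GLbox_mull g n : fsupp n -> exists2 m : P -> int, fsupp m &
  forall h h', GLbox m h h' -> GLbox n (g * h)%g (g * h')%g.
Proof.
move=> fn; have [m1 f1 h1] := mbox_exists (GLmx g).
have [m2 f2 h2] := mbox_exists (GLinvmx g).
exists (fun v => n v + (`|m1 v| + `|m2 v|)).
  apply: (fsupp2 (f := +%R)) => //; apply: (fsupp2 (f := fun x y => `|x| + `|y|)) => //.
move=> h h' [b1 b2]; split.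
  rewrite -[_ - _]/(GLmx g *m GLmx h' - GLmx g *m GLmx h) -mulmxBr.
  apply: mbox_le (mboxM h1 b1) => v; lia.
rewrite -[_ - _]/(GLinvmx h' *m GLinvmx g - GLinvmx h *m GLinvmx g) -mulmxBl.
apply: mbox_le (mboxM b2 h2) => v; lia.
Qed.

Lemma GLbox_mulr g n : fsupp n -> exists2 m : P -> int, fsupp m &
  forall h h', GLbox m h h' -> GLbox n (h * g)%g (h' * g)%g.
Proof.
move=> fn; have [m1 f1 h1] := mbox_exists (GLmx g).
have [m2 f2 h2] := mbox_exists (GLinvmx g).
exists (fun v => n v + (`|m1 v| + `|m2 v|)).
  apply: (fsupp2 (f := +%R)) => //; apply: (fsupp2 (f := fun x y => `|x| + `|y|)) => //.
move=> h h' [b1 b2]; split.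
  rewrite -[_ - _]/(GLmx h' *m GLmx g - GLmx h *m GLmx g) -mulmxBl.
  apply: mbox_le (mboxM b1 h1) => v; lia.
rewrite -[_ - _]/(GLinvmx g *m GLinvmx h' - GLinvmx g *m GLinvmx h) -mulmxBr.
apply: mbox_le (mboxM h2 b2) => v; lia.
Qed.

Lemma continuous_mull g : continuous (fun h => (g * h)%g).
Proof.
move=> h U /nbhs_GLP[n fn nU]; have [m fm mn] := GLbox_mull g fn.
by apply/nbhs_GLP; exists m => // h' /mn /nU.
Qed.

Lemma continuous_mulr g : continuous (fun h => (h * g)%g).
Proof.
move=> h U /nbhs_GLP[n fn nU]; have [m fm mn] := GLbox_mulr g fn.
by apply/nbhs_GLP; exists m => // h' /mn /nU.
Qed.

Definition GLbounded (n : P -> int) g : Prop :=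
  mbox n (GLmx g) /\ mbox n (GLinvmx g).

(** Finitely many boxes [GLbox 0 g] cover [S], and the elements of one box differ from its centre by
    integral matrices. A common bound for the centres, capped at 0, therefore works for all of
    [S]. *)
Lemma compact_bounded (S : set G) : compact S ->
  exists2 n : P -> int, fsupp n & forall g, S g -> GLbounded n g.
Proof.
rewrite (@compact_cover G) => cS.
have h (g : G) : exists2 n : P -> int, fsupp n & GLbounded n g.
  have [m1 f1 h1] := mbox_exists (GLmx g).
  have [m2 f2 h2] := mbox_exists (GLinvmx g).
  exists (fun v => Num.min (m1 v) (m2 v)).
    by apply: (fsupp2 (f := Num.min)) => //; rewrite minxx.
  by split; [apply: mbox_le h1|apply: mbox_le h2] => v;
    rewrite ge_min lexx ?orbT.
have [|x Sx|D _ SD] := cS G S (fun g => GLbox (fun=> 0) g).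
- move=> g _; apply/open_GLP => g' [b1 b2].
  exists (fun=> 0); first exact: fsupp0.
  by move=> h' [c1 c2]; split; [apply: mbox_trans b1|apply: mbox_trans b2].
- exists x => //; split; rewrite subrr => i j; rewrite mxE; exact: abox_zero.
pose n (g : D) v := Num.min (s2val (cid2 (h (val g))) v) 0.
have [|m [fm hm]] := @fsupp_lower P D n.
  move=> g; apply: (fsupp1 (f := fun x => Num.min x 0)); first by rewrite minxx.
  exact: s2valP (cid2 (h (val g))).
exists m => // g /SD[g' /= Dg' [b1 b2]].
have := hm [` Dg']%fset; rewrite /n /=; case: cid2 => n' /= fn' [c1 c2] mn.
have mn1 v : m v <= n' v by have := mn v; rewrite le_min => /andP[].
have mn2 v : m v <= 0 by have := mn v; rewrite le_min => /andP[].
split; first by apply: mbox_subr (mbox_le mn1 c1); apply: mbox_le b1.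
by apply: mbox_subr (mbox_le mn1 c2); apply: mbox_le b2.
Qed.

(* [cl] labels the finitely many left cosets of [H] met by [S]. *)
Lemma compact_coset_label (S H : set G) : compact S -> subgroup H ->
  nbhs (1%g : G) H ->
  exists (N : nat) (cl : G -> 'I_N.+1), forall g g', S g -> S g' -> cl g = cl g' ->
    H (g^-1 * g')%g.
Proof.
move=> + sH /nbhs_GLP[n fn nH]; rewrite (@compact_cover G) => cS.
have [|x Sx|D _ SD] := cS G S (fun g => [set h | H (g^-1 * h)%g]).
- move=> g _; apply/open_GLP => g' Hg'.
  have [m fm mn] := GLbox_mull (g'^-1)%g fn.
  exists m => // h' /mn; rewrite mulVg => /nH; exact: subgroup_divr.
- by exists x => //=; rewrite mulVg; apply: subgroup1.
have h g : exists d : option D, S g -> exists2 g' : D, d = Some g' & H ((val g')^-1 * g)%g.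
  have [/SD[g' /= Dg' hg]|nS] := pselect (S g).
    by exists (Some [` Dg']%fset) => _; exists [` Dg']%fset.
  by exists None.
have {}h := choice h; case: h => f hf.
have c0 : (#|{: option D}| > 0)%N by apply/card_gt0P; exists None.
exists #|{: option D}|.-1, (fun g => cast_ord (esym (prednK c0)) (enum_rank (f g))).
move=> g g' /hf[d ed hd] /hf[d' ed' hd'] /cast_ord_inj/enum_rank_inj.
rewrite ed ed' => -[dd']; subst d'.
exact: subgroup_divl hd hd'.
Qed.

End GLTopology.

(** * Ultrafilter limits and compactness of bounded sets *)

Lemma finite_uniq_seq (T : Type) (S : set T) : finite_set S ->
  exists2 s : seq {classic T}, uniq s & forall x, S x <-> x \in s.
Proof.
move=> /(@finite_fsetP {classic T})[X ->].
by exists X; [exact: fset_uniq|].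
Qed.

Lemma filter_finite (T U : Type) (F : set_system T) (S : set U) (Q : U -> set T) :
  Filter F -> finite_set S -> (forall u, S u -> F (Q u)) ->
  F [set x | forall u, S u -> Q u x].
Proof.
move=> FF /(@finite_fsetP {classic U})[X ->] h.
exact: (@filter_bigI T {classic U} X Q F FF h).
Qed.

Lemma ultra_label (T : Type) (I : finType) (F : set_system T) (cl : T -> I) :
  UltraFilter F -> exists i, F [set x | cl x = i].
Proof.
move=> UF; apply: contrapT => /forallNP h.
have /filter_ex[x /(_ (cl x))] : F [set x | forall i, cl x <> i].
  apply: (@filter_forall T I (fun i => [set x | cl x <> i]) F) => i.
  by have [/h|] := in_ultra_setVsetC [set x | cl x = i] UF.
by [].
Qed.

(** The residue field itself is never formed: a finite labelling that refines congruence modulo the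
    maximal ideal is what the pigeonhole and ultrafilter arguments consume. *)
Definition finite_residue (K : fieldType) (v : place K) : Prop :=
  exists (I : finType) (cl : K -> I), forall c d,
    vge v 0 c -> vge v 0 d -> cl c = cl d -> vge v 1 (c - d).

(** Digit expansion: one more step of precision adds to the label of [c] the residue of its next
    digit, read off from the difference between [c] and a fixed representative [rep] of the label
    found so far. *)
Lemma finite_residueX (K : fieldType) (v : place K) (M : int) (k : nat) :
  finite_residue v -> exists (I : finType) (cl : K -> I), forall c d,
    vge v M c -> vge v M d -> cl c = cl d -> vge v (M + k%:Z) (c - d).
Proof.
move=> [I0 [cl0 h0]]; elim: k => [|k [I [cl h]]].
  by exists unit, (fun=> tt) => c d hc hd _; rewrite addr0; apply: vgeB.
pose rep i := xget 0 [set c | vge v M c /\ cl c = i].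
have repP c : vge v M c -> vge v (M + k%:Z) (c - rep (cl c)).
  move=> hc; rewrite /rep; case: xgetP => [y _ [hy ey]|/(_ c)/=]; first exact: h.
  by move=> n; case: n.
exists (I * I0)%type,
  (fun c => (cl c, cl0 (upow v (- (M + k%:Z)) * (c - rep (cl c))))).
move=> c d hc hd [e]; set x := c - rep _; set y := d - rep _ => e0.
have -> : c - d = x - y by rewrite /x /y e opprB addrA subrK.
have hx : vge v 0 (upow v (- (M + k%:Z)) * x).
  by rewrite vge_upowMl opprK add0r repP.
have hy : vge v 0 (upow v (- (M + k%:Z)) * y).
  by rewrite vge_upowMl opprK add0r repP.
have := h0 _ _ hx hy e0; rewrite -mulrBr vge_upowMl opprK.
by apply: vge_le; lia.
Qed.

(** At each precision there are finitely many labels, so the ultrafilter concentrates on one class;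
    representatives of these classes form a Cauchy sequence, whose limit is [c]. *)
Lemma ultra_limit (E : fieldType) (v : place E) (C : completion v) (T : Type)
    (F : set_system T) (f : T -> C) (M : int) :
  finite_residue (cval C) -> UltraFilter F ->
  F [set x | vge (cval C) M (f x)] ->
  exists c : C, forall N, F [set x | vge (cval C) N (f x - c)].
Proof.
move=> fr UF FM.
have h (k : nat) : exists c : C, F [set x | vge (cval C) (M + k%:Z) (f x - c)].
  have [I [cl hcl]] := @finite_residueX C (cval C) M k fr.
  have [i Fi] := ultra_label (cl \o f) UF.
  have [x0 [/= e0 h0]] := filter_ex (filterI Fi FM).
  exists (f x0); apply: filterS (filterI Fi FM) => x [/= e hx].
  by apply: hcl => //; rewrite e e0.
have {}h := choice h; case: h => u hu.
have [|l hl] := @ccomplete _ _ C u.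
  move=> N; exists `|N - M|%N => i j Ni Nj.
  have [x [/= h1 h2]] := filter_ex (filterI (hu i) (hu j)).
  have -> : u i - u j = (f x - u j) - (f x - u i) by ring.
  by apply: vgeB; [apply: vge_le h2|apply: vge_le h1]; lia.
exists l => N; have [m hm] := hl N.
apply: filterS (hu (maxn m `|N - M|)) => x /= hx.
rewrite -(subrK (u (maxn m `|N - M|)) (f x)) -addrA.
apply: vgeD; first by apply: vge_le hx; lia.
by apply: hm; rewrite leq_maxl.
Qed.

Section CompactGL.
Context (E : fieldType) (inf : place E) (Ehat : forall v : place E, completion v).
Context (r : nat).
Local Notation A := (adele inf Ehat).
Local Notation P := (fplace inf).
Local Notation G := (GL A r).
Hypothesis fr : forall v : P, finite_residue (cval (Ehat (sval v))).

(** The local limits come from [ultra_limit]; the point is uniformity over infinitely many places.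
    Off the supports of [m] and [n] both the values and the limit are integral, which is all that is
    asked there, so only finitely many conditions have to be intersected. *)
Lemma ultra_adele_limit (T : Type) (F : set_system T) (f : T -> A) (m : P -> int) :
  UltraFilter F -> fsupp m -> F [set x | abox m (f x)] ->
  exists2 a : A, abox m a &
    forall n, fsupp n -> F [set x | abox n (f x - a)].
Proof.
move=> UF fm Fm.
have h (v : P) : exists c : Ehat (sval v),
    forall N, F [set x | vge (cval (Ehat (sval v))) N (f x v - c)].
  apply: (ultra_limit (M := m v)) => //.
  by apply: filterS Fm => x /= /(_ v).
pose c v := sval (cid (h v)).
have hc v N : F [set x | vge (cval (Ehat (sval v))) N (f x v - c v)].
  exact: svalP (cid (h v)) N.
have hm v : vge (cval (Ehat (sval v))) (m v) (c v).
  have [x [/= h1 /(_ v) h2]] := filter_ex (filterI (hc v (m v)) Fm).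
  have -> : c v = f x v - (f x v - c v) by rewrite opprB addrC subrK.
  exact: vgeB.
have [a ha] := mk_adele fm hm; exists a; first by move=> v; rewrite ha.
move=> n fn.
have fS : finite_set ([set v | m v != 0] `|` [set v | n v != 0]).
  by rewrite finite_setU.
have FF : Filter F by apply: filter_filter.
have FS := filter_finite FF fS (fun v _ => hc v (n v)).
apply: filterS (filterI FS Fm) => x [/= h1 h2] v.
rewrite adeleD adeleN ha.
have [hv|] := pselect (([set v | m v != 0] `|` [set v | n v != 0]) v).
  exact: h1.
move=> /not_orP[/= /negP + /negP]; rewrite !negbK => /eqP m0 /eqP n0.
by rewrite n0 -m0; apply: vgeB; [apply: h2|apply: hm].
Qed.

Lemma ultra_mx_limit (T : Type) (F : set_system T) (f : T -> 'M[A]_r) (m : P -> int) :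
  UltraFilter F -> fsupp m -> F [set x | mbox m (f x)] ->
  exists2 a : 'M[A]_r, mbox m a &
    forall n, fsupp n -> F [set x | mbox n (f x - a)].
Proof.
move=> UF fm Fm.
have h (ij : 'I_r * 'I_r) : exists a : A, abox m a /\
    forall n, fsupp n -> F [set x | abox n (f x ij.1 ij.2 - a)].
  have [||a h1 h2] := @ultra_adele_limit T F (fun x => f x ij.1 ij.2) m => //.
    by apply: filterS Fm => x /= /(_ ij.1 ij.2).
  by exists a.
have {}h := choice h; case: h => a ha.
exists (\matrix_(i, j) a (i, j)).
  by move=> i j; rewrite mxE; have [] := ha (i, j).
move=> n fn.
have FF : Filter F by apply: filter_filter.
have := @filter_forall T ('I_r * 'I_r)%type _ F FF (fun ij => (ha ij).2 n fn).
move=> H; apply: filterS H => x /= hx i j; rewrite !mxE; exact: (hx (i, j)).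
Qed.

(** Matrices and their inverses are given limits separately. As [GLbounded] controls both, products
    pass to the limit and the two limits are inverse to each other. *)
Lemma compact_GLbounded (m : P -> int) : fsupp m ->
  compact [set g : G | GLbounded m g].
Proof.
move=> fm; rewrite (@compact_ultra G) => F UF FQ.
have [||a ba ha] := @ultra_mx_limit G F (@GLmx A r) m => //.
  by apply: filterS FQ => g [].
have [||b bb hb] := @ultra_mx_limit G F (@GLinvmx A r) m => //.
  by apply: filterS FQ => g [].
have lim0 (c : 'M[A]_r) : (forall n, fsupp n -> mbox n c) -> c = 0.
  move=> h; apply/matrixP => i j; rewrite mxE; apply: adele_eq => v.
  apply: (@vge_sep _ (cval (Ehat (sval v)))) => N.
  pose n (w : P) := if `[< w = v >] then N else 0.
  have fn : fsupp n.
    apply: (fsupp_sub (finite_set1 v)) => w /= wv; rewrite /n.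
    by case: ifP => // /asboolP.
  by have := h n fn i j v; rewrite /n; case: asboolP.
have near n : fsupp n -> exists2 g : G, GLbounded m g &
    mbox n (GLmx g - a) /\ mbox n (GLinvmx g - b).
  move=> fn; have [g [h1 [h2 h3]]] := filter_ex (filterI FQ (filterI (ha n fn) (hb n fn))).
  by exists g.
have ab : a *m b = 1%:M.
  apply/eqP; rewrite -subr_eq0; apply/eqP; apply: lim0 => n fn.
  have [|g [b1 b2] [h1 h2]] := near (fun v => n v - m v).
    by apply: (fsupp2 (f := fun x y => x - y)).
  have -> : a *m b - 1%:M = (a - GLmx g) *m b + GLmx g *m (b - GLinvmx g).
    by rewrite mulmxBl mulmxBr GLmulV addrA subrK.
  apply: mboxD.
    apply: mbox_le (mboxM _ bb); last by rewrite -opprB; apply: mboxN h1.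
    by move=> v; rewrite subrK.
  apply: mbox_le (mboxM b1 _); last by rewrite -opprB; apply: mboxN h2.
  by move=> v /=; rewrite addrC subrK.
have ba' : b *m a = 1%:M.
  apply/eqP; rewrite -subr_eq0; apply/eqP; apply: lim0 => n fn.
  have [|g [b1 b2] [h1 h2]] := near (fun v => n v - m v).
    by apply: (fsupp2 (f := fun x y => x - y)).
  have -> : b *m a - 1%:M = (b - GLinvmx g) *m a + GLinvmx g *m (a - GLmx g).
    by rewrite mulmxBl mulmxBr GLmulVl addrA subrK.
  apply: mboxD.
    apply: mbox_le (mboxM _ ba); last by rewrite -opprB; apply: mboxN h2.
    by move=> v; rewrite subrK.
  apply: mbox_le (mboxM b2 _); last by rewrite -opprB; apply: mboxN h1.
  by move=> v /=; rewrite addrC subrK.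
exists (MkGL ab ba'); split; first by split.
move=> U /nbhs_GLP[n fn nU]; apply: filterS nU _.
exact: filterS (filterI (ha n fn) (hb n fn)).
Qed.

End CompactGL.

(** * Elementary matrices and finiteness of residue fields *)

Section ElementaryMatrices.
Context (R : comPzRingType) (r : nat) (i j : 'I_r).
Local Notation e := (delta_mx i j : 'M[R]_r).

Lemma scale_delta_sqr (a b : R) :
  (a *: e) *m (b *: e) = (a * b *+ (i == j)) *: e.
Proof.
rewrite -scalemxAl -scalemxAr scalerA mul_delta_mx_cond eq_sym.
by case: (i == j); rewrite ?mulr1n// !mulr0n scaler0 scale0r.
Qed.

(** The factor [*+ (i == j)] treats two cases at once: off the diagonal the condition reads b = -a,
    on the diagonal (1 + a)(1 + b) = 1. *)
Lemma elementary_mulmx (a b : R) : a + b + a * b *+ (i == j) = 0 ->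
  (1%:M + a *: e) *m (1%:M + b *: e) = 1%:M.
Proof.
move=> h; rewrite mulmxDl mul1mx mulmxDr mulmx1 scale_delta_sqr.
rewrite -addrA (addrA (b *: e)) -!scalerDl (addrC b) h scale0r addr0 //.
Qed.

Lemma elementary_GL (a b : R) : a + b + a * b *+ (i == j) = 0 ->
  {g : GL R r | GLmx g = 1%:M + a *: e & GLinvmx g = 1%:M + b *: e}.
Proof.
move=> h; have h' : b + a + b * a *+ (i == j) = 0 by rewrite (addrC b) mulrC.
by exists (MkGL (elementary_mulmx h) (elementary_mulmx h')).
Qed.

End ElementaryMatrices.

Section SingleElementary.
Context (E : fieldType) (inf : place E) (Ehat : forall v : place E, completion v).
Context (r : nat).
Local Notation A := (adele inf Ehat).
Local Notation P := (fplace inf).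
Local Notation vg v := (vge (cval (Ehat (sval v)))).

Lemma single_scale_sum (v : P) (c d : Ehat (sval v)) (k : bool) : 
  single c + single d + single c * single d *+ k = single (c + d + c * d *+ k) :> A.
Proof.
apply: adele_eq => w; have [e|e] := pselect (v = w); last first.
  by case: k; rewrite ?mulr0n ?mulr1n !adeleD ?adeleM !single_neq// ?mulr0 ?addr0.
by subst w; case: k; rewrite ?mulr0n ?mulr1n ?addr0 !adeleD ?adeleM !singleE.
Qed.

Lemma single_elementary (v : P) (i j : 'I_r) (c : Ehat (sval v)) :
  1 + c *+ (i == j) != 0 ->
  {g : GL A r | GLmx g = 1%:M + single c *: delta_mx i j &
     GLinvmx g = 1%:M + single (- (c / (1 + c *+ (i == j)))) *: delta_mx i j}.
Proof.
move=> c0; apply: elementary_GL; rewrite single_scale_sum.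
suff -> : c + - (c / (1 + c *+ (i == j))) +
    c * - (c / (1 + c *+ (i == j))) *+ (i == j) = 0.
  by apply: adele_eq => w; apply: (single_ind (Q := fun w x => x = 0)).
case: (i == j) c0; rewrite ?mulr0n ?mulr1n ?addr0 => c0; last by rewrite divr1 subrr.
by field.
Qed.

End SingleElementary.

Section LevelResidue.
Context (E : fieldType) (inf : place E) (Ehat : forall v : place E, completion v).
Local Notation A := (adele inf Ehat).
Local Notation P := (fplace inf).
Local Notation vg v := (vge (cval (Ehat (sval v)))).

Definition congruence_at (r : nat) (v : P) (N : int) : set (GL A r) :=
  [set g : GL A r | forall i j, vg v N ((GLmx g - 1%:M) i j v) /\
                       vg v N ((GLinvmx g - 1%:M) i j v)].
Arguments congruence_at r v N : clear implicits.

Lemma congruence_at_subgroup (r : nat) (v : P) (N : int) : 0 <= N ->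
  subgroup (congruence_at r v N).
Proof.
move=> N0; split=> [i j|g h hg hh].
  by rewrite !subrr !mxE; split; apply: vge0.
have cl (a b : 'M[A]_r) : (forall i j, vg v N ((a - 1%:M) i j v)) ->
    (forall i j, vg v N ((b - 1%:M) i j v)) ->
    forall i j, vg v N ((a *m b - 1%:M) i j v).
  move=> ha hb i j.
  have -> : a *m b - 1%:M = (a - 1%:M) *m (b - 1%:M) + (a - 1%:M) + (b - 1%:M).
    rewrite mulmxBl mul1mx (mulmxBr a b) mulmx1; set c := b - _.
    by rewrite [RHS]addrAC subrK addrA subrK.
  rewrite !(mxE, adeleD); apply: vgeD; first apply: vgeD.
  - rewrite adele_sum; apply: vge_sum => k _; rewrite adeleM.
    apply: (@vge_le _ _ _ (N + N)); first lia.
    apply: vgeM; [exact: ha|exact: hb].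
  - by have := ha i j; rewrite !mxE.
  - by have := hb i j; rewrite !mxE.
move=> i j; split; [apply: (cl (GLinvmx g) (GLmx h))|apply: (cl (GLinvmx h) (GLmx g))];
  by move=> i' j'; have [] := hg i' j'; have [] := hh i' j'.
Qed.

(** Being open, [K] contains 1 + pi^N x e_oo for all integral x at [v]; being compact, it meets
    finitely many cosets of the congruence subgroup modulo pi^(N+1). If x and y give the same coset,
    the quotient of the two matrices shows that pi^N (y - x) is divisible by pi^(N+1). *)
Lemma level_finite_residue (r : nat) (K : level inf Ehat r) (v : P) :
  (0 < r)%N -> finite_residue (cval (Ehat (sval v))).
Proof.
move=> r0; pose o := Ordinal r0; pose val_v := cval (Ehat (sval v)).
have K1 : level_set K 1%g by case: (level_subgroup K).
have [n fn nK] : exists2 n : P -> int, fsupp n & GLbox n 1%g `<=` level_set K.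
  have /open_GLP := level_open K; exact.
(* [n v] keeps the matrices inside [K]; the lower bound 1 makes every 1 + pi^N x a unit. *)
pose N := Num.max (n v) 1.
have NnV : n v <= N by rewrite le_max lexx.
have N1 : 1 <= N by rewrite le_max lexx orbT.
have congr_nbhs : nbhs (1%g : GL A r) (congruence_at r v (N + 1)).
  apply/nbhs_GLP; exists (fun w => if `[< w = v >] then N + 1 else 0).
    apply: (fsupp_sub (finite_set1 v)) => w /= wv.
    by case: ifP => // /asboolP.
  move=> g [h1 h2] i j; have := h1 i j v; have := h2 i j v.
  by case: asboolP.
have cN (x : Ehat (sval v)) : vg v 0 x -> vg v N (upow val_v N * x).
  by rewrite vge_upowMl subrr.
have unit1 (c : Ehat (sval v)) : vg v N c -> 1 + c != 0 /\ val_v (1 + c) = 0.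
  move=> hc; have := @val_addl _ val_v 1 c N; rewrite Defs.val1 oner_neq0.
  by apply => //; lia.
have G (x : Ehat (sval v)) : exists g : GL A r, vg v 0 x ->
    [/\ level_set K g, GLmx g = 1%:M + single (upow val_v N * x) *: delta_mx o o &
    GLinvmx g = 1%:M +
      single (- (upow val_v N * x / (1 + upow val_v N * x))) *: delta_mx o o].
  have [x0|] := boolP (vg v 0 x); last by exists 1%g.
  have [c0 c1] := unit1 _ (cN x x0).
  have := @single_elementary E inf Ehat r v o o (upow val_v N * x).
  rewrite eqxx mulr1n => /(_ c0)[g e1 e2]; exists g => _; split=> //.
  apply: nK; split; rewrite ?e1 ?e2 /= addrC addKr => i j; rewrite !mxE => w.
    rewrite adeleM; case: (_ && _); last by rewrite mulr0; apply: vge0.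
    rewrite mulr1; apply: (single_ind (Q := fun w => vg w (n w))) => [|_]; last exact: vge0.
    by apply: vge_le NnV _; apply: cN.
  rewrite adeleM; case: (_ && _); last by rewrite mulr0; apply: vge0.
  rewrite mulr1; apply: (single_ind (Q := fun w => vg w (n w))) => [|_]; last exact: vge0.
  rewrite vgeN mulrC vgeMl ?invr_neq0// valV// c1 oppr0 subr0.
  by apply: vge_le NnV _; apply: cN.
have [M [cl hcl]] := compact_coset_label (@level_compact _ _ _ _ K)
  (@congruence_at_subgroup r v (N + 1) ltac:(lia)) congr_nbhs.
have [g hg] := choice G.
exists 'I_M.+1, (cl \o g) => x y hx hy /= exy.
have [Kx ex ix] := hg x hx; have [Ky ey iy] := hg y hy.
have [+ _] := hcl _ _ Kx Ky exy o o.
rewrite -[GLmx (_ * _)%g]/(GLinvmx (g x) *m GLmx (g y)) ix ey.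
set c := upow val_v N * x; set d := upow val_v N * y.
have [c0 c1] := unit1 _ (cN x hx).
have -> : (1%:M + single (- (c / (1 + c))) *: delta_mx o o) *m
    (1%:M + single d *: delta_mx o o) - 1%:M =
    single ((d - c) / (1 + c)) *: delta_mx o o :> 'M[A]_r.
  rewrite mulmxDl mul1mx mulmxDr mulmx1 scale_delta_sqr eqxx mulr1n.
  rewrite addrAC [1%:M + _ - _]addrAC subrr add0r addrA -!scalerDl [single d + _]addrC.
  have := @single_scale_sum E inf Ehat v (- (c / (1 + c))) d true.
  rewrite mulr1n => ->; congr (single _ *: _); rewrite mulr1n.
  by field.
rewrite mxE mxE !eqxx andbT mulr1n mulr1 singleE.
rewrite mulrC vgeMl ?invr_neq0// valV// c1 oppr0 subr0.
rewrite /c /d -mulrBr vge_upowMl -vgeN opprB; apply: vge_le; lia.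
Qed.

End LevelResidue.

(** * Maximal compact subgroups *)

Lemma mulmx_conj (R : comPzRingType) (n : nat) (X Y P Q : 'M[R]_n) :
  Y *m X = 1%:M -> (X *m P *m Y) *m (X *m Q *m Y) = X *m (P *m Q) *m Y.
Proof.
by move=> YX; rewrite mulmxA mulmxA -(mulmxA _ Y) YX mulmx1 -(mulmxA X).
Qed.

Section LocalFrame.
Context (K : fieldType) (v : place K) (n : nat).

Lemma vge_det (h : 'M[K]_n) : (forall i j, vge v 0 (h i j)) -> vge v 0 (\det h).
Proof.
move=> hh; apply: vge_sum => s _; apply: vge0M.
  by apply: vgeXn; rewrite vgeN; apply: vge1.
elim/big_ind: _ => //; first exact: vge1.
by move=> x y; apply: vge0M.
Qed.

Definition replace_col (h : 'M[K]_n) (x : 'cV[K]_n) (i : 'I_n) : 'M[K]_n :=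
  \matrix_(a, b) if b == i then x a 0 else h a b.

Lemma cramer_rule (h : 'M[K]_n) (x : 'cV[K]_n) i :
  (\adj h *m x) i 0 = \det (replace_col h x i).
Proof.
rewrite (expand_det_col _ i) mxE; apply: eq_bigr => k _.
rewrite !mxE eqxx mulrC; congr (_ * _); rewrite /cofactor; congr (_ * \det _).
by apply/matrixP => a b; rewrite !mxE eq_sym (negbTE (neq_lift _ _)).
Qed.

(* Among the families of [n] independent vectors of [S], one whose determinant
   has minimal valuation is a frame: by Cramer's rule the coordinates of a
   vector of [S] in it are quotients of such determinants by the minimal one. *)
Lemma local_frame (S : set 'cV[K]_n) (m : int) :
  (forall x, S x -> forall i, vge v 0 (x i 0)) ->
  (forall i, S (upow v m *: delta_mx i 0)) ->
  exists h : 'M[K]_n, [/\ h \in unitmx, forall j, S (col j h) &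
    forall x, S x -> forall i, vge v 0 ((invmx h *m x) i 0)].
Proof.
move=> Sint Se.
pose T (h : 'M[K]_n) := h \in unitmx /\ forall j, S (col j h).
have Tval h : (forall j, S (col j h)) -> vge v 0 (\det h).
  move=> hS; apply: vge_det => i j.
  by have := Sint _ (hS j) i; rewrite mxE.
have ex : exists k : nat, `[< exists2 h, T h & v (\det h) = k%:Z >].
  have T0 : T (upow v m)%:M.
    split; first by rewrite unitmxE det_scalar unitfE expf_neq0 ?upow_neq0.
    move=> j; suff -> : col j (upow v m)%:M = upow v m *: delta_mx j 0 by [].
    by apply/colP => i; rewrite !mxE eqxx andbT mulr_natr.
  pose h0 : 'M[K]_n := (upow v m)%:M.
  exists `|v (\det h0)|%N; apply/asboolP; exists h0 => //; have := Tval _ T0.2.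
  have := T0.1; rewrite unitmxE unitfE => d0; rewrite vge_val// -/h0; lia.
case: (ex_minnP ex) => k /asboolP[h [hu hS] hk] kmin.
have d0 : \det h != 0 by rewrite -unitfE -unitmxE.
exists h; split=> // x Sx i.
rewrite /invmx hu -scalemxAl mxE cramer_rule.
rewrite vgeMl ?invr_neq0// valV// hk opprK add0r.
have S' j : S (col j (replace_col h x i)).
  have [->|ji] := eqVneq j i.
    suff -> : col i (replace_col h x i) = x by [].
    by apply/colP => a; rewrite !mxE eqxx.
  suff -> : col j (replace_col h x i) = col j h by [].
  by apply/colP => a; rewrite !mxE (negbTE ji).
have [->|d'0] := eqVneq (\det (replace_col h x i)) 0; first exact: vge0.
have := Tval _ S'; rewrite !vge_val//.
case ed: (v (\det _)) => [d|//] _.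
rewrite lez_nat; apply: kmin; apply/asboolP; exists (replace_col h x i) => //.
by split=> //; rewrite unitmxE unitfE.
Qed.

End LocalFrame.

Section MaximalCompact.
Context (E : fieldType) (inf : place E) (Ehat : forall v : place E, completion v).
Context (r : nat).
Local Notation A := (adele inf Ehat).
Local Notation P := (fplace inf).
Local Notation vg v := (vge (cval (Ehat (sval v)))).
Local Notation G := (GL A r).
Implicit Types g h u : G.

Lemma mx_at_inj p q (M N : 'M[A]_(p, q)) : (forall v, mx_at v M = mx_at v N) -> M = N.
Proof.
move=> h; apply/matrixP => i j; apply: adele_eq => v.
by have /matrixP/(_ i j) := h v; rewrite !mxE.
Qed.

Lemma mx_at1 (v : P) : mx_at v (1%:M : 'M[A]_r) = 1%:M.
Proof. by apply/matrixP => i j; rewrite !mxE; case: (i == j). Qed.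

Definition GLint : set G := [set g | GLbounded (fun=> 0) g].

Lemma GLint_subgroup : subgroup GLint.
Proof.
split; first by split; apply: mintegral1.
by move=> g h [g1 g2] [h1 h2]; split; apply: mintegralM.
Qed.

Definition GLint_conj h : set G := [set g | GLint (h^-1 * g * h)%g].

Lemma GLint_conj_subgroup h : subgroup (GLint_conj h).
Proof.
exact: (subgroup_conj GLint_subgroup h).
Qed.

(** [S v] is the largest [N]-stable module of integral vectors at [v]. Boundedness puts pi^|n v|
    O_v^r inside it, so [local_frame] supplies a basis [hv v], in which [N] acts integrally. Where
    [n v = 0] the basis matrix and its inverse are both integral, hence the local bases glue to an
    adelic matrix. *)
Lemma bounded_subgroup_conj (N : set G) (n : P -> int) : subgroup N -> fsupp n ->
  (forall g, N g -> GLbounded n g) -> exists h, N `<=` GLint_conj h.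
Proof.
move=> sN fn bN.
pose S v : set 'cV[Ehat (sval v)]_r :=
  [set x | forall g, N g -> forall i, vg v 0 ((mx_at v (GLmx g) *m x) i 0)].
have Sint v x : S v x -> forall i, vg v 0 (x i 0).
  move=> Sx i; have := Sx 1%g (subgroup1 sN) i.
  by rewrite -[GLmx 1%g]/(1%:M) mx_at1 mul1mx.
have Se v i : S v (upow (cval (Ehat (sval v))) `|n v| *: delta_mx i 0).
  move=> g /bN[gn _] k; rewrite -scalemxAr mxE vge_upowMl.
  rewrite -colE !mxE; by apply: vge_le (gn k i v); lia.
have hh v := cid (local_frame (Sint v) (Se v)).
pose hv v := sval (hh v).
have hP v : [/\ hv v \in unitmx, forall j, S v (col j (hv v)) &
  forall x, S v x -> forall i, vg v 0 ((invmx (hv v) *m x) i 0)] := svalP (hh v).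
have hi i j v : vg v 0 (hv v i j).
  by have [_ hS _] := hP v; have := Sint v _ (hS j) i; rewrite mxE.
have hj i j v : vg v (- `|n v|) (invmx (hv v) i j).
  have [_ _ /(_ _ (Se v j) i)] := hP v.
  by rewrite -scalemxAr mxE vge_upowMl sub0r -colE mxE.
have fm : fsupp (fun v => - `|n v|) by apply: (fsupp1 (f := fun x => - `|x|)).
pose H : 'M[A]_r := \matrix_(i, j) sval (mk_adele (fsupp0 P) (hi i j)).
pose H' : 'M[A]_r := \matrix_(i, j) sval (mk_adele fm (hj i j)).
have HE v : mx_at v H = hv v.
  by apply/matrixP => i j; rewrite !mxE; case: mk_adele.
have H'E v : mx_at v H' = invmx (hv v).
  by apply/matrixP => i j; rewrite !mxE; case: mk_adele.
have HH' : H *m H' = 1%:M.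
  by apply: mx_at_inj => v; rewrite mx_atM HE H'E mx_at1 mulmxV//; have [] := hP v.
have H'H : H' *m H = 1%:M.
  by apply: mx_at_inj => v; rewrite mx_atM HE H'E mx_at1 mulVmx//; have [] := hP v.
have key g : N g -> mintegral (H' *m GLmx g *m H).
  move=> Ng i j v.
  have -> : (H' *m GLmx g *m H) i j v =
      (invmx (hv v) *m (mx_at v (GLmx g) *m col j (hv v))) i 0.
    have /matrixP/(_ i j) : mx_at v (H' *m GLmx g *m H) =
       invmx (hv v) *m (mx_at v (GLmx g) *m hv v) by rewrite !mx_atM HE H'E mulmxA.
    rewrite mxE => ->; rewrite colE !mulmxA -colE [RHS]mxE //.
  have [_ hS] := hP v; apply; move=> g' Ng'.
  rewrite mulmxA -mx_atM => k.
  exact: (hS j (g' * g)%g (subgroupM sN Ng' Ng)).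
exists (MkGL HH' H'H) => g Ng; split; first exact: key.
rewrite -[GLinvmx _]/(H' *m (GLinvmx g *m H)) mulmxA.
exact: (key g^-1%g (subgroupV sN Ng)).
Qed.

Lemma GLint_conj_compact h :
  (forall v : P, finite_residue (cval (Ehat (sval v)))) -> compact (GLint_conj h).
Proof.
move=> fr; have cQ := @compact_GLbounded E inf Ehat r fr (fun=> 0) (fsupp0 _).
rewrite /GLint_conj (conj_image GLint h).
apply: continuous_compact.
  by apply: continuous_subspaceT => g; apply: continuous_mull.
apply: continuous_compact => //.
by apply: continuous_subspaceT => g; apply: continuous_mulr.
Qed.

Lemma elementary_GLint (i j : 'I_r) : i != j ->
  exists2 u, GLint u & GLmx u = 1%:M + delta_mx i j.
Proof.
move=> ij; have : 1 + (-1) + 1 * (-1) *+ (i == j) = 0 :> A.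
  by rewrite (negbTE ij) mulr0n addr0 subrr.
move=> /elementary_GL[u e1 e2]; exists u; last by rewrite e1 scale1r.
have delta_int : mintegral (delta_mx i j : 'M[A]_r).
  by move=> a b v; rewrite mxE; case: (_ && _); [exact: vge1|exact: vge0].
split; rewrite ?e1 ?e2; apply: mboxD; try exact: mintegral1.
  by rewrite scale1r.
by rewrite scaleN1r; apply: mboxN.
Qed.

(* Conjugation by [g] preserves [M_r(O)] as soon as it maps [GL_r(O)] into
   itself; the entries [(g^-1)_ki * g_jl] involved are the same for [g^-1]. *)
Lemma GLint_normalized g :
  (forall u, GLint u -> GLint (g^-1 * u * g)%g) ->
  forall u, GLint u -> GLint (g * u * g^-1)%g.
Proof.
move=> hg.
have conj_delta i j k l : (GLinvmx g *m delta_mx i j *m GLmx g) k l =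
    GLinvmx g k i * GLmx g j l.
  rewrite mxE (bigD1 j)//= big1 ?addr0 => [|p pj].
    rewrite mxE (bigD1 i)//= big1 ?addr0 => [|p pi]; first by rewrite mxE !eqxx mulr1.
    by rewrite mxE (negbTE pi) mulr0.
  rewrite mxE big1 ?mul0r// => q _; by rewrite mxE (negbTE pj) andbF mulr0.
have off i j : i != j -> mintegral (GLinvmx g *m delta_mx i j *m GLmx g).
  move=> ij; have [u uint ue] := elementary_GLint ij.
  have [+ _] := hg u uint.
  rewrite -[GLmx _]/(GLinvmx g *m GLmx u *m GLmx g) ue mulmxDr mulmx1 mulmxDl GLmulVl.
  move=> /mboxB/(_ (@mintegral1 E inf Ehat r)).
  by rewrite addrC addKr.
have all i j k l : integral (GLinvmx g k i * GLmx g j l).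
  rewrite -conj_delta; have [<-|ij] := eqVneq i j; last exact: off.
  (* The relation e_ii = e_ip e_pi reduces the diagonal case to the off-diagonal one when a second
     index exists; in rank one the product in question is the entry of g^-1 g = 1. *)
  have [[p pi]|np] := pselect (exists p, p != i).
    have -> : GLinvmx g *m delta_mx i i *m GLmx g =
        (GLinvmx g *m delta_mx i p *m GLmx g) *m
        (GLinvmx g *m delta_mx p i *m GLmx g).
      by rewrite (mulmx_conj _ _ (GLmulV g)) mul_delta_mx.
    by apply: mintegralM; apply: off => //; rewrite eq_sym.
  have eqi p : p = i.
    by apply/eqP/negP => /negP pi; apply: np; exists p.
  rewrite conj_delta (eqi k) (eqi l).
  have /matrixP/(_ i i) := GLmulVl g; rewrite mxE (bigD1 i)//= big1 ?addr0.
    by move=> ->; apply: mintegral1.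
  by move=> p; rewrite (eqi p) eqxx.
have conj_int (M : 'M[A]_r) : mintegral M -> mintegral (GLmx g *m M *m GLinvmx g).
  move=> Mint i j; rewrite mxE; apply: abox_sum => p _.
  rewrite mxE mulr_suml; apply: abox_sum => q _.
  rewrite mulrAC [X in X * _]mulrC => v; rewrite adeleM; apply: vge0M.
    exact: all.
  exact: Mint.
move=> u [u1 u2]; split; first exact: conj_int.
rewrite -[GLinvmx _]/(GLmx g *m (GLinvmx u *m GLinvmx g)) mulmxA.
exact: conj_int.
Qed.

Hypothesis fr : forall v : P, finite_residue (cval (Ehat (sval v))).

(** A larger compact subgroup lies in some [GLint_conj h']. Then u |-> k^-1 u k with k = h^-1 h'
    maps GL_r(O) into itself, by [GLint_normalized] so does the inverse conjugation, and this brings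
    the larger group back into [GLint_conj h]. *)
Lemma maximal_compact_conj (h : G) : maximal_compact_subgroup (GLint_conj h).
Proof.
split; first by split; [exact: GLint_conj_subgroup|exact: GLint_conj_compact].
move=> N [sN cN] hN.
have [n fn bN] := compact_bounded cN.
have [h' hh'] := bounded_subgroup_conj sN fn bN.
apply/seteqP; split; last exact: hN.
move=> g /hh' hg.
pose k := (h^-1 * h')%g.
have kn u : GLint u -> GLint (k^-1 * u * k)%g.
  move=> hu; rewrite /k conj_quotientV; apply: hh'; apply: hN.
  by rewrite /GLint_conj /= conj_conjV.
by have := GLint_normalized kn hg; rewrite /k conj_quotient.
Qed.

Lemma maximal_compact_is_conj (M : set G) : maximal_compact_subgroup M ->
  exists h, M = GLint_conj h.
Proof.
move=> [[sM cM] maxM]; have [n fn bM] := compact_bounded cM.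
have [h hM] := bounded_subgroup_conj sM fn bM.
by exists h; apply: esym; apply: (maxM _ _ hM); case: (maximal_compact_conj h).
Qed.

End MaximalCompact.

(** * Adelic linear bijections *)

Section LinearMatrix.
Context (R : comPzRingType) (n : nat).

Lemma col_sum_delta (x : 'cV[R]_n) : x = \sum_j x j 0 *: delta_mx j 0.
Proof.
apply/colP => i; rewrite summxE (bigD1 i)//= big1 ?addr0 => [|j ji].
  by rewrite !mxE !eqxx mulr1.
by rewrite !mxE eq_sym (negbTE ji) mulr0.
Qed.

Lemma linear_mulmx (f : 'cV[R]_n -> 'cV[R]_n) :
  (forall x y, f (x + y) = f x + f y) -> (forall c x, f (c *: x) = c *: f x) ->
  exists M : 'M[R]_n, forall x, f x = M *m x.
Proof.
move=> fD fZ; exists (\matrix_(i, j) f (delta_mx j 0) i 0) => x.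
have f0 : f 0 = 0 by have := fZ 0 0; rewrite !scale0r.
rewrite [x in RHS]col_sum_delta {1}[x]col_sum_delta.
rewrite (big_morph f fD f0) mulmx_sumr; apply: eq_bigr => j _.
rewrite fZ -scalemxAr -colE; congr (_ *: _).
by apply/colP => i; rewrite !mxE.
Qed.

Lemma linear_GL (f g : 'cV[R]_n -> 'cV[R]_n) :
  (forall x y, f (x + y) = f x + f y) -> (forall c x, f (c *: x) = c *: f x) ->
  cancel f g -> cancel g f ->
  exists k : GL R n, (forall x, f x = GLmx k *m x) /\ (forall x, g x = GLinvmx k *m x).
Proof.
move=> fD fZ fK gK.
have gD x y : g (x + y) = g x + g y by rewrite -{1}[x]gK -{1}[y]gK -fD fK.
have gZ c x : g (c *: x) = c *: g x by rewrite -{1}[x]gK -fZ fK.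
have [M hM] := linear_mulmx fD fZ; have [N hN] := linear_mulmx gD gZ.
have id1 (P : 'M[R]_n) : (forall x : 'cV[R]_n, P *m x = x) -> P = 1%:M.
  move=> h; apply/matrixP => i j.
  have /colP/(_ i) := h (delta_mx j 0); rewrite -colE !mxE => ->.
  by rewrite eqxx andbT.
have MN : M *m N = 1%:M by apply: id1 => x; rewrite -mulmxA -hN -hM gK.
have NM : N *m M = 1%:M by apply: id1 => x; rewrite -mulmxA -hM -hN fK.
by exists (MkGL MN NM).
Qed.

End LinearMatrix.

Lemma minimal_valuation (K : fieldType) (v : place K) (n : nat) (x : 'I_n -> K) :
  (exists i, x i != 0) ->
  exists N, (forall i, vge v N (x i)) /\ ~ (forall i, vge v (N + 1) (x i)).
Proof.
move=> [i0 x0]; case: (@Order.TotalTheory.arg_minP _ _ _ i0 (fun i => x i != 0) (fun i => v (x i)) x0) => i xi mini.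
exists (v (x i)); split=> [j|/(_ i)].
  by have [->|xj] := eqVneq (x j) 0; [exact: vge0|rewrite vge_val// mini].
by rewrite vge_val// gerDl.
Qed.

Section AdelicLinear.
Context (F : fieldType) (L : fieldExtType F).
Context (inf : place F) (infL : place L).
Context (Fhat : forall v : place F, completion v).
Context (Lhat : forall w : place L, completion w).
Context (iota : {rmorphism adele inf Fhat -> adele infL Lhat}).
Context (r r' : nat).
Local Notation AF := (adele inf Fhat).
Local Notation AL := (adele infL Lhat).
Local Notation PF := (fplace inf).
Local Notation PL := (fplace infL).
Local Notation vF v := (vge (cval (Fhat (sval v)))).
Local Notation vL w := (vge (cval (Lhat (sval w)))).

(** [u w] stands for the place of F below [w] and [e w] for the ramification index. The arguments
    below see the canonical map [iota] only through these hypotheses, not through its local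
    embeddings. *)
Context (u : PL -> PF) (e : PL -> nat).
Hypothesis e_gt0 : forall w, (0 < e w)%N.
Hypothesis iota_zero : forall (a : AF) w, a (u w) = 0 -> iota a w = 0.
Hypothesis iota_val : forall (a : AF) w, a (u w) != 0 ->
  iota a w != 0 /\
  cval (Lhat (sval w)) (iota a w) = (e w)%:Z * cval (Fhat (sval (u w))) (a (u w)).

Lemma iota_vge (a : AF) w N : vL w ((e w)%:Z * N) (iota a w) = vF (u w) N (a (u w)).
Proof.
have [a0|a0] := eqVneq (a (u w)) 0; first by rewrite iota_zero// a0 !vge0.
have [i0 iv] := iota_val a0; rewrite !vge_val// iv ler_pM2l// ltz_nat.
exact: e_gt0.
Qed.

Lemma iota_vge0 (a : AF) w : vL w 0 (iota a w) = vF (u w) 0 (a (u w)).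
Proof. by rewrite -iota_vge mulr0. Qed.

Lemma iota_eq (a a' : AF) w : a (u w) = a' (u w) -> iota a w = iota a' w.
Proof.
move=> aa; apply/eqP; rewrite -subr_eq0 -adeleN -adeleD -raddfB iota_zero//.
by rewrite adeleD adeleN aa subrr.
Qed.

Definition idem v : AF := single (v := v) 1.

Lemma iota_idem_eq w : iota (idem (u w)) w = 1.
Proof.
rewrite (@iota_eq _ 1); first by rewrite rmorph1.
by rewrite singleE.
Qed.

Lemma iota_idem_neq v w : u w <> v -> iota (idem v) w = 0.
Proof. by move=> uw; rewrite iota_zero// single_neq// => /esym. Qed.

(** The adele with a simple pole at [v] and 0 elsewhere is mapped by [iota] to an adele with a pole
    at every place above [v], and an adele has finitely many poles. *)
Lemma finite_fiber v : finite_set [set w | u w = v].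
Proof.
pose a : AF := single (upow (cval (Fhat (sval v))) (-1)).
apply: sub_finite_set (adele_int (iota a)) => w /= uw; subst v.
by rewrite iota_vge0 singleE vge_val ?upow_neq0// val_upow.
Qed.

Lemma fsupp_pull (n : PF -> int) : fsupp n -> fsupp (fun w => (e w)%:Z * n (u w)).
Proof.
move=> fn.
have fS : finite_set (\bigcup_(v in [set v | n v != 0]) [set w | u w = v]).
  by apply: bigcup_finite => // v _; apply: finite_fiber.
apply: (fsupp_sub fS) => w /= h; apply/eqP; rewrite mulf_eq0; apply/orP; right.
by apply/negP => /negP nu; apply: h; exists (u w).
Qed.

Section Bijection.
Variable (b : adelic_linear iota r r').

Lemma adelicD x y : b (x + y) = b x + b y. Proof. exact: raddfD. Qed.
Lemma adelicZ c x : b (c *: x) = iota c *: b x. Proof. exact: linearZ. Qed.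

Lemma adelic_sum x : b x = \sum_i iota (x i 0) *: b (delta_mx i 0).
Proof.
rewrite {1}(col_sum_delta x).
by rewrite (big_morph b adelicD (raddf0 b)); apply: eq_bigr => j _; rewrite adelicZ.
Qed.

Lemma adelic_bound : exists2 m : PL -> int, fsupp m &
  forall w N (x : 'cV[AF]_r), (forall i, vF (u w) N (x i 0 (u w))) ->
    forall j, vL w ((e w)%:Z * N + m w) (b x j 0 w).
Proof.
have h i := mbox_exists (b (delta_mx i 0)).
have [m [fm hm]] := @fsupp_lower PL 'I_r (fun i => s2val (cid2 (h i)))
  (fun i => s2valP (cid2 (h i))).
exists m => // w N x hx j; rewrite adelic_sum summxE adele_sum.
apply: vge_sum => i _; rewrite mxE adeleM; apply: vgeM; first by rewrite iota_vge.
by apply: vge_le (s2valP' (cid2 (h i)) j 0 w); apply: hm.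
Qed.

Variable beta : 'cV[AL]_r' -> 'cV[AF]_r.
Hypothesis (bK : cancel b beta) (betaK : cancel beta b).

Lemma betaD x y : beta (x + y) = beta x + beta y.
Proof. by rewrite -{1}[x]betaK -{1}[y]betaK -adelicD bK. Qed.

Lemma betaN x : beta (- x) = - beta x.
Proof. by rewrite -{1}[x]betaK -raddfN bK. Qed.

Lemma betaB x y : beta (x - y) = beta x - beta y.
Proof. by rewrite betaD betaN. Qed.

Lemma beta0 : beta 0 = 0.
Proof. by rewrite -[RHS]bK raddf0. Qed.

Lemma betaZ c y : beta (iota c *: y) = c *: beta y.
Proof. by rewrite -{1}[y]betaK -adelicZ bK. Qed.

Hypothesis frF : forall v : PF, finite_residue (cval (Fhat (sval v))).

(** If [beta] were unbounded at [v], rescaling would give primitive vectors y_k at [v] whose images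
    tend to 0 above [v]. As the residue field is finite, they converge along an ultrafilter; the
    limit is nonzero at [v] but killed by [b], against injectivity. *)
Lemma beta_bounded_at v : exists M : int, forall x : 'cV[AF]_r,
  mintegral (b (idem v *: x)) -> forall i, vF v M (x i 0 v).
Proof.
apply: contrapT => /forallNP h.
pose val_v := cval (Fhat (sval v)).
have {}h (k : nat) : exists y : 'cV[AF]_r,
    [/\ forall i, vF v 0 (y i 0 v), ~ (forall i, vF v 1 (y i 0 v)) &
      forall w j, u w = v -> vL w ((e w)%:Z * k%:Z) (b (idem v *: y) j 0 w)].
  have /existsNP[x /not_implyP[hx nx]] := h (- k%:Z).
  have [|N [N1 N2]] := @minimal_valuation _ val_v r (fun i => x i 0 v).
    apply: contrapT => /forallNP h0; apply: nx => i.
    by have /negP := h0 i; rewrite negbK => /eqP ->; apply: vge0.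
  have Nk : N < - k%:Z.
    rewrite ltNge; apply/negP => kN; apply: nx => i; apply: vge_le kN _; exact: N1.
  (* [N] is the minimal valuation of [x] at [v] and lies below -k: dividing by pi^N makes the vector
     primitive and its integral image divisible by pi^k. *)
  exists (single (upow val_v (- N)) *: x); split.
  - by move=> i; rewrite mxE adeleM singleE vge_upowMl opprK add0r.
  - move=> h1; apply: N2 => i; have := h1 i.
    by rewrite mxE adeleM singleE vge_upowMl opprK addrC.
  - move=> w j uw; subst v; rewrite scalerA [idem _ * _]mulrC -scalerA adelicZ mxE adeleM.
    apply: (@vge_le _ _ _ ((e w)%:Z * k%:Z + 0)); first by rewrite addr0.
    apply: vgeM; last exact: hx.
    by rewrite iota_vge singleE vge_val ?upow_neq0// val_upow; lia.
have {}h := choice h; case: h => y hy.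
have [U [UU nearU]] := ultraFilterLemma (eventually_filter : ProperFilter \oo).
have lim i : exists c : Fhat (sval v),
    forall N, U [set k | vF v N (y k i 0 v - c)].
  apply: (ultra_limit (M := 0)) => //.
  by apply: nearU; exists 0%N => // k _ /=; have [] := hy k.
have {}lim := choice lim; case: lim => c hc.
have FU : Filter U by apply: filter_filter.
have near N (k0 : nat) : exists2 k, (k0 <= k)%N & forall i, vF v N (y k i 0 v - c i).
  have H := @filter_forall nat 'I_r _ U FU (fun i => hc i N).
  have H0 : U [set k | (k0 <= k)%N] by apply: nearU; exists k0.
  have [k [/= h1 h2]] := filter_ex (filterI H0 H).
  by exists k.
pose z : 'cV[AF]_r := \col_i single (c i).
have [mb fmb hmb] := adelic_bound.
have bz0 : b z = 0.
  apply/matrixP => j j0; rewrite [j0]ord1 mxE; apply: adele_eq => w.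
  have zE : idem v *: z = z.
    by apply/colP => i; rewrite !mxE single1M singleE.
  have [uw|uw] := pselect (u w = v); last first.
    by rewrite -zE adelicZ mxE adeleM iota_idem_neq// mul0r.
  apply: (@vge_sep _ (cval (Lhat (sval w)))) => N.
  have [k kN hk] := near (`|N - mb w|%N)%:Z `|N|%N.
  have -> : z = idem v *: (z - y k) + idem v *: y k.
    by rewrite scalerBr zE subrK.
  rewrite adelicD mxE adeleD; apply: vgeD.
    rewrite adelicZ mxE adeleM -uw iota_idem_eq mul1r.
    apply: (@vge_le _ _ _ ((e w)%:Z * (`|N - mb w|%N)%:Z + mb w)).
      by have := e_gt0 w; nia.
    apply: hmb => i; rewrite uw !mxE adeleD adeleN singleE -vgeN opprB.
    exact: hk.
  have [_ _ /(_ w j uw)] := hy k; apply: vge_le.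
  by have := e_gt0 w; nia.
have z0 : z = 0 by rewrite -(bK z) bz0 beta0.
have [k _ hk] := near 1 0%N.
have [_ + _] := hy k; apply=> i.
have c0 : c i = 0.
  by have /colP/(_ i) := z0; rewrite !mxE => /(congr1 (fun a : AF => a v)); rewrite singleE.
by have := hk i; rewrite c0 subr0.
Qed.

(* If the preimages of integral vectors were unbounded at infinitely many
   places, an integral vector gathering witnesses at all these places would
   have a preimage that is not adelic. *)
Lemma beta_bounded : exists2 m : PF -> int, fsupp m &
  forall y, mintegral y -> mbox m (beta y).
Proof.
pose S : set PF := [set v | exists x : 'cV[AF]_r, mintegral (b (idem v *: x)) /\
  ~ (forall i, vF v 0 (x i 0 v))].
have h v : exists x : 'cV[AF]_r, S v -> mintegral (b (idem v *: x)) /\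
    ~ (forall i, vF v 0 (x i 0 v)).
  by have [[x hx]|nS] := pselect (S v); [exists x|exists 0].
have {}h := choice h; case: h => x hx.
pose yw i w : Lhat (sval w) :=
  if `[< S (u w) >] then b (idem (u w) *: x (u w)) i 0 w else 0.
have yint i w : vL w 0 (yw i w).
  rewrite /yw; case: asboolP => [Sw|_]; last exact: vge0.
  by have [+ _] := hx _ Sw; apply.
have [y yE] : exists y : 'cV[AL]_r', forall i w, y i 0 w = yw i w.
  exists (\col_i sval (mk_adele (fsupp0 PL) (yint i))) => i w.
  by rewrite mxE; case: mk_adele.
have ey v : S v -> idem v *: beta y = idem v *: x v.
  move=> Sv; rewrite -betaZ -[RHS]bK; congr beta.
  apply/matrixP => i i0; rewrite [i0]ord1; apply: adele_eq => w.
  rewrite adelicZ !mxE !adeleM.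
  have [uw|uw] := pselect (u w = v); last by rewrite iota_idem_neq// !mul0r.
  subst v; rewrite yE /yw asboolT//.
  by rewrite adelicZ mxE adeleM iota_idem_eq !mul1r.
have fS : finite_set S.
  have fU : finite_set (\bigcup_(i in [set: 'I_r]) [set v | ~~ vF v 0 (beta y i 0 v)]).
    by apply: bigcup_finite => // i _; apply: adele_int.
  apply: sub_finite_set fU => v Sv; have [_ nx] := hx v Sv.
  have /existsNP[i /negP ni] := nx; exists i => //=.
  have /colP/(_ i) := ey v Sv; rewrite !mxE => /(congr1 (fun a : AF => a v)).
  by rewrite !adeleM singleE !mul1r => ->.
have M v := cid (beta_bounded_at v).
exists (fun v => if `[< S v >] then sval (M v) else 0).
  by apply: (fsupp_sub fS) => v /asboolPn/negbTE ->.
move=> y' hy' i j v; rewrite [j]ord1.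
have ib : mintegral (b (idem v *: beta y')).
  rewrite adelicZ betaK => i' j' w; rewrite mxE adeleM.
  apply: vge0M; last exact: hy'.
  rewrite iota_vge0; apply: (single_ind (Q := fun w => vF w 0)); first exact: vge1.
  by move=> _; apply: vge0.
case: asboolP => [_|nS]; first exact: (svalP (M v)).
by apply: contrapT => ni; apply: nS; exists (beta y'); split=> // /(_ i).
Qed.

(** Scaling by an idele of F turns the bound on integral vectors into continuity of [beta] at 0. *)
Lemma beta_small (n : PF -> int) : fsupp n -> exists2 n' : PL -> int, fsupp n' &
  forall y, mbox n' y -> mbox n (beta y).
Proof.
move=> fn; have [m fm hm] := beta_bounded.
have fmn : fsupp (fun v => m v - n v) by apply: (fsupp2 (f := fun x y => x - y)).
exists (fun w => - ((e w)%:Z * (m (u w) - n (u w)))).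
  exact: (fsuppN (fsupp_pull fmn)).
move=> y hy; have : mintegral (iota (idele Fhat fmn) *: y).
  move=> i j w; rewrite mxE adeleM.
  rewrite -(subrr ((e w)%:Z * (m (u w) - n (u w)))); apply: vgeM.
    by rewrite iota_vge ideleE vge_upow.
  exact: hy.
move=> /hm; rewrite betaZ => /mbox_ideleM; apply: mbox_le => v.
by rewrite opprB addrCA subrr addr0.
Qed.

(** The label of [c] records, to high precision at [u w], the preimage under [b] of a vector with
    entry [c] at [w]. Equal labels make the preimage of the difference small, and [adelic_bound]
    carries this back to [w]; the precision [k] absorbs the losses [m v] and [mb w]. *)
Lemma finite_residue_above (r'_gt0 : (0 < r')%N) (w : PL) :
  finite_residue (cval (Lhat (sval w))).
Proof.
have [m fm hm] := beta_bounded; have [mb fmb hmb] := adelic_bound.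
pose v := u w; pose k := (`|m v| + `|mb w| + 1)%N.
have [I [cl hcl]] := finite_residueX (m v) k (frF v).
pose o := Ordinal r'_gt0.
pose y (c : Lhat (sval w)) : 'cV[AL]_r' := single c *: delta_mx o 0.
have yB c d : y c - y d = y (c - d).
  rewrite /y -scalerBl; congr (_ *: _).
  apply: adele_eq => w'; rewrite adeleD adeleN.
  have [ww|ww] := pselect (w = w'); first by subst w'; rewrite !singleE.
  by rewrite !single_neq// subr0.
have yint c : vL w 0 c -> mintegral (y c).
  move=> hc i j w'; rewrite mxE adeleM; apply: vge0M.
    by apply: (single_ind (Q := fun w => vL w 0)) => // _; apply: vge0.
  by rewrite mxE; case: (_ && _); [exact: vge1|exact: vge0].
exists {ffun 'I_r -> I}, (fun c => [ffun i => cl (beta (y c) i 0 v)]).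
move=> c d hc hd /ffunP ecd.
have hi i : vF v (m v + k%:Z) (beta (y (c - d)) i 0 v).
  rewrite -yB betaB mxE adeleD mxE adeleN; apply: hcl.
  - exact: hm (yint c hc) i 0 v.
  - exact: hm (yint d hd) i 0 v.
  - by have := ecd i; rewrite !ffunE.
have := hmb w _ _ hi o; rewrite betaK mxE adeleM singleE mxE !eqxx mulr1.
by apply: vge_le; rewrite /k -/v; have := e_gt0 w; nia.
Qed.

(** Multiplication by [h] is in particular linear over the adeles of F, so [b] embeds GL_r'(A_L)
    into GL_r(A_F), and [k] is the image of [h]. *)
Lemma conjugate_GL (h : GL AL r') : exists k : GL AF r,
  (forall x, GLmx h *m b x = b (GLmx k *m x)) /\
  (forall x, GLinvmx h *m b x = b (GLinvmx k *m x)).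
Proof.
have [||||k [k1 k2]] := @linear_GL AF r (fun x => beta (GLmx h *m b x))
    (fun x => beta (GLinvmx h *m b x)).
- by move=> x y; rewrite adelicD mulmxDr betaD.
- by move=> c x; rewrite adelicZ -scalemxAr betaZ.
- by move=> x; rewrite betaK mulmxA GLmulVl mul1mx bK.
- by move=> x; rewrite betaK mulmxA GLmulV mul1mx bK.
by exists k; split=> x; rewrite -?k1 -?k2 betaK.
Qed.

End Bijection.
End AdelicLinear.

(** * Cosets, and the finite index of K' *)

(** h^-1 is the product of h^(l-k-1), which lies in the monoid [Q], and of h^-l h^k, which lies in
    [H]. *)
Lemma inverse_closed (G : groupType) (Q H : set G) (h : G) (k l : nat) :
  Q 1%g -> (forall x y, Q x -> Q y -> Q (x * y)%g) -> H `<=` Q ->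
  (k < l)%N -> H ((h ^+ l)^-1 * h ^+ k)%g -> Q h -> Q h^-1%g.
Proof.
move=> Q1 QM HQ kl Hh Qh.
have QX n : Q (h ^+ n)%g by elim: n => [|n IH]; rewrite ?expg0// expgS; apply: QM.
have -> : (h^-1 = h ^+ (l - k).-1 * ((h ^+ l)^-1 * h ^+ k))%g.
  have el : l = (k + ((l - k).-1).+1)%N by lia.
  rewrite {2}el expgnDr invgM -mulgA mulVg mulg1 expgS invgM mulgA mulgV mul1g //.
by apply: QM => //; apply: HQ.
Qed.

Lemma finite_cosets (G : groupType) (M H : set G) (I : finType) (cl : G -> I) :
  subgroup H ->
  (forall g g', M g -> M g' -> cl g = cl g' -> H (g^-1 * g')%g) ->
  exists i, has_index M H i.
Proof.
move=> sH hcl; apply/finite_setP.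
pose coset (x : G) := [set (x * h)%g | h in H].
pose rep i := xget 1%g [set g | M g /\ cl g = i].
have fI : finite_set [set coset (rep i) | i in [set: I]].
  by apply: finite_image; apply: finite_finset.
apply: sub_finite_set fI => _ [x Mx <-]; exists (cl x) => //.
have [Mr er] : M (rep (cl x)) /\ cl (rep (cl x)) = cl x.
  by rewrite /rep; case: xgetP => [y _ //|/(_ x)]; case.
have h1 := hcl _ _ Mr Mx er; have h2 := hcl _ _ Mx Mr (esym er).
apply/seteqP; split=> _ [h Hh <-].
  exists (x^-1 * rep (cl x) * h)%g; first exact: subgroupM.
  by rewrite !mulgA mulgV mul1g.
exists ((rep (cl x))^-1 * x * h)%g; first exact: subgroupM.
by rewrite !mulgA mulgV mul1g.
Qed.

Lemma index_pigeonhole (G : groupType) (M H : set G) (i B : nat) (g : 'I_B.+1 -> G) :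
  subgroup H -> has_index M H i -> (i <= B)%N -> (forall k, M (g k)) ->
  exists k l : 'I_B.+1, (k < l)%N /\ H ((g l)^-1 * g k)%g.
Proof.
move=> sH /card_set_bijP[f [fI finj _]] iB Mg.
pose S := [set [set (x * h)%g | h in H] | x in M].
pose coset (x : G) := [set (x * h)%g | h in H].
have Sg k : S (coset (g k)) by exists (g k).
have lt k : (f (coset (g k)) < i)%N by apply: fI; apply: Sg.
have [k [l [kl ekl]]] : exists k l : 'I_B.+1, k <> l /\ coset (g k) = coset (g l).
  apply: contrapT => /forallNP hn.
  have inj : injective (fun k => Ordinal (lt k)).
    move=> k l /(congr1 val)/= ekl; apply: contrapT => kl.
    have /forallNP/(_ l) := hn k; apply; split=> //.
    by apply: finj => //; rewrite inE; apply: Sg.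
  by have := leq_card _ inj; rewrite !card_ord leqNgt ltnS iB.
have mem x y : coset x = coset y -> H (y^-1 * x)%g.
  move=> exy; have : coset x x by exists 1%g; [exact: subgroup1|rewrite mulg1].
  by rewrite exy => -[h Hh <-]; rewrite mulgA mulVg mul1g.
have [kl'|lk|/val_inj//] := ltngtP k l.
  by exists k, l; split=> //; apply: mem.
by exists l, k; split=> //; apply: mem.
Qed.

Section Pullback.
Context (F : fieldType) (L : fieldExtType F).
Context (inf : place F) (infL : place L).
Context (Fhat : forall v : place F, completion v).
Context (Lhat : forall w : place L, completion w).
Context (iota : {rmorphism adele inf Fhat -> adele infL Lhat}).
Context (r r' : nat).
Local Notation AF := (adele inf Fhat).
Local Notation AL := (adele infL Lhat).
Local Notation PF := (fplace inf).
Local Notation PL := (fplace infL).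
Local Notation vF v := (vge (cval (Fhat (sval v)))).
Local Notation vL w := (vge (cval (Lhat (sval w)))).

Section GLAdelic.
Context (g : GL AL r') (b : adelic_linear iota r r').
Definition GL_adelic (x : 'cV[AF]_r) : 'cV[AL]_r' := GLmx g *m b x.
Fact GL_adelic_linear : GRing.linear_for (iota \; *:%R) GL_adelic.
Proof.
move=> c x y; rewrite /GL_adelic adelicD adelicZ mulmxDr -scalemxAr //.
Qed.
HB.instance Definition _ := GRing.isLinear.Build AF 'cV[AF]_r 'cV[AL]_r'
  (iota \; *:%R) GL_adelic GL_adelic_linear.
Definition GL_adelic_map : adelic_linear iota r r' := GL_adelic.
Lemma GL_adelicE x : GL_adelic_map x = GLmx g *m b x. Proof. by []. Qed.
End GLAdelic.

Context (u : PL -> PF) (e : PL -> nat).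
Hypothesis e_gt0 : forall w, (0 < e w)%N.
Hypothesis iota_zero : forall (a : AF) w, a (u w) = 0 -> iota a w = 0.
Hypothesis iota_val : forall (a : AF) w, a (u w) != 0 ->
  iota a w != 0 /\
  cval (Lhat (sval w)) (iota a w) = (e w)%:Z * cval (Fhat (sval (u w))) (a (u w)).
Hypothesis frF : forall v : PF, finite_residue (cval (Fhat (sval v))).
Context (K : level inf Fhat r).

Lemma level_nbhs : nbhs (1%g : GL AF r) (level_set K).
Proof.
apply: open_nbhs_nbhs; split; first exact: level_open.
by case: (level_subgroup K).
Qed.

Section WithInverse.
Variable (b : adelic_linear iota r r') (beta : 'cV[AL]_r' -> 'cV[AF]_r).
Hypothesis (bK : cancel b beta) (betaK : cancel beta b).

Lemma pullback_subgroup : subgroup (pullback_level K b).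
Proof.
have [K1 KM] := level_subgroup K.
split; first by exists 1%g => // x; rewrite !mul1mx.
move=> g h [k Kk gk] [l Kl hl]; exists (k^-1 * l)%g; first exact: KM.
have gi x : GLinvmx g *m b x = b (GLinvmx k *m x).
  rewrite -{1}[x]mul1mx -(GLmulV k) -mulmxA -gk mulmxA GLmulVl mul1mx //.
move=> x; rewrite -[GLmx (g^-1 * h)%g]/(GLinvmx g *m GLmx h) -mulmxA hl gi.
by rewrite mulmxA.
Qed.

(** By continuity of [beta], the matrix of [beta] o h o [b] is close to 1 when h and h^-1 are, hence
    lies in the open group [K]. *)
Lemma pullback_nbhs : nbhs (1%g : GL AL r') (pullback_level K b).
Proof.
have /nbhs_GLP[n fn nK] := level_nbhs.
have [n1 f1 h1] := beta_small e_gt0 iota_zero iota_val bK betaK frF fn.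
pose B := \matrix_(i, j) b (delta_mx j 0) i 0.
have bE j : b (delta_mx j 0) = col j B by apply/colP => i; rewrite !mxE.
have [n2 f2 h2] := mbox_exists B.
apply/nbhs_GLP; exists (fun w => n1 w - n2 w).
  by apply: (fsupp2 (f := fun x y => x - y)).
move=> h [hh hi]; have [k [k1 k2]] := conjugate_GL bK betaK h.
exists k; last exact: k1.
apply: nK.
have small (M : 'M[AL]_r') (N : 'M[AF]_r) :
    (forall x, M *m b x = b (N *m x)) -> mbox (fun w => n1 w - n2 w) (M - 1%:M) ->
    mbox n (N - 1%:M).
  move=> MN hM i j; have -> : (N - 1%:M) i j = beta ((M - 1%:M) *m b (delta_mx j 0)) i 0.
    by rewrite mulmxBl mul1mx MN (betaB bK betaK) !bK -colE !mxE eqxx andbT.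
  apply: h1; apply: mbox_le (mboxM hM _); last first.
    by rewrite bE => a c; rewrite mxE; apply: h2.
  by move=> w /=; rewrite subrK.
by split; [apply: small k1 hh|apply: small k2 hi].
Qed.

Lemma pullback_bounded : exists2 n : PL -> int, fsupp n &
  forall h, pullback_level K b h -> GLbounded n h.
Proof.
have [n fn nK] := compact_bounded (@level_compact _ _ _ _ K).
pose B := \matrix_(i, j) beta (delta_mx j 0) i 0.
have bE j : beta (delta_mx j 0) = col j B by apply/colP => i; rewrite !mxE.
have [n2 f2 h2] := mbox_exists B.
have [mb fmb hmb] := adelic_bound e_gt0 iota_zero iota_val b.
pose n3 v := n v + n2 v.
have f3 : fsupp n3 by apply: fsuppD.
exists (fun w => (e w)%:Z * n3 (u w) + mb w).
  by apply: fsuppD => //; exact: (fsupp_pull e_gt0 iota_zero iota_val f3).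
have bd (M : 'M[AL]_r') (N : 'M[AF]_r) :
    (forall x, M *m b x = b (N *m x)) -> mbox n N ->
    mbox (fun w => (e w)%:Z * n3 (u w) + mb w) M.
  move=> MN hN i j w.
  have -> : M i j = (b (N *m beta (delta_mx j 0))) i 0.
    by rewrite -MN betaK -colE mxE.
  apply: hmb => i'; apply: (mboxM hN _) => a c.
  by rewrite bE mxE.
have sP := pullback_subgroup.
move=> h Hh; have [k Kk hk] := Hh; have [k' Kk' hk'] := subgroupV sP Hh.
by split; [apply: bd hk _; case: (nK k Kk)|apply: bd hk' _; case: (nK k' Kk')].
Qed.

(** [drinfeld_index] picks a value by [xget] with default 0, so it means something only once an
    index exists. K' is bounded, hence contained in a conjugate of GL_r'(O_L); that conjugate is
    compact and K' is open, hence of finite index in it. *)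
Lemma pullback_index (r'_gt0 : (0 < r')%N) : exists M i,
  [/\ maximal_compact_subgroup M, pullback_level K b `<=` M &
      has_index M (pullback_level K b) i].
Proof.
have frL w := finite_residue_above e_gt0 iota_zero iota_val bK betaK frF r'_gt0 w.
have [n fn bn] := pullback_bounded.
have [h hh] := bounded_subgroup_conj pullback_subgroup fn bn.
have mc := maximal_compact_conj frL h.
have [N [cl hcl]] := compact_coset_label mc.1.2 pullback_subgroup pullback_nbhs.
have [i hi] := finite_cosets pullback_subgroup hcl.
by exists (GLint_conj h), i.
Qed.

End WithInverse.
End Pullback.

(** * Stabilizers of lattices *)

Section LatticeStabilizer.
Context (F : fieldType) (L : fieldExtType F).
Context (inf : place F) (infL : place L).
Context (Fhat : forall v : place F, completion v).
Context (Lhat : forall w : place L, completion w).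
Context (iota : {rmorphism adele inf Fhat -> adele infL Lhat}).
Context (r r' : nat).
Local Notation AF := (adele inf Fhat).
Local Notation AL := (adele infL Lhat).
Local Notation PF := (fplace inf).
Local Notation PL := (fplace infL).
Local Notation vF v := (vge (cval (Fhat (sval v)))).
Local Notation vL w := (vge (cval (Lhat (sval w)))).
Local Notation valF v := (cval (Fhat (sval v))).
Local Notation valL w := (cval (Lhat (sval w))).

Context (u : PL -> PF) (e : PL -> nat).
Hypothesis e_gt0 : forall w, (0 < e w)%N.
Hypothesis iota_zero : forall (a : AF) w, a (u w) = 0 -> iota a w = 0.
Hypothesis iota_val : forall (a : AF) w, a (u w) != 0 ->
  iota a w != 0 /\
  cval (Lhat (sval w)) (iota a w) = (e w)%:Z * cval (Fhat (sval (u w))) (a (u w)).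
Hypothesis frF : forall v : PF, finite_residue (cval (Fhat (sval v))).
Context (K : level inf Fhat r).

(* The elements of the largest [K]-stable submodule of [O_F^r]. *)
Definition level_lattice (x : 'cV[AF]_r) : Prop :=
  forall k, level_set K k -> mintegral (GLmx k *m x).

Lemma level_latticeD x y :
  level_lattice x -> level_lattice y -> level_lattice (x + y).
Proof. by move=> hx hy k Kk; rewrite mulmxDr; apply: mboxD; [apply: hx|apply: hy]. Qed.

Lemma level_latticeN x : level_lattice x -> level_lattice (- x).
Proof. by move=> hx k Kk; rewrite mulmxN; apply: mboxN; apply: hx. Qed.

Lemma level_latticeZ c x : integral c -> level_lattice x -> level_lattice (c *: x).
Proof.
move=> hc hx k Kk; rewrite -scalemxAr => i j v; rewrite mxE adeleM.
by apply: vge0M; [apply: hc|apply: hx].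
Qed.

Lemma level_lattice0 : level_lattice 0.
Proof. by move=> k _; rewrite mulmx0 => i j v; rewrite mxE; apply: vge0. Qed.

Lemma level_lattice_int x : level_lattice x -> mintegral x.
Proof.
by move=> /(_ _ (subgroup1 (level_subgroup K))); rewrite mul1mx.
Qed.

Lemma level_lattice_mul k x : level_set K k -> level_lattice x ->
  level_lattice (GLmx k *m x).
Proof.
move=> Kk hx k' Kk'; rewrite mulmxA.
exact: hx (k' * k)%g (subgroupM (level_subgroup K) Kk' Kk).
Qed.

Lemma level_lattice_idem x : (forall v : PF, level_lattice (idem Fhat v *: x)) ->
  level_lattice x.
Proof.
move=> h k Kk i j v; have := h v k Kk i j v.
by rewrite -scalemxAr mxE adeleM singleE mul1r.
Qed.

Lemma level_lattice_box : exists2 n : PF -> int, fsupp n &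
  forall x, mbox n x -> level_lattice x.
Proof.
have [n fn nK] := compact_bounded (@level_compact _ _ _ _ K).
exists (fun v => - n v); first exact: fsuppN.
move=> x hx k /nK[hk _]; apply: mbox_le (mboxM hk hx) => v.
by rewrite subrr.
Qed.

Lemma integral_single (v : PF) c : vF v 0 c -> integral (single c : AF).
Proof. by move=> hc; apply: abox_single. Qed.

(** A module over O_F can be cut into pieces at places of F, not of L. The part above [v] is
    therefore split further, as a finite sum over the places of L above [v]. *)
Lemma iota_idem_decomp (v : PF) : exists s : seq PL, (forall w, w \in (s : seq {classic PL}) -> u w = v) /\
  forall z : AL, iota (idem Fhat v) * z = \sum_(w <- s) single (z w).
Proof.
have [s us hs] := finite_uniq_seq (finite_fiber e_gt0 iota_zero iota_val v).
exists s; split=> [w /hs //|z]; apply: adele_eq => w.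
rewrite adele_sum adeleM; have [uw|uw] := pselect (u w = v); last first.
  rewrite (iota_idem_neq iota_zero uw) mul0r (@big1_seq _ _ _ {classic PL})// => w' /andP[_ w's].
  by rewrite single_neq// => ww; apply: uw; rewrite -ww; apply/hs.
have ws : (w : {classic PL}) \in s by apply/hs.
rewrite -uw (iota_idem_eq iota_zero) mul1r.
rewrite (@bigD1_seq _ _ _ {classic PL} s w)// singleE big1 => [|w' /eqP ww]; first by rewrite /= addr0.
by rewrite single_neq.
Qed.

Section WithInverse.
Variable (b : adelic_linear iota r r') (beta : 'cV[AL]_r' -> 'cV[AF]_r).
Hypothesis (bK : cancel b beta) (betaK : cancel beta b).

Definition image_lattice (y : 'cV[AL]_r') : Prop := level_lattice (beta y).
Definition stabilizes (z : 'M[AL]_r') : Prop :=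
  forall y, image_lattice y -> image_lattice (z *m y).

Lemma image_latticeD x y : image_lattice x -> image_lattice y -> image_lattice (x + y).
Proof. by rewrite /image_lattice (betaD bK betaK); apply: level_latticeD. Qed.

Lemma image_lattice0 : image_lattice 0.
Proof. by rewrite /image_lattice (beta0 bK); apply: level_lattice0. Qed.

Lemma image_lattice_sum (I : Type) (s : seq I) (P : pred I) (f : I -> 'cV[AL]_r') :
  (forall i, P i -> image_lattice (f i)) -> image_lattice (\sum_(i <- s | P i) f i).
Proof.
move=> h; elim/big_ind: _; [exact: image_lattice0|exact: image_latticeD|exact: h].
Qed.

Lemma image_lattice_idem y : (forall v : PF, image_lattice (iota (idem Fhat v) *: y)) ->
  image_lattice y.
Proof.
move=> h; apply: level_lattice_idem => v; rewrite -(betaZ bK betaK); exact: h.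
Qed.

Lemma stabilizesD z z' : stabilizes z -> stabilizes z' -> stabilizes (z + z').
Proof.
by move=> hz hz' y hy; rewrite mulmxDl; apply: image_latticeD; [apply: hz|apply: hz'].
Qed.

Lemma stabilizesN z : stabilizes z -> stabilizes (- z).
Proof.
move=> hz y hy; rewrite mulNmx /image_lattice (betaN bK betaK).
by apply: level_latticeN; apply: hz.
Qed.

Lemma stabilizesB z z' : stabilizes z -> stabilizes z' -> stabilizes (z - z').
Proof. by move=> hz /stabilizesN; apply: stabilizesD. Qed.

Lemma stabilizesM z z' : stabilizes z -> stabilizes z' -> stabilizes (z *m z').
Proof. by move=> hz hz' y hy; rewrite -mulmxA; apply/hz/hz'. Qed.

Lemma stabilizesZ c z : integral c -> stabilizes z -> stabilizes (iota c *: z).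
Proof.
move=> hc hz y hy; rewrite -scalemxAl /image_lattice (betaZ bK betaK).
by apply: level_latticeZ; [exact: hc|exact: hz].
Qed.

Lemma stabilizes1 : stabilizes 1%:M.
Proof. by move=> y; rewrite mul1mx. Qed.

Lemma stabilizes_pullback h : pullback_level K b h -> stabilizes (GLmx h).
Proof.
move=> [k Kk hk] y hy; rewrite /image_lattice -{1}(betaK y) hk bK.
exact: level_lattice_mul.
Qed.

Variable B : nat.
Hypothesis pigeon : forall g : 'I_B.+1 -> GL AL r', (forall k, GLint (g k)) ->
  exists k l : 'I_B.+1, (k < l)%N /\ pullback_level K b ((g l)^-1 * g k)%g.

(** The stabilizer of a lattice is a priori only a monoid. Two of the powers 1, h, ..., h^B lie in
    one coset of K', whose elements do stabilize the lattice, and [inverse_closed] applies. *)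
Lemma stabilizesV h : GLint h -> stabilizes (GLmx h) -> stabilizes (GLinvmx h).
Proof.
move=> hint hs.
have [|k [l [kl Hkl]]] := pigeon (g := fun k => (h ^+ k)%g).
  move=> k; elim: (nat_of_ord k) => [|n IH].
    by rewrite expg0; apply: subgroup1 (GLint_subgroup infL Lhat r').
  by rewrite expgS; exact: (subgroupM (GLint_subgroup infL Lhat r') hint IH).
apply: (@inverse_closed (GL AL r') [set g | stabilizes (GLmx g)] _ h k l _ _ _ kl Hkl hs).
- exact: stabilizes1.
- by move=> x y; apply: stabilizesM.
- exact: stabilizes_pullback.
Qed.

(* Two of the units [1 + t_k x] lie in the same coset of the stabilizer; this
   yields [(t_k - t_l) x (1 + t_l x)^-1] and then, since [t_k - t_l] divides
   [t_l], also [(1 + t_l x)^-1], whose inverse [1 + t_l x] therefore stabilizes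
   the lattice too. *)
Lemma stabilizes_difference (w : PL) (i j : 'I_r') (a : Lhat (sval w))
    (t : 'I_B.+1 -> Fhat (sval (u w))) :
  vL w 0 a -> (forall k, vF (u w) 0 (t k)) ->
  (forall k, 1 + iota (single (t k)) w * a *+ (i == j) != 0) ->
  (forall k, valL w (1 + iota (single (t k)) w * a *+ (i == j)) = 0) ->
  (forall k l : 'I_B.+1, (k < l)%N -> t k - t l != 0 /\
     vF (u w) (valF (u w) (t k - t l)) (t l)) ->
  exists k l : 'I_B.+1, (k < l)%N /\
    stabilizes (iota (single (t k - t l)) *: (single a *: delta_mx i j)).
Proof.
move=> ha ht ne0 val0 hd.
pose x : 'M[AL]_r' := single a *: delta_mx i j.
pose T k : AL := iota (single (t k)).
have Tint k : vL w 0 (T k w) by rewrite (iota_vge0 e_gt0 iota_zero iota_val) singleE.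
have g_ k : {g : GL AL r' | GLint g & GLmx g = 1%:M + T k *: x}.
  have [g e1 e2] := single_elementary (inf := infL) (ne0 k).
  exists g; last first.
    by rewrite e1 /x scalerA; congr (_ + _ *: _); rewrite [in RHS]mulrC singleM mulrC.
  have dint (c : Lhat (sval w)) : vL w 0 c -> mintegral (single c *: delta_mx i j : 'M[AL]_r').
    move=> hc p q; rewrite mxE => w'; rewrite adeleM; apply: vge0M.
      exact: abox_single hc w'.
    by rewrite mxE; case: (_ && _); [exact: vge1|exact: vge0].
  split; rewrite ?e1 ?e2; apply: mboxD; try exact: mintegral1; apply: dint.
    by apply: vge0M => //; apply: Tint.
  rewrite vgeN mulrC vgeMl ?invr_neq0 ?ne0// valV ?ne0// val0 oppr0 subr0.
  by apply: vge0M => //; apply: Tint.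
pose g k := s2val (g_ k).
have gint k : GLint (g k) by rewrite /g; case: (g_ k).
have gE k : GLmx (g k) = 1%:M + T k *: x by rewrite /g; case: (g_ k).
have [k [l [kl /stabilizes_pullback Hkl]]] := pigeon gint.
exists k, l; split; first exact: kl.
rewrite -/x.
pose U := GLinvmx (g l); pose W := U *m x.
have [d0 dl] := hd k l kl.
have iB : iota (single (t k - t l)) = T k - T l.
  rewrite -raddfB; congr (iota _); apply: adele_eq => v; rewrite adeleD adeleN.
  have [uv|uv] := pselect (u w = v); first by subst v; rewrite !singleE.
  by rewrite !single_neq// subr0.
have UG : U *m GLmx (g l) = 1%:M by apply: GLmulVl.
have hW : stabilizes (iota (single (t k - t l)) *: W).
  have -> : iota (single (t k - t l)) *: W = GLmx ((g l)^-1 * g k)%g - 1%:M.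
    rewrite -[GLmx (_ * _)%g]/(U *m GLmx (g k)).
    rewrite -UG -mulmxBr !gE opprD addrACA subrr add0r -scalerBl -iB -scalemxAr //.
  exact: stabilizesB Hkl stabilizes1.
have hTW : stabilizes (T l *: W).
  have -> : T l = iota (single (t l / (t k - t l))) * iota (single (t k - t l)).
    by rewrite -rmorphM singleM singleE divfK.
  rewrite -scalerA; apply: stabilizesZ hW; apply: integral_single.
  by rewrite mulrC vgeMl ?invr_neq0// valV// opprK add0r.
have hU : stabilizes U.
  have -> : U = 1%:M - T l *: W.
    by rewrite -UG gE mulmxDr mulmx1 -scalemxAr addrK.
  exact: stabilizesB stabilizes1 hTW.
have hG : stabilizes (GLmx (g l)).
  exact: (stabilizesV (subgroupV (GLint_subgroup infL Lhat r') (gint l)) hU).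
have -> : iota (single (t k - t l)) *: x =
    GLmx (g l) *m (iota (single (t k - t l)) *: W).
  by rewrite -scalemxAr mulmxA (GLmulV (g l)) mul1mx.
exact: stabilizesM.
Qed.

End WithInverse.
End LatticeStabilizer.

(** * Scaling [b] by an idele *)

Section Normalization.
Context (F : fieldType) (L : fieldExtType F).
Context (inf : place F) (infL : place L).
Context (Fhat : forall v : place F, completion v).
Context (Lhat : forall w : place L, completion w).
Context (iota : {rmorphism adele inf Fhat -> adele infL Lhat}).
Context (r r' : nat).
Local Notation AF := (adele inf Fhat).
Local Notation AL := (adele infL Lhat).
Local Notation PF := (fplace inf).
Local Notation PL := (fplace infL).
Local Notation vF v := (vge (cval (Fhat (sval v)))).
Local Notation vL w := (vge (cval (Lhat (sval w)))).
Local Notation valF v := (cval (Fhat (sval v))).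
Local Notation valL w := (cval (Lhat (sval w))).

Context (u : PL -> PF) (e : PL -> nat).
Hypothesis e_gt0 : forall w, (0 < e w)%N.
Hypothesis iota_zero : forall (a : AF) w, a (u w) = 0 -> iota a w = 0.
Hypothesis iota_val : forall (a : AF) w, a (u w) != 0 ->
  iota a w != 0 /\
  cval (Lhat (sval w)) (iota a w) = (e w)%:Z * cval (Fhat (sval (u w))) (a (u w)).
Hypothesis frF : forall v : PF, finite_residue (cval (Fhat (sval v))).
Context (K : level inf Fhat r).

Context (B : nat).

(** B + 2 elements, one more than the pigeonhole consumes, because one of them may have to be
    dropped to keep every 1 + t x invertible. *)
Definition residue_spread (v : PF) (s : 'I_B.+2 -> Fhat (sval v)) : Prop :=
  (forall k, vF v 0 (s k)) /\
  (forall k l, k != l -> s k - s l != 0 /\ valF v (s k - s l) = 0).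

Definition small_residue : set PF := [set v | ~ exists s, residue_spread (v := v) s].

Hypothesis finite_small_residue : finite_set small_residue.

(** The exponent at [v] of the constant C. At a place with a small residue field t_k = pi^(k+1) with
    k <= B, so B + 1 bounds the valuation of every difference of two distinct t_k; elsewhere the
    differences are units. *)
Definition conductor (v : PF) : int := if `[< small_residue v >] then B.+1%:Z else 0.

Lemma fsupp_conductor : fsupp conductor.
Proof.
apply: (fsupp_sub finite_small_residue) => v nv.
by rewrite /conductor; case: asboolP.
Qed.

Lemma exists_difference_family (w : PL) (i j : 'I_r') (a : Lhat (sval w)) :
  vL w 0 a -> exists t : 'I_B.+1 -> Fhat (sval (u w)),
  [/\ forall k, vF (u w) 0 (t k),
      forall k, 1 + iota (single (t k)) w * a *+ (i == j) != 0,
      forall k, valL w (1 + iota (single (t k)) w * a *+ (i == j)) = 0 &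
      forall k l : 'I_B.+1, (k < l)%N -> [/\ t k - t l != 0,
        vF (u w) (valF (u w) (t k - t l)) (t l) &
        valF (u w) (t k - t l) <= conductor (u w)]].
Proof.
move=> ha; set v := u w.
have unit1 (c : Lhat (sval w)) : vL w 1 c ->
    1 + c *+ (i == j) != 0 /\ valL w (1 + c *+ (i == j)) = 0.
  move=> hc; have hc' : vL w 1 (c *+ (i == j)).
    by case: (i == j); rewrite ?mulr1n// mulr0n; apply: vge0.
  have := val_addl (oner_neq0 _) _ hc'; rewrite Defs.val1; exact.
have [bad|/contrapT[s [s0 sd]]] := pselect (small_residue v).
  pose t (k : 'I_B.+1) := upow (valF v) k.+1%:Z.
  have tw (k : 'I_B.+1) : vL w 1 (iota (single (t k)) w * a).
    rewrite -[1]addr0; apply: vgeM => //.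
    apply: (@vge_le _ _ _ ((e w)%:Z * k.+1%:Z)); first by have := e_gt0 w; nia.
    by rewrite (iota_vge e_gt0 iota_zero iota_val) singleE vge_upow.
  exists t; split=> [k|k|k|k l kl].
  - by apply: vge_le (vge_upow _ _).
  - by have [] := unit1 _ (tw k).
  - by have [] := unit1 _ (tw k).
  have kl' : valF v (t k) < l.+1%:Z by rewrite val_upow; lia.
  have hl : vF v l.+1%:Z (- t l) by rewrite vgeN vge_upow.
  have [d0 dv] := val_addl (upow_neq0 _ _) kl' hl.
  rewrite d0 dv val_upow; split=> //.
    by apply: vge_le (vge_upow _ _); lia.
  by rewrite /conductor asboolT//; have := ltn_ord k; lia.
have nc : conductor v = 0.
  by rewrite /conductor; case: asboolP => // bad; case: bad; exists s.
pose T k := iota (single (s k)) w.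
have Tint k : vL w 0 (T k) by rewrite (iota_vge0 e_gt0 iota_zero iota_val) singleE.
pose z k := 1 + T k * a *+ (i == j).
have zint k : vL w 0 (z k).
  apply: vgeD; first exact: vge1.
  case: (i == j); rewrite ?mulr1n ?mulr0n; [exact: vge0M|exact: vge0].
(* At most one z_k fails to be a unit. For two of them, (t_k - t_l) a would lie in the maximal
   ideal, hence so would a, since t_k - t_l is a unit; but then 1 + t_k a is a unit. Off the
   diagonal z_k = 1. The exceptional index [k0] is skipped by [lift k0]. *)
have one_bad k l : k != l -> vL w 1 (z k) -> vL w 1 (z l) -> False.
  move=> kl hk hl; have [d0 dv] := sd k l kl.
  have iB : iota (single (s k - s l)) w = T k - T l.
    rewrite /T -adeleN -adeleD -raddfB; apply: (iota_eq iota_zero).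
    by rewrite adeleD adeleN !singleE.
  have [n0 nv] : T k - T l != 0 /\ valL w (T k - T l) = 0.
    rewrite -iB; have := @iota_val (single (s k - s l)) w.
    by rewrite singleE dv mulr0; apply.
  have hda : vL w 1 ((T k - T l) * a *+ (i == j)).
    have -> : (T k - T l) * a *+ (i == j) = z k - z l.
      by rewrite /z; case: (i == j); rewrite ?mulr1n ?mulr0n; ring.
    exact: vgeB.
  have hTa : vL w 1 (T k * a).
    move: hda hk; rewrite /z; case: (i == j); rewrite ?mulr1n ?mulr0n.
      rewrite vgeMl// nv subr0 => h1 _; rewrite -[1]add0r; exact: vgeM.
    by rewrite addr0 => _; rewrite vge_val ?oner_neq0// Defs.val1.
  have [zn0 zv] := unit1 _ hTa.
  by move: hk; rewrite vge_val// zv.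
have [k0 hk0] : exists k0, forall k, k != k0 -> ~~ vL w 1 (z k).
  have [[k0 hk0]|nk] := pselect (exists k, vL w 1 (z k)).
    by exists k0 => k kk; apply/negP => hk; exact: one_bad kk hk hk0.
  by exists ord0 => k _; apply/negP => hk; apply: nk; exists k.
have zgood k : k != k0 -> z k != 0 /\ valL w (z k) = 0.
  move=> /hk0 nk; have z0 : z k != 0.
    by apply: contraNneq nk => ->; apply: vge0.
  split=> //; have := zint k; move: nk; rewrite !vge_val//; lia.
exists (fun k => s (lift k0 k)); split=> [k|k|k|k l kl].
- exact: s0.
- by have [] := zgood (lift k0 k) (negbT (lift_eqF _ _)).
- by have [] := zgood (lift k0 k) (negbT (lift_eqF _ _)).
have [|d0 dv] := sd (lift k0 k) (lift k0 l).
  by apply: contraTneq kl => /lift_inj ->; rewrite ltnn.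
by rewrite d0 dv nc; split=> //; exact: s0.
Qed.

Section WithInverse.
Variable (b : adelic_linear iota r r') (beta : 'cV[AL]_r' -> 'cV[AF]_r).
Hypothesis (bK : cancel b beta) (betaK : cancel beta b).
Hypothesis pigeon : forall g : 'I_B.+1 -> GL AL r', (forall k, GLint (g k)) ->
  exists k l : 'I_B.+1, (k < l)%N /\ pullback_level K b ((g l)^-1 * g k)%g.

Local Notation lattice := (image_lattice K beta).
Local Notation cond := (idele Fhat fsupp_conductor).

(** The pair (k, l) given by the pigeonhole depends on [a]; multiplying by the integral element
    pi^conductor / (t_k - t_l) replaces t_k - t_l by a factor that does not. *)
Lemma stabilizes_conductor (w : PL) (i j : 'I_r') (a : Lhat (sval w)) : vL w 0 a ->
  stabilizes K beta (iota cond *: (single a *: delta_mx i j)).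
Proof.
move=> ha; have [t [t1 t2 t3 t4]] := exists_difference_family i j ha.
have t5 (k l : 'I_B.+1) (kl : (k < l)%N) : t k - t l != 0 /\
     vF (u w) (valF (u w) (t k - t l)) (t l) by have [] := t4 k l kl.
have [k [l [kl hkl]]] :=
  stabilizes_difference e_gt0 iota_zero iota_val bK betaK pigeon ha t1 t2 t3 t5.
have [d0 _ dD] := t4 k l kl.
pose c : AF := single (upow (valF (u w)) (conductor (u w)) / (t k - t l)).
have cint : integral c.
  by apply: integral_single; rewrite vge_upowMl vge_val ?invr_neq0// valV//; lia.
suff -> : iota cond *: (single a *: delta_mx i j) =
    iota c *: (iota (single (t k - t l)) *: (single a *: delta_mx i j)) :> 'M[AL]_r'.
  exact: (stabilizesZ bK betaK cint hkl).
rewrite !scalerA; congr (_ *: _); rewrite -rmorphM /c singleM singleE divfK//.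
rewrite mulrC [RHS]mulrC !singleM; congr (single (_ * _)).
by apply: (iota_eq iota_zero); rewrite ideleE singleE.
Qed.

(** The fractional ideal of the c for which c O_w^r', placed at [w], is contained in b(Lambda).
    Quantifying over [a] builds in stability under O_w, which b(Lambda) need not have. *)
Definition multiplier (w : PL) : set (Lhat (sval w)) :=
  [set c | forall (i : 'I_r') (a : Lhat (sval w)), vL w 0 a ->
     lattice (single (c * a) *: delta_mx i 0)].

Lemma mbox_single_delta (n : PL -> int) (w : PL) (c : Lhat (sval w)) (i : 'I_r') :
  vL w (n w) c -> mbox n (single c *: delta_mx i 0 : 'cV[AL]_r').
Proof.
move=> hc p q; rewrite mxE => w'; rewrite adeleM mxE; case: (_ && _).
  by rewrite mulr1; apply: abox_single.
by rewrite mulr0; apply: vge0.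
Qed.

Lemma multiplier_lower : exists2 n : PL -> int, fsupp n &
  forall w c, vL w (n w) c -> multiplier c.
Proof.
have [n0 f0 h0] := level_lattice_box K.
have [n fn hn] := beta_small e_gt0 iota_zero iota_val bK betaK frF f0.
exists n => // w c hc i a ha; apply: h0; apply: hn; apply: mbox_single_delta.
by rewrite -[n w]addr0; apply: vgeM.
Qed.

Hypothesis r'_gt0 : (0 < r')%N.

Lemma multiplier_upper : exists2 m : PL -> int, fsupp m &
  forall w c, multiplier (w := w) c -> vL w (m w) c.
Proof.
have [m fm hm] := adelic_bound e_gt0 iota_zero iota_val b.
exists m => // w c hc; pose o := Ordinal r'_gt0.
have := hc o 1 (vge1 _); rewrite mulr1 => /level_lattice_int hint.
have /hm/(_ o) : forall i, vF (u w) 0 (beta (single c *: delta_mx o 0) i 0 (u w)).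
  by move=> i; apply: hint.
by rewrite betaK mulr0 add0r !mxE !eqxx mulr1 singleE.
Qed.

Lemma multiplier_generator : exists2 N : PL -> int, fsupp N &
  forall w, multiplier (upow (valL w) (N w)) /\
    forall c, multiplier (w := w) c -> vL w (N w) c.
Proof.
have [n fn hn] := multiplier_lower; have [m fm hm] := multiplier_upper.
(* The upper bound on [k] forces [k = 0] wherever [m w = n w = 0], which gives the exponents finite
   support. *)
have ex w : exists k : nat, `[< multiplier (upow (valL w) (m w + k%:Z)) >] &&
    (k <= `|n w - m w|)%N.
  exists `|n w - m w|%N; rewrite leqnn andbT; apply/asboolP; apply: hn.
  by apply: vge_le (vge_upow _ _); lia.
exists (fun w => m w + (ex_minn (ex w))%:Z).
  have fS : finite_set ([set w | m w != 0] `|` [set w | n w != 0]).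
    by rewrite finite_setU.
  apply: (fsupp_sub fS) => w /not_orP[/= /negP + /negP].
  rewrite !negbK => /eqP m0 /eqP n0; case: ex_minnP => k /andP[_ kn] _.
  by rewrite m0; move: kn; rewrite n0 m0; lia.
move=> w; case: ex_minnP => k /andP[/asboolP hk kn] kmin; split; first exact: hk.
move=> c hc; have [->|c0] := eqVneq c 0; first exact: vge0.
have := hm w c hc; rewrite !vge_val// => mc.
have hc' : multiplier (upow (valL w) (m w + (`|valL w c - m w|%N)%:Z)).
  have -> : m w + (`|valL w c - m w|%N)%:Z = valL w c by lia.
  move=> i a ha; pose y := upow (valL w) (valL w c) / c.
  have -> : upow (valL w) (valL w c) * a = c * (y * a).
    by rewrite mulrA [c * _]mulrC divfK.
  apply: hc; apply: vge0M => //.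
  by rewrite vge_upowMl vge_val ?invr_neq0// valV//; lia.
have [kn'|kn'] := leqP (`|valL w c - m w|)%N `|n w - m w|%N.
  have : (k <= `|valL w c - m w|)%N by apply: kmin; rewrite kn' andbT; apply/asboolP.
  by lia.
by lia.
Qed.

(** The idele [a] generates the multiplier ideals at all places, so a O_L^r' is contained in
    b(Lambda). Conversely, for y in b(Lambda) the matrices of [stabilizes_conductor] move C y_j to
    every position with every integral factor; thus C y_j is a multiplier, hence divisible by
    [a]. *)
Lemma normalizing_idele : exists (a a' : AL),
  [/\ a * a' = 1,
      forall y, mintegral y -> lattice (a *: y) &
      forall y, lattice y -> mintegral (iota cond *: (a' *: y))].
Proof.
have [N fN hN] := multiplier_generator.
exists (idele Lhat fN), (idele Lhat (fsuppN fN)); split; first exact: ideleV.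
  move=> y hy; apply: (image_lattice_idem bK betaK) => v.
  have [s [su sE]] := iota_idem_decomp e_gt0 iota_zero iota_val v.
  have -> : iota (idem Fhat v) *: (idele Lhat fN *: y) =
      \sum_(w <- s) \sum_i single (upow (valL w) (N w) * y i 0 w) *: delta_mx i 0.
    apply/colP => i; rewrite mxE mxE sE summxE; apply: eq_bigr => w _.
    rewrite summxE (bigD1 i)//= big1 ?addr0 => [|j ji].
      by rewrite !mxE !eqxx mulr1 ideleE.
    by rewrite !mxE eq_sym (negbTE ji) mulr0.
  apply: (image_lattice_sum bK betaK) => w _.
  apply: (image_lattice_sum bK betaK) => i _.
  exact: (hN w).1 i _ (hy i 0 w).
move=> y hy j j0; rewrite [j0]ord1 => w.
pose c : Lhat (sval w) := iota cond w * y j 0 w.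
have hc : multiplier c.
  move=> i a ha; have := stabilizes_conductor i j ha hy.
  suff -> : (iota cond *: (single a *: delta_mx i j)) *m y =
      single (c * a) *: delta_mx i 0 by [].
  apply/colP => p; rewrite mxE (bigD1 j)//= big1 ?addr0 => [|q qj].
    rewrite !mxE !eqxx !andbT.
    have -> : single (c * a) = iota cond * single a * y j 0 :> AL.
      by rewrite -mulrA [RHS]mulrC !singleM; congr single; rewrite /c; ring.
    by rewrite mulrA mulrAC.
  by rewrite !mxE (negbTE qj) andbF !mulr0 mul0r.
have := (hN w).2 c hc; rewrite !mxE !adeleM ideleE /c.
rewrite mulrCA vge_upowMl sub0r opprK //.
Qed.

End WithInverse.
End Normalization.

(** * Places of function fields *)

Section DistinctPlaces.
Context (E : fieldType).
Implicit Types (v : place E) (x y : E).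

Lemma place_eq v v' : (forall x, x != 0 -> v x = v' x) -> v = v'.
Proof.
move=> h; have {}h : val_of v = val_of v'.
  apply: functional_extensionality_dep => x.
  have [->|/h //] := eqVneq x 0; by rewrite !val_zero.
case: v v' h => [f f0 fM fD fS] [g g0 gM gD gS] /= h; subst g.
by congr Place; apply: Prop_irrelevance.
Qed.

(** Otherwise [v'] is nonnegative wherever [v] is, so it vanishes on the units of [v] and is a
    multiple of [v]. Both are normalized, so the factor is 1 and the places agree. *)
Lemma exists_separating v v' : v <> v' ->
  exists x, [/\ x != 0, 0 <= v x & v' x < 0].
Proof.
move=> vv'; apply: contrapT => /forallNP h.
have pos x : x != 0 -> 0 <= v x -> 0 <= v' x.
  by move=> x0 vx; rewrite leNgt; apply/negP => v'x; apply: (h x).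
have zero x : x != 0 -> v x = 0 -> v' x = 0.
  move=> x0 vx; apply/eqP; rewrite eq_le pos ?vx// andbT -oppr_ge0 -valV//.
  by apply: pos; rewrite ?invr_eq0// valV// vx oppr0.
have lin x : x != 0 -> v' x = v x * v' (uniformizer v).
  move=> x0; have := zero (x * (upow v (v x))^-1).
  have p0 := upow_neq0 v (v x).
  rewrite mulf_neq0 ?invr_neq0// !val_mul ?invr_neq0// !valV// val_upow subrr.
  move=> /(_ isT erefl)/eqP; rewrite subr_eq0 => /eqP ->.
  have u0 := uniformizer_neq0 v; rewrite /upow; case: (v x) => n.
    by rewrite -[uniformizer v ^ _]/(uniformizer v ^+ n) valX.
  rewrite -[uniformizer v ^ _]/(uniformizer v ^+ n.+1)^-1 valV ?expf_neq0// valX//.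
  by rewrite NegzE mulNr.
have e0 : 0 <= v' (uniformizer v).
  by apply: pos; rewrite ?uniformizer_neq0// val_uniformizer.
have [x x0 v'x] := val_surj v'.
have e1 : v' (uniformizer v) = 1.
  have := lin x x0; rewrite v'x; move: (v' _) (v x) e0 => m a m0 e1.
  have [a0|a0] : a <= 0 \/ 1 <= a by lia.
    by nia.
  by nia.
by apply: vv'; apply: place_eq => y y0; rewrite lin// e1 mulr1.
Qed.

Lemma exists_separating_strict v v' : v <> v' ->
  exists x, [/\ x != 0, 0 < v x & v' x < 0].
Proof.
move=> vv'; have [x [x0 vx v'x]] := exists_separating vv'.
have [y [y0 v'y vy]] := exists_separating (nesym vv').
exists (x / y); rewrite mulf_neq0 ?invr_neq0// !val_mul ?invr_neq0// !valV//.
by split=> //; lia.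
Qed.

Lemma val_mul_pow v x y n : x != 0 -> y != 0 -> v (y * x ^+ n) = v y + n%:Z * v x.
Proof. by move=> x0 y0; rewrite val_mul ?expf_neq0// valX. Qed.

Lemma val_mul_1pow v x y n : x != 0 -> y != 0 -> (0 < n)%N -> v x != 0 ->
  1 + x ^+ n != 0 /\ v (y * (1 + x ^+ n)) = v y + Num.min 0 (n%:Z * v x).
Proof.
move=> x0 y0 n0 vx.
suff [s0 sv] : 1 + x ^+ n != 0 /\ v (1 + x ^+ n) = Num.min 0 (n%:Z * v x).
  by split=> //; rewrite val_mul// sv.
have xn0 : x ^+ n != 0 by rewrite expf_neq0.
have [vp|vn] : 0 < v x \/ v x < 0 by lia.
  have -> : Num.min 0 (n%:Z * v x) = v 1 by rewrite Defs.val1 min_l//; nia.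
  apply: (@val_addl _ v _ _ 1); rewrite ?oner_neq0 ?Defs.val1// vge_val// valX//; nia.
have -> : Num.min 0 (n%:Z * v x) = v (x ^+ n) by rewrite valX// min_r//; nia.
by rewrite addrC; apply: (@val_addl _ v _ _ 0); rewrite ?vge1// valX//; nia.
Qed.

(** Only signs are approximated. Let x serve the first n places and let y separate [v] from the last
    one. According to the sign of the last valuation of x, the answer is x, y (1 + x^m) or y x^m,
    where m exceeds all |v_i(y)| so that x^m outweighs y. *)
Lemma weak_approximation v (vs : nat -> place E) (n : nat) :
  (forall i, (i < n)%N -> vs i <> v) ->
  exists x, [/\ x != 0, 0 < v x & forall i, (i < n)%N -> vs i x < 0].
Proof.
elim: n => [_|n IH vsv].
  by exists (uniformizer v); rewrite uniformizer_neq0 val_uniformizer.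
have [|x [x0 vx xn]] := IH; first by move=> i ni; apply: vsv; lia.
have [|y [y0 vy yn]] := @exists_separating_strict v (vs n).
  by apply/nesym/vsv.
pose m := (\sum_(i < n) `|vs i y|).+1.
have mi i : (i < n)%N -> (`|vs i y| < m)%N.
  by move=> ni; rewrite /m ltnS (bigD1 (Ordinal ni))//= leq_addr.
have lastcase i : (i < n.+1)%N -> (i < n)%N \/ i = n by lia.
have [xneg|xpos|xz] := ltgtP (vs n x) 0.
- by exists x; split=> // i /lastcase[/xn//|->].
- have [s0 _] := @val_mul_1pow v x y m x0 y0 isT ltac:(lia).
  exists (y * (1 + x ^+ m)); split; first by rewrite mulf_neq0.
    have [_ ->] := @val_mul_1pow v x y m x0 y0 isT ltac:(lia).
    by rewrite min_l//; [lia|nia].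
  move=> i /lastcase[ni|->].
    have xi := xn i ni; have mi' := mi i ni.
    have [_ ->] := @val_mul_1pow (vs i) x y m x0 y0 isT ltac:(lia).
    by rewrite min_r; nia.
  have [_ ->] := @val_mul_1pow (vs n) x y m x0 y0 isT ltac:(lia).
  by rewrite min_l; [lia|nia].
- exists (y * x ^+ m); split; first by rewrite mulf_neq0 ?expf_neq0.
    by rewrite val_mul_pow//; nia.
  move=> i /lastcase[ni|->]; rewrite val_mul_pow//; last by rewrite xz; lia.
  by have := xn i ni; have := mi i ni; nia.
Qed.

(** If x is positive at v_i and has poles at the other places, then (1 + x)^-1 is a unit at v_i and
    vanishes at the others. *)
Lemma dual_family (n : nat) (vs : 'I_n.+1 -> place E) : injective vs ->
  exists y : 'I_n.+1 -> E, forall i, [/\ y i != 0, vs i (y i) = 0 &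
    forall j, j != i -> 0 < vs j (y i)].
Proof.
move=> inj.
suff h i : exists y, [/\ y != 0, vs i y = 0 & forall j, j != i -> 0 < vs j y].
  by have [y hy] := choice h; exists y.
pose ws k := if insub k is Some j then vs (lift i j) else vs i.
have wsE (j : 'I_n) : ws j = vs (lift i j) by rewrite /ws valK.
have [|x [x0 vx wx]] := @weak_approximation (vs i) ws n.
  move=> k kn; rewrite (wsE (Ordinal kn)) => /inj/eqP.
  by rewrite eq_sym (negbTE (neq_lift _ _)).
have [s0 sv] : 1 + x != 0 /\ vs i (1 + x) = vs i 1.
  by apply: (@val_addl _ _ _ _ 1); rewrite ?oner_neq0 ?Defs.val1// vge_val//; lia.
exists (1 + x)^-1; split; first by rewrite invr_eq0.
  by rewrite valV// sv Defs.val1 oppr0.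
move=> j ji; case: (unliftP i j) ji => [j' ->|->]; last by rewrite eqxx.
move=> _; rewrite -wsE valV//; have xj := wx j' (ltn_ord j').
rewrite [1 + x]addrC; have [_ ->] : x + 1 != 0 /\ ws j' (x + 1) = ws j' x.
  by apply: (@val_addl _ _ _ _ 0) => //; apply: vge1.
by lia.
Qed.

End DistinctPlaces.

(** * Finiteness of the poles and zeros of polynomials *)

Lemma tofrac_surj (D : idomainType) (x : {fraction D}) :
  exists p q : D, q != 0 /\ tofrac q * x = tofrac p.
Proof.
elim/quotW: x => x; exists (frac x).1, (frac x).2; split; first exact: denom_ratioP.
unlock tofrac; rewrite -[LHS]FracField.pi_mul; apply/eqP; rewrite FracField.equivf_def.
rewrite /FracField.mulf /= !numden_Ratio; first by rewrite mul1r mulr1.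
all: by rewrite ?mul1r ?oner_neq0 ?denom_ratioP.
Qed.

Lemma common_denominator (D : idomainType) (n : nat) (x : 'I_n -> {fraction D}) :
  exists q (p : 'I_n -> D), q != 0 /\ forall i, tofrac q * x i = tofrac (p i).
Proof.
have h i : exists pq : D * D, pq.2 != 0 /\ tofrac pq.2 * x i = tofrac pq.1.
  by have [p [q h]] := tofrac_surj (x i); exists (p, q).
have {}h := choice h; case: h => f hf.
exists (\prod_i (f i).2), (fun i => (\prod_(j | j != i) (f j).2) * (f i).1).
split=> [|i]; first by apply/prodf_neq0 => i _; have [] := hf i.
by rewrite (bigD1 i)//=; set Q := \prod_(_ | _) _; rewrite !tofracM -(hf i).2; ring.
Qed.

Lemma finite_of_no_sequence (T : Type) (S : set T) :
  (forall f : nat -> T, injective f -> (forall i, S (f i)) -> False) -> finite_set S.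
Proof.
move=> h; apply: contrapT => /infiniteP/card_leP[f].
pose c n : [set: nat] := SigSub (in_setT n).
apply: (h (fun n => set_val (f (c n)))) => [m n /val_inj|i]; last exact: set_valP.
by move=> /(@inj _ _ _ f _ _ (in_setT _) (in_setT _))/(congr1 set_val).
Qed.

Section FunctionFieldPlaces.
Context (k : finFieldType) (F : fieldExtType {fraction {poly k}}).
Implicit Types (v : place F) (p q : {poly k}).

Definition poly_embed p : F := (tofrac p)%:A.

Lemma poly_embedD p q : poly_embed (p + q) = poly_embed p + poly_embed q.
Proof. by rewrite /poly_embed rmorphD /= scalerDl. Qed.

Lemma poly_embedN p : poly_embed (- p) = - poly_embed p.
Proof. by rewrite /poly_embed rmorphN /= scaleNr. Qed.

Lemma poly_embedM p q : poly_embed (p * q) = poly_embed p * poly_embed q.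
Proof. by rewrite /poly_embed rmorphM /= -scalerAl mul1r scalerA. Qed.

Lemma poly_embed1 : poly_embed 1 = 1.
Proof. by rewrite /poly_embed rmorph1 scale1r. Qed.

Lemma poly_embed_eq0 p : (poly_embed p == 0) = (p == 0).
Proof. by rewrite /poly_embed scaler_eq0 oner_eq0 orbF tofrac_eq0. Qed.

Lemma poly_relation (y : 'I_(\dim {:F}).+1 -> F) :
  exists p : 'I_(\dim {:F}).+1 -> {poly k},
    (exists i, p i != 0) /\ \sum_i poly_embed (p i) * y i = 0.
Proof.
pose t := [tuple y i | i < (\dim {:F}).+1].
have nft : ~~ free t.
  apply/negP => ft; have := dimvS (subvf <<t>>%VS).
  by move: ft; rewrite /free size_tuple => /eqP ->; rewrite ltnn.
have [c [[i ci] hc]] : exists c : 'I_(\dim {:F}).+1 -> {fraction {poly k}},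
    (exists i, c i != 0) /\ \sum_i c i *: y i = 0.
  apply: contrapT => /forallNP h; move/negP: nft; apply; apply/freeP => c hc i.
  apply/eqP/negP => /negP ci; apply: (h c); split; first by exists i.
  by rewrite -[RHS]hc; apply: eq_bigr => j _; rewrite -tnth_nth tnth_mktuple.
have [q [p [q0 hp]]] := common_denominator c.
have tq0 : tofrac q != 0 by rewrite tofrac_eq0.
exists p; split.
  by exists i; rewrite -tofrac_eq0 -hp; exact: (mulf_neq0 tq0 ci).
have -> : \sum_i poly_embed (p i) * y i = tofrac q *: \sum_i c i *: y i.
  rewrite scaler_sumr; apply: eq_bigr => j _.
  by rewrite /poly_embed -hp -scalerAl mul1r scalerA.
by rewrite hc scaler0.
Qed.

Lemma val_const v (c : k) : c != 0 -> v (poly_embed c%:P) = 0.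
Proof.
move=> c0; have := congr1 (fun c => v (poly_embed c%:P)) (finfield.expf_card c) => /=.
have e0 : poly_embed c%:P != 0 by rewrite poly_embed_eq0 polyC_eq0.
have -> n : poly_embed (c ^+ n)%:P = poly_embed c%:P ^+ n.
  elim: n => [|n IH]; first by rewrite !expr0 poly_embed1.
  by rewrite !exprS polyCM poly_embedM IH.
rewrite valX//; have := finRing_gt1 k; move: (#|k|) (v _) => n m; nia.
Qed.

Lemma vge_const v (c : k) : vge v 0 (poly_embed c%:P).
Proof.
have [->|c0] := eqVneq c 0.
  by rewrite (eqP (_ : poly_embed 0%:P == 0)) ?vge0// poly_embed_eq0.
by rewrite vge_val ?val_const// poly_embed_eq0 polyC_eq0.
Qed.

Lemma vge_poly v p : vge v 0 (poly_embed 'X) -> vge v 0 (poly_embed p).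
Proof.
move=> vX; elim/poly_ind: p => [|p c IH].
  by rewrite (eqP (_ : poly_embed 0 == 0)) ?vge0// poly_embed_eq0.
by rewrite poly_embedD poly_embedM; apply: vgeD; [apply: vge0M|apply: vge_const].
Qed.

Lemma val_poly_pole v p : v (poly_embed 'X) < 0 -> p != 0 ->
  v (poly_embed p) = (size p).-1%:Z * v (poly_embed 'X).
Proof.
move=> vX; have X0 : poly_embed 'X != 0 by rewrite poly_embed_eq0 polyX_eq0.
elim/poly_ind: p => [|p c IH]; first by rewrite eqxx.
have [->|p0] := eqVneq p 0.
  rewrite mul0r add0r polyC_eq0 => c0; rewrite val_const// size_polyC c0 mul0r //.
move=> _; rewrite poly_embedD size_MXaddC (negbTE p0) /=.
have pX0 : poly_embed (p * 'X) != 0 by rewrite poly_embed_eq0 mulf_neq0 ?polyX_eq0.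
have vpX : v (poly_embed (p * 'X)) = (size p)%:Z * v (poly_embed 'X).
  rewrite poly_embedM val_mul ?X0 ?poly_embed_eq0// IH//.
  by move: p0; rewrite -size_poly_gt0; case: (size p) => // n _; rewrite /= intS; ring.
have [|_ ->] := val_addl pX0 _ (vge_const v c); last exact: vpX.
rewrite vpX; move: p0; rewrite -size_poly_gt0; move: (v _) vX => m; nia.
Qed.

(* If [sum p_i y_i = 0] with [v_i y_i = 0 < v_j y_i], a coefficient [p_i] of
   minimal valuation at [v_i] cannot be cancelled. *)
Lemma no_relation v (n : nat) (p : 'I_n -> {poly k}) (y : 'I_n -> F) (i : 'I_n) :
  p i != 0 -> y i != 0 -> v (y i) = 0 ->
  (forall j, j != i -> vge v (v (poly_embed (p i)) + 1) (poly_embed (p j) * y j)) ->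
  \sum_j poly_embed (p j) * y j <> 0.
Proof.
move=> pi yi vyi h /eqP; rewrite (bigD1 i)//=.
have e0 : poly_embed (p i) * y i != 0 by rewrite mulf_neq0 ?poly_embed_eq0.
have ev : v (poly_embed (p i) * y i) = v (poly_embed (p i)).
  by rewrite val_mul ?poly_embed_eq0// vyi addr0.
have [||n0 _] := @val_addl _ v _ (\sum_(j | j != i) poly_embed (p j) * y j)
    (v (poly_embed (p i)) + 1) e0.
- by rewrite ev; lia.
- exact: vge_sum.
by rewrite (negbTE n0).
Qed.

(** More than [F : k(T)] poles of T would carry a dual family satisfying a relation over k[T]. At a
    pole of T a polynomial has valuation its degree times that of T, so a coefficient p_i of maximal
    degree has minimal valuation, in particular at v_i, where its term cannot be cancelled. *)
Lemma finite_pole_places (vs : nat -> place F) : injective vs ->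
  (forall i, vs i (poly_embed 'X) < 0) -> False.
Proof.
move=> inj pole; pose ws (i : 'I_(\dim {:F}).+1) := vs i.
have winj : injective ws by move=> i j /inj/val_inj.
have [y hy] := dual_family winj; have [p [[i0 pi0] hp]] := poly_relation y.
case: (@arg_maxnP _ i0 (fun i => p i != 0) (fun i => size (p i)) pi0) => i pi maxi.
have [yi vyi _] := hy i; apply: (no_relation pi yi vyi _ hp) => j ji.
have [yj _ /(_ i) vij] := hy j.
have [->|pj] := eqVneq (p j) 0.
  by rewrite (eqP (_ : poly_embed 0 == 0)) ?mul0r ?vge0// poly_embed_eq0.
have ej : poly_embed (p j) != 0 by rewrite poly_embed_eq0.
rewrite vge_val; last exact: mulf_neq0 ej yj.
rewrite (val_mul _ ej yj) (val_poly_pole (pole i) pi) (val_poly_pole (pole i) pj).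
have := vij; rewrite eq_sym ji => /(_ isT).
have := maxi j pj; have := pole i; rewrite -/(ws i).
move: (ws i (y j)) (ws i _) => a c; nia.
Qed.

Lemma irreducible_val0 v P p : irreducible_poly P -> vge v 0 (poly_embed 'X) ->
  vge v 1 (poly_embed P) -> ~~ (P %| p) -> poly_embed p != 0 /\ v (poly_embed p) = 0.
Proof.
move=> irrP vX vP ndiv.
have p0 : p != 0 by apply: contraNneq ndiv => ->; apply: dvdp0.
have cop : coprimep P p by rewrite qpoly.irreducible_poly_coprime.
have e0 : poly_embed p != 0 by rewrite poly_embed_eq0.
split=> //; have := vge_poly p vX; rewrite vge_val// => vp.
apply/eqP; rewrite eq_le vp andbT leNgt; apply/negP => vp'.
have /Bezout_coprimepP[[a c] /=] := cop; rewrite -size_poly_eq1 => /size_poly1P[d d0 e].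
have : vge v 1 (poly_embed d%:P).
  rewrite -e poly_embedD !poly_embedM; apply: vgeD; rewrite -[1]add0r; apply: vgeM => //.
  - exact: vge_poly.
  - exact: vge_poly.
  - by rewrite vge_val.
by rewrite vge_val ?val_const// poly_embed_eq0 polyC_eq0.
Qed.

(** The relation is now taken of minimal total size. Division by P would shrink it, so some p_i is
    not divisible by P; by Bezout p_i is a unit at v_i, while all other terms vanish there. *)
Lemma finite_zero_places (P : {poly k}) (vs : nat -> place F) :
  irreducible_poly P -> injective vs ->
  (forall i, vge (vs i) 0 (poly_embed 'X)) ->
  (forall i, vge (vs i) 1 (poly_embed P)) -> False.
Proof.
move=> irrP inj vX vP; pose ws (i : 'I_(\dim {:F}).+1) := vs i.
have P0 : P != 0 by rewrite -size_poly_gt0; apply: ltnW; case: irrP.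
have winj : injective ws by move=> i j /inj/val_inj.
have [y hy] := dual_family winj; have [p0 hp0] := poly_relation y.
pose rel (p : 'I_(\dim {:F}).+1 -> {poly k}) :=
  (exists i, p i != 0) /\ \sum_i poly_embed (p i) * y i = 0.
have ex : exists n, `[< exists2 p, rel p & (\sum_i size (p i))%N = n >].
  by exists (\sum_i size (p0 i))%N; apply/asboolP; exists p0.
case: (ex_minnP ex) => n /asboolP[p [[i0 pi0] hp] en] nmin.
have [[i ndiv]|div] := pselect (exists i, ~~ (P %| p i)).
  have [e0 ev] := irreducible_val0 irrP (vX i) (vP i) ndiv.
  have [yi vyi _] := hy i; have pi : p i != 0 by rewrite -poly_embed_eq0.
  apply: (no_relation pi yi vyi _ hp) => j ji; rewrite ev add0r.
  have [yj _ /(_ i)] := hy j; rewrite eq_sym ji => /(_ isT) vij.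
  rewrite -[1]add0r; apply: vgeM; first exact: vge_poly (vX i).
  by rewrite vge_val.
have {}div i : P %| p i by apply: contrapT => /negP nd; apply: div; exists i.
pose q i := p i %/ P.
have pq i : p i = q i * P by rewrite /q divpK.
have qlt i : p i != 0 -> (size (q i) < size (p i))%N.
  move=> pi; rewrite size_divp// ltn_subrL size_poly_gt0 pi andbT -subn1 subn_gt0.
  by case: irrP.
have qle i : (size (q i) <= size (p i))%N.
  by have [e|/qlt/ltnW//] := eqVneq (p i) 0; rewrite /q e div0p.
have : `[< exists2 p, rel p & (\sum_i size (p i))%N = (\sum_i size (q i))%N >].
  apply/asboolP; exists q => //; split.
    by exists i0; apply: contraNneq pi0 => e; rewrite pq e mul0r.
  have eP : poly_embed P != 0 by rewrite poly_embed_eq0.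
  apply: (mulIf eP); rewrite mul0r -[RHS]hp mulr_suml; apply: eq_bigr => i _.
  by rewrite [in RHS]pq poly_embedM mulrAC.
move=> /nmin; rewrite -en leqNgt => /negP; apply.
rewrite (bigD1 i0)//= [X in (_ < X)%N](bigD1 i0)//=.
by rewrite -addSn leq_add ?qlt// leq_sum.
Qed.

End FunctionFieldPlaces.

Section SmallResidueFields.
Context (k : finFieldType) (F : fieldExtType {fraction {poly k}}).
Context (inf : place F) (Fhat : forall v : place F, completion v).
Local Notation PF := (fplace inf).
Local Notation vE v := (vge (sval v)).

Lemma sval_fplace_inj (f : nat -> PF) : injective f -> injective (fun i => sval (f i)).
Proof.
move=> inj i j h; apply: inj; move: h; case: (f i) => v hv; case: (f j) => w hw /= e.
by subst w; congr exist; apply: Prop_irrelevance.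
Qed.

Lemma finite_poles : finite_set [set v : PF | sval v (poly_embed F 'X) < 0].
Proof.
apply: finite_of_no_sequence => f inj hf.
exact: finite_pole_places (sval_fplace_inj inj) hf.
Qed.

Lemma finite_zeros (Q : {poly k}) : Q != 0 ->
  finite_set [set v : PF | vE v 0 (poly_embed F 'X) /\ vE v 1 (poly_embed F Q)].
Proof.
have [n] := ubnP (size Q); elim: n Q => // n IH Q sQ Q0.
have [irr|nirr] := pselect (irreducible_poly Q).
  apply: finite_of_no_sequence => f inj hf.
  apply: (finite_zero_places irr (sval_fplace_inj inj)) => i; by have [] := hf i.
have [Q1|Q1] := leqP (size Q) 1.
  apply: sub_finite_set (finite_set0 _) => v [_].
  have [c c0 ->] : exists2 c, c != 0 & Q = c%:P.
    by apply/size_poly1P; rewrite eqn_leq Q1 size_poly_gt0.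
  rewrite vge_val; last by rewrite poly_embed_eq0 polyC_eq0.
  by rewrite val_const.
have [q [sq qQ nq]] : exists q : {poly k}, [/\ size q != 1%N, q %| Q & ~~ (q %= Q)].
  apply: contrapT => /forallNP h; apply: nirr; split=> // q sq qQ.
  by apply: contrapT => /negP nq; apply: (h q).
have eQ : Q = (Q %/ q) * q by rewrite divpK.
have q0 : q != 0 by apply: contraTneq qQ => ->; rewrite dvd0p.
have q'0 : Q %/ q != 0 by apply: contraNneq Q0 => e; rewrite eQ e mul0r.
have sq1 : (1 < size q)%N.
  by move: sq; have := q0; rewrite -size_poly_gt0; case: (size q) => [|[]].
have sqQ : (size q < size Q)%N.
  by rewrite ltn_neqAle dvdp_leq// andbT; apply: contra nq => e; rewrite -dvdp_size_eqp.
have sq'Q : (size (Q %/ q)%R < size Q)%N.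
  rewrite size_divp//; move: (size q) (size Q) sq1 sqQ => a c; lia.
have sQn : (size Q <= n)%N by rewrite -ltnS.
have f1 := IH (Q %/ q) (leq_trans sq'Q sQn) q'0.
have f2 := IH q (leq_trans sqQ sQn) q0.
have fU : finite_set ([set v : PF | vE v 0 (poly_embed F 'X) /\ vE v 1 (poly_embed F (Q %/ q))]
   `|` [set v : PF | vE v 0 (poly_embed F 'X) /\ vE v 1 (poly_embed F q)]).
  by rewrite finite_setU.
apply: sub_finite_set fU => v [vX].
have e0 : poly_embed F q != 0 by rewrite poly_embed_eq0.
have e'0 : poly_embed F (Q %/ q) != 0 by rewrite poly_embed_eq0.
rewrite {1}eQ poly_embedM vge_val; last exact: mulf_neq0.
rewrite (val_mul _ e'0 e0) => hv.
have := vge_poly q vX; have := vge_poly (Q %/ q) vX; rewrite (vge_val _ _ e0) (vge_val _ _ e'0) => h1 h2.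
have [h|h] : 1 <= sval v (poly_embed F (Q %/ q)) \/ 1 <= sval v (poly_embed F q) by lia.
  by left; split; [exact: vX|rewrite vge_val].
by right; split; [exact: vX|rewrite vge_val].
Qed.

(** The powers 1, T, ..., T^(B+1) form a spread at every place where T is integral and no T^i - T^j
    with i != j vanishes. The exceptions are poles of T or zeros of finitely many nonzero
    polynomials. *)
Lemma finite_small_residue (B : nat) : finite_set (@small_residue F inf Fhat B).
Proof.
pose T (i j : nat) := [set v : PF | vE v 0 (poly_embed F 'X) /\
  vE v 1 (poly_embed F ('X^i - 'X^j))].
have fT i j : i != j -> finite_set (T i j).
  move=> ij; apply: finite_zeros; rewrite subr_eq0.
  by apply: contraNneq ij => /(congr1 (fun p : {poly k} => size p)); rewrite !size_polyXn => -[->].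
pose S := \bigcup_(ij in [set ij : 'I_B.+2 * 'I_B.+2 | ij.1 != ij.2]) T ij.1 ij.2.
have fS : finite_set S.
  by apply: bigcup_finite; [exact: finite_finset|move=> [i j] /= /fT].
have fU : finite_set ([set v : PF | sval v (poly_embed F 'X) < 0] `|` S).
  by rewrite finite_setU; split; [exact: finite_poles|].
apply: sub_finite_set fU => v small; apply: contrapT => /not_orP[npole nS].
apply: small.
have vX : vE v 0 (poly_embed F 'X).
  by rewrite /vge; apply/orP; right; rewrite leNgt; apply/negP.
have ce x : cval (Fhat (sval v)) (cemb (Fhat (sval v)) x) = sval v x by apply: cval_emb.
exists (fun i => cemb (Fhat (sval v)) (poly_embed F 'X^i)); split=> [i|i j ij].
  have X0 : poly_embed F 'X^i != 0 by rewrite poly_embed_eq0 monic_neq0 ?monicXn.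
  rewrite vge_val; last by rewrite fmorph_eq0.
  by rewrite ce -vge_val//; apply: vge_poly.
have d0 : poly_embed F ('X^i - 'X^j) != 0.
  rewrite poly_embed_eq0 subr_eq0; apply: contraNneq ij => /(congr1 (fun p : {poly k} => size p)).
  by rewrite !size_polyXn => -[/val_inj ->].
rewrite -rmorphB -poly_embedN -poly_embedD fmorph_eq0 d0 ce; split=> //.
have := vge_poly ('X^i - 'X^j) vX; rewrite vge_val// => h.
apply/eqP; rewrite eq_le h andbT leNgt; apply/negP => h'.
apply: nS; exists (i, j) => //=; split; first exact: vX.
by rewrite vge_val.
Qed.

End SmallResidueFields.

(** * Restriction of places and the canonical map of adeles *)

Section Restriction.
Context (F : fieldType) (L : fieldExtType F).

(** If [w] were trivial on F, an element y with w(y) = -1 would satisfy a monic equation with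
    coefficients integral at [w], in which the leading power has a pole of larger order than all
    other terms. *)
Lemma restriction_nontrivial (w : place L) : exists2 x : F, x != 0 & w x%:A != 0.
Proof.
apply: contrapT => h.
have {}h (x : F) : x != 0 -> w x%:A = 0.
  by move=> x0; apply/eqP/negP => /negP wx; apply: h; exists x.
pose y := (uniformizer w)^-1.
have y0 : y != 0 by rewrite invr_eq0 uniformizer_neq0.
have wy : w y = -1 by rewrite valV ?uniformizer_neq0// val_uniformizer.
pose p := minPoly 1%VS y.
have px : root p y by apply: root_minPoly.
have mp : p \is monic by apply: monic_minPoly.
have pO : p \is a polyOver 1%VS by apply: minPolyOver.
have coef i : vge w 0 p`_i.
  have /vlineP[c ->] : p`_i \in 1%VS by apply: polyOverP.
  have [->|c0] := eqVneq c 0; first by rewrite scale0r vge0.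
  by rewrite /vge h// lexx orbT.
have [n sp] : exists n, size p = n.+2.
  have := root_size_gt1 (monic_neq0 mp) px; case: (size p) => [|[|n]] // _; by exists n.
have yX i : w (y ^+ i) = - i%:Z by rewrite valX// wy; lia.
move: px; rewrite rootE horner_coef sp big_ord_recr /=.
have -> : p`_n.+1 = 1 by have := monicP mp; rewrite lead_coefE sp.
rewrite mul1r addrC addr_eq0 => /eqP ey.
have : vge w (- n%:Z) (y ^+ n.+1).
  rewrite ey vgeN; apply: vge_sum => i _; rewrite -[- n%:Z]add0r; apply: vgeM; first exact: coef.
  by rewrite vge_val ?expf_neq0// yX; have := ltn_ord i; lia.
by rewrite vge_val ?expf_neq0// yX; lia.
Qed.

(** The values of [w] on F form a nonzero subgroup of Z; [e] is its positive generator, and [w]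
    divided by [e] is a normalized valuation of F. *)
Lemma exists_restriction (w : place L) : exists v : place F, lies_over w v.
Proof.
have A0 (x : F) : (x%:A == 0 :> L) = (x == 0) by rewrite scaler_eq0 oner_eq0 orbF.
have AM (x y : F) : (x * y)%:A = x%:A * y%:A :> L by rewrite -scalerAl mul1r scalerA.
have wM (x y : F) : x != 0 -> y != 0 -> w (x * y)%:A = w x%:A + w y%:A.
  by move=> x0 y0; rewrite AM val_mul ?A0.
have AV (x : F) : (x^-1)%:A = (x%:A)^-1 :> L by rewrite -[LHS]/(in_alg L x^-1) fmorphV.
have ex : exists n : nat, (0 < n)%N && `[< exists2 x : F, x != 0 & w x%:A = n%:Z >].
  have [x x0 wx] := restriction_nontrivial w; exists `|w x%:A|%N.
  rewrite absz_gt0 wx; apply/asboolP; have [wp|wn] := leP 0 (w x%:A).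
    by exists x => //; lia.
  by exists x^-1; rewrite ?invr_eq0// AV valV ?A0// ltz0_abs.
case: (ex_minnP ex) => e /andP[e0 /asboolP[z z0 wz]] emin.
have wz_pow (n : int) : w (z ^ n)%:A = n * e%:Z.
  have pw (m : nat) : w (z ^+ m)%:A = m%:Z * e%:Z.
    elim: m => [|m IH]; first by rewrite expr0 scale1r Defs.val1 mul0r.
    by rewrite exprS wM ?expf_neq0// IH wz intS mulrDl mul1r.
  case: n => n; first exact: pw.
  rewrite -[z ^ _]/(z ^+ n.+1)^-1 AV valV ?A0 ?expf_neq0// pw NegzE; ring.
have dvd (x : F) : x != 0 -> w x%:A = e%:Z * (w x%:A %/ e%:Z)%Z.
  move=> x0; have := divz_eq (w x%:A) e%:Z; set q := (_ %/ _)%Z; set m := (_ %% _)%Z => eq.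
  have m0 : 0 <= m by apply: modz_ge0; lia.
  have me : m < e%:Z by apply: ltz_pmod; lia.
  rewrite eq; suff -> : m = 0 by rewrite addr0 mulrC.
  apply/eqP; rewrite eq_le m0 andbT leNgt; apply/negP => mp.
  have : (0 < `|m|)%N && `[< exists2 x : F, x != 0 & w x%:A = `|m|%N%:Z >].
    rewrite absz_gt0 gt_eqF//; apply/asboolP.
    have zq0 : z ^ (- q) != 0 by rewrite expfz_neq0.
    by exists (x * z ^ (- q)); rewrite ?mulf_neq0// wM// wz_pow eq; lia.
  by move=> /emin; lia.
pose f (x : F) := (w x%:A %/ e%:Z)%Z.
have inj (a c : int) : e%:Z * a = e%:Z * c -> a = c.
  by move=> h; apply: (@mulfI _ e%:Z) h; lia.
have f0 : f 0 = 0 by rewrite /f scale0r val_zero div0z.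
have fM x y : x != 0 -> y != 0 -> f (x * y) = f x + f y.
  move=> x0 y0; apply: inj; rewrite mulrDr -!dvd ?mulf_neq0//; exact: wM.
have fD x y : x != 0 -> y != 0 -> x + y != 0 -> Num.min (f x) (f y) <= f (x + y).
  move=> x0 y0 xy0; have := @val_add _ w x%:A y%:A; rewrite -scalerDl !A0 => /(_ x0 y0 xy0).
  by rewrite (dvd x)// (dvd y)// (dvd (x + y))// !ge_min -!/(f _) !ler_pM2l; lia.
have fS : exists2 x, x != 0 & f x = 1.
  by exists z => //; apply: inj; rewrite -dvd// wz mulr1.
exists (Place f0 fM fD fS), e => // x.
by have [->|x0] := eqVneq x 0; [rewrite scale0r !val_zero mulr0|exact: dvd].
Qed.

End Restriction.

Section CanonicalMap.
Context (F : fieldType) (L : fieldExtType F).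
Context (inf : place F) (infL : place L).
Context (infL_unique : forall w : place L, lies_over w inf -> w = infL).
Context (Fhat : forall v : place F, completion v).
Context (Lhat : forall w : place L, completion w).
Context (iota : {rmorphism adele inf Fhat -> adele infL Lhat}).
Context (iota_canonical : canonical_adele_map iota).
Local Notation AF := (adele inf Fhat).
Local Notation PF := (fplace inf).
Local Notation PL := (fplace infL).

(** By density [a] is approximated by some x in F so closely that both have the same valuation and,
    [loc] being continuous, so do their images; on F the formula holds by hypothesis. *)
Lemma local_map_val (v : place F) (w : place L) (e : nat)
    (loc : {rmorphism Fhat v -> Lhat w}) :
  (0 < e)%N -> (forall x : F, w x%:A = e%:Z * v x) ->
  (forall x : F, loc (cemb (Fhat v) x) = cemb (Lhat w) x%:A) ->
  (forall N : int, exists M : int, forall a : Fhat v,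
     vge (cval (Fhat v)) M a -> vge (cval (Lhat w)) N (loc a)) ->
  forall a : Fhat v, a != 0 -> cval (Lhat w) (loc a) = e%:Z * cval (Fhat v) a.
Proof.
move=> e0 we locE locC a a0; set va := cval _ a.
have [M hM] := locC (e%:Z * va + 1).
have [x hx] := cdense a (Num.max M (va + 1)).
have hx1 : vge (cval (Fhat v)) (va + 1) (- (a - cemb (Fhat v) x)).
  by rewrite vgeN; apply: vge_le hx; rewrite le_max lexx orbT.
have [|] := val_addl a0 _ hx1; first by rewrite -/va; lia.
rewrite opprB addrC subrK cval_emb => c0 vx.
have cL : cval (Lhat w) (loc (cemb (Fhat v) x)) = e%:Z * va.
  by rewrite locE cval_emb we vx.
have h2 : vge (cval (Lhat w)) (e%:Z * va + 1) (loc (a - cemb (Fhat v) x)).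
  by apply: hM; apply: vge_le hx; rewrite le_max lexx.
have l0 : loc (cemb (Fhat v) x) != 0 by rewrite fmorph_eq0.
have [|_] := val_addl l0 _ h2; first by rewrite cL; lia.
by rewrite -rmorphD addrC subrK cL.
Qed.

Lemma canonical_map_places : exists (u : PL -> PF) (e : PL -> nat),
  [/\ forall w, (0 < e w)%N,
      forall (a : AF) w, a (u w) = 0 -> iota a w = 0 &
      forall (a : AF) w, a (u w) != 0 -> iota a w != 0 /\
        cval (Lhat (sval w)) (iota a w) =
          (e w)%:Z * cval (Fhat (sval (u w))) (a (u w))].
Proof.
have h (w : PL) : exists ve : PF * nat, [/\ (0 < ve.2)%N,
    forall a : AF, a ve.1 = 0 -> iota a w = 0 &
    forall a : AF, a ve.1 != 0 -> iota a w != 0 /\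
      cval (Lhat (sval w)) (iota a w) =
        ve.2%:Z * cval (Fhat (sval ve.1)) (a ve.1)].
  have [v wv] := exists_restriction (sval w).
  (* Since [infL] is the only place above [inf], every other place of L lies over a finite place of
     F, where the canonical map is described. *)
  have vinf : v <> inf by move=> e; subst v; exact: (svalP w) (infL_unique wv).
  have [e e0 we] := wv.
  have [loc [l1 l2 l3]] := @iota_canonical w (exist _ v vinf) wv.
  exists (exist _ v vinf, e); split=> //= a; first by rewrite l3 => ->; rewrite rmorph0.
  move=> a0; rewrite l3 fmorph_eq0 a0; split=> //.
  exact: local_map_val e0 we l1 l2 _ a0.
have {}h := choice h; case: h => f hf.
exists (fun w => (f w).1), (fun w => (f w).2).
by split=> [w|a w|a w]; case: (hf w) => h1 h2 h3; first [exact: h1|exact: h2|exact: h3].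
Qed.

End CanonicalMap.

(** * Images of inclusions *)

Section InclusionImages.
Context (F : fieldType) (L : fieldExtType F).
Context (inf : place F) (infL : place L).
Context (Fhat : forall v : place F, completion v).
Context (Lhat : forall w : place L, completion w).
Context (R : realType) (C : fieldType) (absC : C -> R).
Context (jF : {rmorphism F -> C}) (jL : {rmorphism L -> C}).
Context (iota : {rmorphism adele inf Fhat -> adele infL Lhat}).
Context (r r' : nat) (K : level inf Fhat r).
Implicit Types (b : adelic_linear iota r r').
Local Notation image b :=
  (@inclusion_image F L inf infL Fhat Lhat R C absC jF jL iota r r' K b).

Lemma drinfeld_class_level (omega : frame absC jF r) (g k : GL (adele inf Fhat) r) :
  level_set K k -> drinfeld_class K omega (g * k)%g = drinfeld_class K omega g.
Proof.
move=> Kk; apply/esym/eqmodP/asboolP; exists 1%:M, 1, k; split.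
- exact: unitmx1.
- exact: oner_neq0.
- exact: Kk.
- by rewrite invmx1 map_mx1 mulmx1 scale1r.
- by move=> v; rewrite map_mx1 mul1mx.
Qed.

Lemma inclusion_image_level b b' k : level_set K k ->
  (forall x, b' x = b (GLmx k *m x)) -> image b' = image b.
Proof.
move=> Kk bb'; apply/seteqP; split.
  move=> s [omega' [h' [phi [omega [g [h1 h2 h3 h4]]]]]].
  exists omega', h', phi, omega, (g * k^-1)%g; split; [exact: h1|exact: h2| |].
    move=> x w; have := h3 (GLinvmx k *m x) w; rewrite bb'.
    rewrite (mulmxA (GLmx k)) (GLmulV k) mul1mx => <-.
    by rewrite mulmxA.
  by rewrite h4 drinfeld_class_level//; apply: level_inv.
move=> s [omega' [h' [phi [omega [g [h1 h2 h3 h4]]]]]].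
exists omega', h', phi, omega, (g * k)%g; split; [exact: h1|exact: h2| |].
  move=> x w; rewrite bb' -h3.
  by rewrite mulmxA.
by rewrite h4 drinfeld_class_level.
Qed.

Lemma inclusion_image_GL b (h : GL (adele infL Lhat) r') :
  image (GL_adelic_map h b) = image b.
Proof.
apply/seteqP; split.
  move=> s [omega' [h' [phi [omega [g [h1 h2 h3 h4]]]]]].
  exists omega', (h' * h)%g, phi, omega, g; split; [exact: h1|exact: h2| |exact: h4].
  move=> x w; rewrite h3 GL_adelicE mulmxA //.
move=> s [omega' [h' [phi [omega [g [h1 h2 h3 h4]]]]]].
exists omega', (h' * h^-1)%g, phi, omega, g; split; [exact: h1|exact: h2| |exact: h4].
move=> x w; rewrite h3 GL_adelicE mulmxA.
rewrite -[GLmx (h' * h^-1)%g]/(GLmx h' *m GLinvmx h) -(mulmxA (GLmx h')).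
by rewrite (GLmulVl h) mulmx1.
Qed.

End InclusionImages.

Lemma mulmx_conj_cancel (A : comPzRingType) (n m : nat) (H Hi G Gi : 'M[A]_n)
    (x : 'M[A]_(n, m)) : Hi *m H = 1%:M ->
  Hi *m ((H *m (Gi *m Hi)) *m ((H *m G) *m Hi) *m x) = (Gi *m G) *m (Hi *m x).
Proof.
by move=> h; rewrite !mulmxA h mul1mx -(mulmxA Gi) h mulmx1.
Qed.

(** * Finitely many images of bounded index *)

Section FinitelyManyImages.
Context (F : fieldType) (L : fieldExtType F).
Context (inf : place F) (infL : place L).
Context (Fhat : forall v : place F, completion v).
Context (Lhat : forall w : place L, completion w).
Context (iota : {rmorphism adele inf Fhat -> adele infL Lhat}).
Context (r r' : nat) (K : level inf Fhat r).
Local Notation AF := (adele inf Fhat).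
Local Notation AL := (adele infL Lhat).
Local Notation PF := (fplace inf).
Local Notation PL := (fplace infL).

Context (u : PL -> PF) (e : PL -> nat).
Hypothesis e_gt0 : forall w, (0 < e w)%N.
Hypothesis iota_zero : forall (a : AF) w, a (u w) = 0 -> iota a w = 0.
Hypothesis iota_val : forall (a : AF) w, a (u w) != 0 ->
  iota a w != 0 /\
  cval (Lhat (sval w)) (iota a w) = (e w)%:Z * cval (Fhat (sval (u w))) (a (u w)).
Hypothesis frF : forall v : PF, finite_residue (cval (Fhat (sval v))).
Hypothesis r'_gt0 : (0 < r')%N.
Context (B : nat).
Hypothesis finS : finite_set (@small_residue F inf Fhat B).
Local Notation cond := (idele Fhat (fsupp_conductor finS)).

Definition normalized (b : adelic_linear iota r r') (beta : 'cV[AL]_r' -> 'cV[AF]_r) :=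
  [/\ cancel b beta, cancel beta b,
      forall y, mintegral y -> level_lattice K (beta y) &
      forall x, level_lattice K x -> mintegral (iota cond *: b x)].

Lemma exists_normalized (b : adelic_linear iota r r') (M : set (GL AL r')) (i : nat) :
  bijective b -> maximal_compact_subgroup M -> pullback_level K b `<=` M ->
  has_index M (pullback_level K b) i -> (i <= B)%N ->
  exists (h s : GL AL r') beta,
    normalized (GL_adelic_map s (GL_adelic_map h b)) beta.
Proof.
move=> [beta bK betaK] mM _ hi iB.
have frL w := finite_residue_above e_gt0 iota_zero iota_val bK betaK frF r'_gt0 w.
have [h eM] := maximal_compact_is_conj frL mM.
have sP := pullback_subgroup K b.
pose b1 := GL_adelic_map h^-1%g b; pose beta1 y := beta (GLmx h *m y).
have b1K : cancel b1 beta1.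
  move=> x; rewrite /b1 /beta1 GL_adelicE mulmxA.
  by rewrite -[GLmx h^-1%g]/(GLinvmx h) (GLmulV h) mul1mx bK.
have beta1K : cancel beta1 b1.
  move=> y; rewrite /b1 /beta1 GL_adelicE betaK mulmxA.
  by rewrite -[GLmx h^-1%g]/(GLinvmx h) (GLmulVl h) mul1mx.
have pigeon (g : 'I_B.+1 -> GL AL r') : (forall k, GLint (g k)) ->
    exists k l : 'I_B.+1, (k < l)%N /\ pullback_level K b1 ((g l)^-1 * g k)%g.
  move=> gint; have gM k : M (h * g k * h^-1)%g.
    by rewrite eM /GLint_conj /= conj_conjV; exact: gint.
  have [k [l [kl [k0 Kk0 hk0]]]] := index_pigeonhole sP hi iB gM.
  exists k, l; split; first exact: kl.
  exists k0; first exact: Kk0.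
  move=> x; rewrite /b1 !GL_adelicE -hk0.
  rewrite -[GLmx h^-1%g]/(GLinvmx h).
  rewrite -[GLmx ((g l)^-1 * g k)%g]/(GLinvmx (g l) *m GLmx (g k)).
  rewrite -[GLmx ((h * g l * h^-1)^-1 * _)%g]/((GLmx h *m (GLinvmx (g l) *m GLinvmx h)) *m
     ((GLmx h *m GLmx (g k)) *m GLinvmx h)).
  exact/esym/mulmx_conj_cancel/GLmulVl.
have [a [a' [aa' ha ha']]] := normalizing_idele e_gt0 iota_zero iota_val frF finS
  b1K beta1K pigeon r'_gt0.
have s1 : a'%:M *m a%:M = 1%:M :> 'M[AL]_r' by rewrite -scalar_mxM mulrC aa'.
have s2 : a%:M *m a'%:M = 1%:M :> 'M[AL]_r' by rewrite -scalar_mxM aa'.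
exists h^-1%g, (MkGL s1 s2), (fun y => beta1 (a *: y)); split.
- by move=> x; rewrite GL_adelicE /= mul_scalar_mx scalerA aa' scale1r b1K.
- by move=> y; rewrite GL_adelicE /= mul_scalar_mx beta1K scalerA mulrC aa' scale1r.
- exact: ha.
- move=> x hx; rewrite GL_adelicE /= mul_scalar_mx; apply: ha'.
  by rewrite /image_lattice b1K.
Qed.

(** Take g = [beta0] o [b1]. Lambda contains pi^n O_F^r, where C [b1] takes integral values; [beta0]
    sends these into Lambda, hence to integral vectors. So C pi^n g is integral, with a bound that
    does not involve the two maps. Exchanging them treats g^-1. *)
Lemma transition_bounded : exists2 m : PF -> int, fsupp m &
  forall b0 beta0 b1 beta1, normalized b0 beta0 -> normalized b1 beta1 ->
    exists g : GL AF r, GLbounded m g /\ forall x, b1 x = b0 (GLmx g *m x).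
Proof.
have [n fn hn] := level_lattice_box K.
exists (fun v => (0 - conductor Fhat B v) - n v).
  apply: (fsupp2 (f := fun x y => x - y)) => //.
  apply: (fsupp1 (f := fun x => 0 - x)) => //; exact: fsupp_conductor.
have half b0 beta0 b1 beta1 (M : 'M[AF]_r) :
    normalized b0 beta0 -> normalized b1 beta1 ->
    (forall x, beta0 (b1 x) = M *m x) ->
    mbox (fun v => (0 - conductor Fhat B v) - n v) M.
  move=> [b0K beta0K int0 _] [_ _ _ int1] hM i j.
  have : mintegral (cond *: (idele Fhat fn *: (M *m (delta_mx j 0 : 'cV[AF]_r)))).
    rewrite -hM -(betaZ b0K beta0K) -(betaZ b0K beta0K) -(adelicZ b1).
    apply: (@level_lattice_int _ _ _ _ K); apply: int0; apply: int1; apply: hn.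
    apply/mbox_ideleM => p q v; rewrite subrr mxE.
    by case: (_ && _); [exact: vge1|exact: vge0].
  move=> /mbox_ideleM/mbox_ideleM/(_ i 0).
  by rewrite -colE mxE.
move=> b0 beta0 b1 beta1 N0 N1.
have [b0K beta0K _ _] := N0; have [b1K beta1K _ _] := N1.
have [||||g [g1 g2]] := @linear_GL AF r (fun x => beta0 (b1 x)) (fun x => beta1 (b0 x)).
- by move=> x y; rewrite adelicD (betaD b0K beta0K).
- by move=> c x; rewrite adelicZ (betaZ b0K beta0K).
- by move=> x; rewrite beta0K b1K.
- by move=> x; rewrite beta1K b0K.
exists g; split; last by move=> x; rewrite -g1 beta0K.
by split; [exact: half N0 N1 g1|exact: half N1 N0 g2].
Qed.

End FinitelyManyImages.

Theorem theorem4p3p5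
  (* the global function field F with constant field k, the place inf *)
  (k : finFieldType) (F : fieldExtType {fraction {poly k}})
  (Fconst : full_constant_field F)
  (inf : place F) (Fhat : forall v : place F, completion v)
  (* C_infinity *)
  (R : realType) (C : closedFieldType) (absC : C -> R)
  (jF : {rmorphism F -> C}) (Cinfty : is_Cinfty inf absC jF)
  (* the Drinfeld modular variety S = S^r_{F,K} *)
  (r : nat) (r_gt0 : (0 < r)%N) (K : level inf Fhat r)
  (* the common reflex field F' = jL(L), with its unique place above inf *)
  (L : fieldExtType F) (jL : {rmorphism L -> C})
  (jLF : forall x : F, jL x%:A = jF x)
  (infL : place L) (infL_over : lies_over infL inf)
  (infL_unique : forall w : place L, lies_over w inf -> w = infL)
  (Lhat : forall w : place L, completion w)
  (iota : {rmorphism adele inf Fhat -> adele infL Lhat})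
  (iota_canonical : canonical_adele_map iota)
  (r' : nat) (r_eq : r = (r' * \dim {:L})%N)
  (* the sequence of Drinfeld modular subvarieties *)
  (X : nat -> set (drinfeld_points absC jF K))
  (X_sub : forall n, drinfeld_subvariety jL iota r' (X n))
  (X_distinct : forall m n, m <> n -> X m <> X n) :
  forall B : nat, exists n : nat, (B < drinfeld_index jL iota r' (X n))%N.
Proof.
move=> B; apply: contrapT => /forallNP small.
have r'_gt0 : (0 < r')%N by move: r_gt0; rewrite r_eq; case: (r').
have frF v := level_finite_residue K v r_gt0.
have [u [e [e_gt0 iota_zero iota_val]]] :=
  canonical_map_places infL_unique iota_canonical.
have finS := @finite_small_residue k F inf Fhat B.
have normal n : exists (b : adelic_linear iota r r')
    (beta : 'cV[adele infL Lhat]_r' -> 'cV[adele inf Fhat]_r),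
    normalized K finS b beta /\ X n = inclusion_image jL b.
  have index_le : (drinfeld_index jL iota r' (X n) <= B)%N.
    by rewrite leqNgt; apply/negP/small.
  have [b0 bij0 eX0] := X_sub n.
  (* Some index exists for [b0], so [xget] returns a genuine index instead of its default 0. The
     proof then continues with the [b] and [M] that realize the returned value, which may differ
     from [b0] and [M0]. *)
  have [M0 [i0 h0]] : exists M i, [/\ maximal_compact_subgroup M,
      pullback_level K b0 `<=` M & has_index M (pullback_level K b0) i].
    have [beta0 b0K beta0K] := bij0.
    exact: (pullback_index e_gt0 iota_zero iota_val frF K b0K beta0K r'_gt0).
  have : is_index jL iota r' (X n) (drinfeld_index jL iota r' (X n)).
    apply: (@xgetPex _ 0%N [set i | is_index jL iota r' (X n) i]).
    by exists i0, b0, M0; case: h0.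
  move=> [b [M [bij eX mM subM idxM]]].
  have [h [s [beta nb]]] :=
    exists_normalized e_gt0 iota_zero iota_val frF r'_gt0 finS bij mM subM idxM index_le.
  exists (GL_adelic_map s (GL_adelic_map h b)), beta; split; first exact: nb.
  by rewrite !inclusion_image_GL.
have [b hb] := choice normal.
have {hb}[beta hb] := choice hb.
have [m fm trans] := transition_bounded iota r' K finS.
have [g hg] := choice (fun n => trans _ _ _ _ (hb 0%N).1 (hb n).1).
have [N [cl hcl]] := compact_coset_label
  (@compact_GLbounded F inf Fhat r frF m fm) (level_subgroup K) (level_nbhs K).
(* The matrices [g n], all measured from [b 0], lie in one compact set, which meets at most N + 1
   cosets of [K]: among N + 2 of them two share a coset. *)
have [p [q [pq epq]]] : exists p q : 'I_N.+2, p <> q /\ cl (g p) = cl (g q).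
  apply: contrapT => hn.
  have inj : injective (fun n : 'I_N.+2 => cl (g n)).
    by move=> p q epq; apply: contrapT => pq; apply: hn; exists p, q.
  by have := leq_card _ inj; rewrite !card_ord ltnn.
have Kpq := hcl _ _ (hg p).1 (hg q).1 epq.
have /X_distinct : nat_of_ord q <> p by move=> /val_inj/esym.
apply.
rewrite (hb p).2 (hb q).2.
have := @inclusion_image_level F L inf infL Fhat Lhat R C absC jF jL iota r r' K (b p) (b q) _ Kpq.
apply=> x.
rewrite (hg q).2 (hg p).2; congr (b 0%N _).
rewrite -[GLmx ((g p)^-1 * g q)%g]/(GLinvmx (g p) *m GLmx (g q)) !mulmxA.
by rewrite (GLmulV (g p)) mul1mx.
Qed.
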